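(* Let $0<\varepsilon\le 1$ and suppose that $\gamma_\varepsilon\ge 8L$. Then the renormalized equation $\dot v^\varepsilon+A_\varepsilon v^\varepsilon=F(v^\varepsilon)$ possesses a finite-dimensional Lipschitz inertial manifold $$\mathcal M_\varepsilon=\{p+h_\varepsilon(p):p\in P_\varepsilon\mathcal H\},\qquad h_\varepsilon:P_\varepsilon\mathcal H\to Q_\varepsilon\mathcal H,$$ where the graph map satisfies $$\|h_\varepsilon\|_{L^\infty(P_\varepsilon\mathcal H;\mathcal H)}\le\frac{M}{\alpha_\varepsilon}\le\frac{M\varepsilon^2}{\mu+\varepsilon}\le\frac M\mu\varepsilon^2,\qquad \operatorname{Lip}(h_\varepsilon)\le\frac{4L}{\gamma_\varepsilon}\le 4L\varepsilon .$$ Moreover $S_\varepsilon(t)\mathcal M_\varepsilon=\mathcal M_\varepsilon$ for all $t\ge0$, and the dynamics on $\mathcal M_\varepsilon$ are governed by the finite-dimensional equation $$\dot p+Ap=P_\varepsilon F\bigl(p+h_\varepsilon(p)\bigr),\qquad p\in P_\varepsilon\mathcal H.$$ Finally, there exist constants $C_\varepsilon\ge1$ and $\varkappa_\varepsilon>0$ such that for every $u_0\in\mathcal H$ there exists $\widetilde u_0\in\mathcal M_\varepsilon$ with $$\|S_\varepsilon(t)u_0-S_\varepsilon(t)\widetilde u_0\|_{\mathcal H}\le C_\varepsilon e^{-\varkappa_\varepsilon t}\|u_0-\widetilde u_0\|_{\mathcal H},\qquad t\ge0.$$ Consequently, whenever $S_\varepsilon(t)$ possesses a global attractor $\mathcal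 A_\varepsilon$, one has $\mathcal A_\varepsilon\subset\mathcal M_\varepsilon$.
   Context: $\mathcal H$ is an infinite-dimensional real Hilbert space and $A:\mathrm D(A)\subset\mathcal H\to\mathcal H$ is a nonnegative self-adjoint operator with compact resolvent, with eigenvalues (repeated by multiplicity) $0\le\lambda_1\le\lambda_2\le\cdots\to\infty$. The map $F:\mathcal H\to\mathcal H$ satisfies, for constants $M,L>0$, $\|F(u)\|_{\mathcal H}\le M$ and $\|F(u)-F(w)\|_{\mathcal H}\le L\|u-w\|_{\mathcal H}$ for all $u,w\in\mathcal H$. Fix $\mu>0$. For $0<\varepsilon\le1$ let $\Lambda_\varepsilon=\mu\varepsilon^{-2}$, $P_\varepsilon=\mathbf 1_{[0,\Lambda_\varepsilon]}(A)$ (orthogonal spectral projection, finite rank), $Q_\varepsilon=I-P_\varepsilon$, and $A_\varepsilon=A+\varepsilon^{-1}Q_\varepsilon$ with $\mathrm D(A_\varepsilon)=\mathrm D(A)$. Put $\beta_\varepsilon=\sup\sigma(A|_{P_\varepsilon\mathcal H})$ (with $\beta_\varepsilon=0$ if $P_\varepsilon\mathcal H=\{0\}$), $\lambda_\varepsilon^+=\inf\sigma(A|_{Q_\varepsilon\mathcal H})$, $\alpha_\varepsilon=\lambda_\varepsilon^++\varepsilon^{-1}$ and $\gamma_\varepsilon=\alpha_\varepsilon-\beta_\varepsilon$. $S_\varepsilon(t)$ denotes the semiflow on $\mathcal H$ of global mild solutions of $\dot v^\varepsilon+A_\varepsilon v^\varepsilon=F(v^\varepsilon)$. An inertial manifold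 for a semiflow $T(t)$ on $\mathcal H$ is a finite-dimensional Lipschitz submanifold $\mathcal M\subset\mathcal H$ which is invariant, contains the global attractor whenever the latter exists, and has the exponential tracking property: there are $\varkappa>0$, $C\ge1$ such that for every $u_0\in\mathcal H$ there is $\bar u_0\in\mathcal M$ with $\|T(t)u_0-T(t)\bar u_0\|_{\mathcal H}\le Ce^{-\varkappa t}\|u_0-\bar u_0\|_{\mathcal H}$ for $t\ge0$. *)

(* Defs.v *)
From Stdlib Require Import Reals.
From Coquelicot Require Import Coquelicot.
Open Scope R_scope.

(** * Real Hilbert spaces *)

(* The norm is Coquelicot's norm of the complete normed module; completeness is
   that of [CompleteNormedModule]. *)
Record HilbertSpace := {
  carrier :> CompleteNormedModule R_AbsRing;
  inner : carrier -> carrier -> R;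
  inner_sym : forall x y, inner x y = inner y x;
  inner_plus_l : forall x y z, inner (plus x y) z = inner x z + inner y z;
  inner_scal_l : forall (a : R) x y, inner (scal a x) y = a * inner x y;
  inner_norm : forall x, inner x x = norm x ^ 2
}.

Arguments inner {h} _ _.

Section Definitions.

Context {H : HilbertSpace}.

(** * Linear algebra *)

Definition whole : H -> Prop := fun _ => True.

Definition range (T : H -> H) : H -> Prop := fun u => exists v, u = T v.

(* The sum of [scal (c i) (e i)] over [i < n]. *)
Fixpoint lincomb (n : nat) (c : nat -> R) (e : nat -> H) : H :=
  match n with
  | O => zero
  | S m => plus (lincomb m c e) (scal (c m) (e m))
  end.

Definition span (X : H -> Prop) : H -> Prop := fun u =>
  exists (n : nat) (c : nat -> R) (e : nat -> H),
    (forall i, (i < n)%nat -> X (e i)) /\ u = lincomb n c e.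

Definition has_dimension (V : H -> Prop) (n : nat) : Prop :=
  exists e : nat -> H,
    (forall u, V u <-> exists c, u = lincomb n c e) /\
    (forall c, lincomb n c e = zero -> forall i, (i < n)%nat -> c i = 0).

Definition finite_dimensional (V : H -> Prop) : Prop :=
  exists n, has_dimension V n.

Definition closure (X : H -> Prop) : H -> Prop := fun u =>
  forall d : R, 0 < d -> exists v, X v /\ norm (minus u v) < d.

Definition is_orthogonal_projection (V : H -> Prop) (P : H -> H) : Prop :=
  forall u, V (P u) /\ forall v, V v -> inner (minus u (P u)) v = 0.

Definition complement_of (P : H -> H) : H -> H := fun u => minus u (P u).

(** * Compactness *)

Definition converging_subsequence_to (u : nat -> H) (l : H) : Prop :=
  exists phi : nat -> nat,
    (forall n m, (n < m)%nat -> (phi n < phi m)%nat) /\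
    filterlim (fun n => u (phi n)) eventually (locally l).

Definition bounded_set (B : H -> Prop) : Prop :=
  exists C : R, forall u, B u -> norm u <= C.

Definition compact_set (K : H -> Prop) : Prop :=
  forall u : nat -> H, (forall n, K (u n)) ->
    exists l, K l /\ converging_subsequence_to u l.

Definition compact_operator (T : H -> H) : Prop :=
  forall (u : nat -> H) (C : R), (forall n, norm (u n) <= C) ->
    exists l, converging_subsequence_to (fun n => T (u n)) l.

(** * Unbounded operators

   An unbounded operator is given by its domain [D] and a total function [A]
   whose values outside [D] are irrelevant. *)

Definition linear_operator (D : H -> Prop) (A : H -> H) : Prop :=
  D zero /\
  (forall x y, D x -> D y -> D (plus x y) /\ A (plus x y) = plus (A x) (A y)) /\
  (forall (a : R) x, D x -> D (scal a x) /\ A (scal a x) = scal a (A x)).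

(* [D (A^* )] is the set of [y] for which such a [z] exists, and [A^* y = z]. *)
Definition adjoint_graph (D : H -> Prop) (A : H -> H) (y z : H) : Prop :=
  forall x, D x -> inner (A x) y = inner x z.

Definition self_adjoint (D : H -> Prop) (A : H -> H) : Prop :=
  linear_operator D A /\
  (forall u, closure D u) /\
  (forall y z, adjoint_graph D A y z <-> D y /\ A y = z).

Definition nonnegative (D : H -> Prop) (A : H -> H) : Prop :=
  forall x, D x -> 0 <= inner (A x) x.

(* [T] is the bounded inverse of [A|_V - lambda], where [A|_V] is the part of [A]
   in the invariant subspace [V], with domain the intersection of [D] and [V].
   [T] is irrelevant outside [V]. *)
Definition is_resolvent (D : H -> Prop) (A : H -> H) (V : H -> Prop)
    (lambda : R) (T : H -> H) : Prop :=
  (forall y, V y ->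
     D (T y) /\ V (T y) /\ minus (A (T y)) (scal lambda (T y)) = y) /\
  (forall x, D x -> V x -> T (minus (A x) (scal lambda x)) = x) /\
  (exists C : R, forall y, V y -> norm (T y) <= C * norm y).

Definition spectrum (D : H -> Prop) (A : H -> H) (V : H -> Prop) : R -> Prop :=
  fun lambda => ~ exists T, is_resolvent D A V lambda T.

Definition compact_resolvent (D : H -> Prop) (A : H -> H) : Prop :=
  exists (lambda : R) (T : H -> H),
    is_resolvent D A whole lambda T /\ compact_operator T.

(* Range of the spectral projection [1_B(A)]. A self-adjoint operator with compact
   resolvent has pure point spectral measure, so that [1_B(A)] is the orthogonal
   projection onto the closed span of the eigenspaces with eigenvalue in [B]. *)
Definition spectral_subspace (D : H -> Prop) (A : H -> H) (B : R -> Prop)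
    : H -> Prop :=
  closure (span (fun u => D u /\ exists lambda : R, B lambda /\ A u = scal lambda u)).

Definition is_spectral_projection (D : H -> Prop) (A : H -> H) (B : R -> Prop)
    (P : H -> H) : Prop :=
  is_orthogonal_projection (spectral_subspace D A B) P.

(** * Semigroups and mild solutions *)

Definition C0_semigroup (E : R -> H -> H) : Prop :=
  (forall t, 0 <= t -> is_linear (E t)) /\
  (forall x, E 0 x = x) /\
  (forall s t x, 0 <= s -> 0 <= t -> E (s + t) x = E s (E t x)) /\
  (forall x, filterlim (fun t => E t x) (at_right 0) (locally x)).

(* [E t = exp (- t A)]: the generator of [E] is [-A], with domain exactly [D]. *)
Definition exp_semigroup (D : H -> Prop) (A : H -> H) (E : R -> H -> H) : Prop :=
  C0_semigroup E /\
  forall x y,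
    filterlim (fun t : R => scal (/ t) (minus (E t x) x)) (at_right 0) (locally y)
    <-> D x /\ y = opp (A x).

Definition continuous_on_halfline (v : R -> H) : Prop :=
  forall t, 0 <= t ->
    filterlim v (within (fun s => 0 <= s) (locally t)) (locally (v t)).

(* Global mild solutions of [v' + A v = F v], [v 0 = u0], where [E t = exp (- t A)]. *)
Definition is_mild_solution (E : R -> H -> H) (F : H -> H) (u0 : H) (v : R -> H)
    : Prop :=
  continuous_on_halfline v /\
  forall t, 0 <= t ->
    ex_RInt (fun s => E (t - s) (F (v s))) 0 t /\
    v t = plus (E t u0) (RInt (fun s => E (t - s) (F (v s))) 0 t).

Definition is_mild_semiflow (D : H -> Prop) (A : H -> H) (F : H -> H)
    (T : R -> H -> H) : Prop :=
  exists E, exp_semigroup D A E /\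
    forall u0, is_mild_solution E F u0 (fun t => T t u0).

(** * Attractors and inertial manifolds *)

Definition invariant (T : R -> H -> H) (X : H -> Prop) : Prop :=
  forall t, 0 <= t -> forall u, X u <-> exists w, X w /\ u = T t w.

Definition global_attractor (T : R -> H -> H) (K : H -> Prop) : Prop :=
  compact_set K /\
  invariant T K /\
  forall B, bounded_set B -> forall d : R, 0 < d ->
    exists t0 : R, forall t u, t0 <= t -> 0 <= t -> B u ->
      exists k, K k /\ norm (minus (T t u) k) < d.

Definition lipschitz_on (V : H -> Prop) (h : H -> H) (c : R) : Prop :=
  forall p q, V p -> V q -> norm (minus (h p) (h q)) <= c * norm (minus p q).

Definition graph_over (V : H -> Prop) (h : H -> H) : H -> Prop :=
  fun u => exists p, V p /\ u = plus p (h p).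

(* Locally the graph of a Lipschitz map from an [n]-dimensional subspace to its
   orthogonal complement. *)
Definition lipschitz_submanifold (n : nat) (X : H -> Prop) : Prop :=
  forall x, X x ->
    exists (V : H -> Prop) (h : H -> H) (c r : R),
      has_dimension V n /\
      (forall p v, V p -> V v -> inner (h p) v = 0) /\
      lipschitz_on V h c /\
      0 < r /\
      forall u, norm (minus u x) < r -> (X u <-> graph_over V h u).

Definition exponential_tracking (T : R -> H -> H) (X : H -> Prop) : Prop :=
  exists C kappa : R, 1 <= C /\ 0 < kappa /\
    forall u0, exists w0, X w0 /\
      forall t, 0 <= t ->
        norm (minus (T t u0) (T t w0))
        <= C * exp (- kappa * t) * norm (minus u0 w0).

Definition inertial_manifold (T : R -> H -> H) (X : H -> Prop) : Prop :=
  (exists n, lipschitz_submanifold n X) /\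
  invariant T X /\
  (forall K, global_attractor T K -> forall u, K u -> X u) /\
  exponential_tracking T X.

(* One-sided at [t = 0]. *)
Definition derivative_on_halfline (p : R -> H) (t : R) (l : H) : Prop :=
  filterlim (fun s => scal (/ (s - t)) (minus (p s) (p t)))
    (within (fun s => 0 <= s) (locally' t)) (locally l).

(** * The renormalized problem *)

Definition cutoff (mu eps : R) : R := mu / eps ^ 2.

Definition renormalized (A P : H -> H) (eps : R) : H -> H :=
  fun u => plus (A u) (scal (/ eps) (complement_of P u)).

(* [Lub_Rbar] of the empty set is [m_infty], whose [real] part is [0]: this is the
   convention [beta = 0] when [range P] is trivial. *)
Definition beta (D : H -> Prop) (A P : H -> H) : R :=
  real (Lub_Rbar (spectrum D A (range P))).

Definition lambda_plus (D : H -> Prop) (A P : H -> H) : R :=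
  real (Glb_Rbar (spectrum D A (range (complement_of P)))).

Definition alpha (D : H -> Prop) (A P : H -> H) (eps : R) : R :=
  lambda_plus D A P + / eps.

Definition gamma (D : H -> Prop) (A P : H -> H) (eps : R) : R :=
  alpha D A P eps - beta D A P.

(* [p' + A p = P F (p + h p)] in [range P], for [t >= 0]. *)
Definition reduced_solution (D : H -> Prop) (A P F h : H -> H) (p : R -> H) : Prop :=
  forall t, 0 <= t ->
    range P (p t) /\ D (p t) /\
    exists l, derivative_on_halfline p t l /\
      plus l (A (p t)) = P (F (plus (p t) (h (p t)))).

End Definitions.

(* Main.v *)
(** The invariant graph is the limit, as [T] tends to infinity, of the images under [S T]
    of the flat slice [range P]; no Lyapunov-Perron integral is needed.

    For the difference of two trajectories let [q] and [p] be the norms of its components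
    in the ranges of [I - P] and [P].  Their Dini derivatives satisfy
    [q' <= - alpha q + L (q + p)] and [p' >= - beta p - L (q + p)], so that
    [(q - k p)' <= (- alpha + (1 + k) L) (q - k p)] as soon as
    [(1 + k) ^ 2 L <= (alpha - beta) k].  By Gronwall the cones [q <= k p] are forward
    invariant; the gap condition allows [k = 1] and [k = 4 L / gamma].  Conversely, if
    [p] vanishes at time [T], then [p <= q] on [[0, T]], where [q] therefore decays like
    [exp (- (alpha - 2 L) t)].  This squeezing makes the images of [range P] a Cauchy
    family of graphs over [range P] (a contraction argument for short times shows that
    they stay graphs over the whole of it), identifies every state with a bounded past
    as a point of the limit, and makes the points [w] of the manifold with
    [P (S T w) = P (S T u)] converge to a tracking initial value of [u]: they separate at
    a rate of at most [beta + 2 L] inside the cone, which is less than [alpha - 2 L].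

    On the linear side, [range P] has finite dimension because the resolvent is compact,
    the infimum of the numerical range of [A] on the kernel of [P] belongs to the
    spectrum, and the part of the spectrum below the cutoff is excluded there by the
    Fredholm alternative. *)

(* The dynamics rest instead on the expansion [v (t + r) = E r (v t) + r F (v t) + o(r)] as [r]
   decreases to 0, which turns bounds on the linear semigroup into one-sided differential
   inequalities; a single Gronwall lemma for upper right Dini derivatives serves them all.

   The semigroup in turn is known only through its generator. Contractivity, commutation with [P]
   and decay on the kernel of [P] are proved on the domain, where energy estimates are legitimate,
   and extended by density; the extension presupposes local boundedness, which comes from a uniform
   boundedness argument.

   No spectral theorem is invoked: below the cutoff a finite eigenbasis suffices, and on the kernel
   of [P] only a lower bound of the quadratic form matters.

   The gap condition enters as [4 L <= alpha - beta] (the cone with [k = 1]), as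
   [alpha - beta - 4 L > 0] (convergence in the tracking) and as [4 L / gamma <= 1 / 2] (the cone
   behind the Lipschitz constant). *)
From Stdlib Require Import ssreflect.
Require Import Defs.
From Stdlib Require Import Reals Lra Lia Classical ClassicalEpsilon.
From Coquelicot Require Import Coquelicot.
Open Scope R_scope.

(** * Hilbert space preliminaries *)

Section Hilbert.

Context {H : HilbertSpace}.
Implicit Types x y z : H.

Lemma inner_zero_l z : inner (zero : H) z = 0.
Proof.
  replace (zero : H) with (scal 0 z) by apply (scal_zero_l z).
  rewrite inner_scal_l; ring.
Qed.

Lemma inner_opp_l x z : inner (opp x) z = - inner x z.
Proof.
  assert (E : inner (plus x (opp x)) z = 0)
    by (replace (plus x (opp x)) with (zero : H) by (symmetry; apply (plus_opp_r x));
        apply inner_zero_l).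
  rewrite inner_plus_l in E; lra.
Qed.

Lemma inner_minus_l x y z : inner (minus x y) z = inner x z - inner y z.
Proof. unfold minus; rewrite inner_plus_l inner_opp_l; ring. Qed.

Lemma inner_plus_r x y z : inner z (plus x y) = inner z x + inner z y.
Proof. rewrite inner_sym inner_plus_l !(inner_sym _ _ z); reflexivity. Qed.

Lemma inner_scal_r a x z : inner z (scal a x) = a * inner z x.
Proof. rewrite inner_sym inner_scal_l (inner_sym _ _ z); reflexivity. Qed.

Lemma inner_zero_r z : inner z (zero : H) = 0.
Proof. rewrite inner_sym; apply inner_zero_l. Qed.

Lemma inner_minus_r x y z : inner z (minus x y) = inner z x - inner z y.
Proof. rewrite inner_sym inner_minus_l !(inner_sym _ _ z); reflexivity. Qed.

Lemma inner_opp_r x z : inner z (opp x) = - inner z x.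
Proof. rewrite inner_sym inner_opp_l (inner_sym _ _ z); reflexivity. Qed.

Lemma norm_pos x : 0 <= norm x.
Proof. exact (norm_ge_0 (V := H) x). Qed.

Lemma norm_zero_eq x : norm x = 0 -> x = zero.
Proof. exact (norm_eq_zero (V := H) x). Qed.

Lemma norm_0 : norm (zero : H) = 0.
Proof. exact (norm_zero (V := H)). Qed.

Lemma minus_eq x y : minus x y = zero -> x = y.
Proof.
  intro E; symmetry; etransitivity; [symmetry; apply (plus_zero_r y) |].
  etransitivity; [apply (f_equal (plus y)); symmetry; exact E |].
  etransitivity; [apply (f_equal (plus y) (plus_comm x (opp y))) |].
  etransitivity; [apply (plus_assoc y (opp y) x) |].
  etransitivity; [apply (f_equal (fun v => plus v x) (plus_opp_r y)) |].
  apply (plus_zero_l x).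
Qed.

Lemma inner_ext x y : (forall z, inner x z = inner y z) -> x = y.
Proof.
  intro E; apply minus_eq, norm_zero_eq.
  assert (N : norm (minus x y) ^ 2 = 0).
  { rewrite -inner_norm inner_minus_l E; ring. }
  nra.
Qed.

End Hilbert.

Ltac inner_expand :=
  unfold complement_of in *;
  rewrite ?(inner_plus_l, inner_scal_l, inner_opp_l, inner_minus_l,
            inner_zero_l, inner_plus_r, inner_scal_r, inner_opp_r,
            inner_minus_r, inner_zero_r).

(* A vector identity is checked by pairing both sides with an arbitrary vector. *)
Ltac vec :=
  apply inner_ext; let z := fresh "z" in intro z;
  inner_expand; try ring; try (field; auto with real).

(* [norm] reads its argument in the underlying [NormedModule]; [lra] needs a single
   syntactic form of the vector operations. *)
Ltac canon :=
  match goal with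
  | h : HilbertSpace |- _ =>
    let N := constr:(CompleteNormedModule.NormedModule R_AbsRing (carrier h)) in
    change (@minus (NormedModule.AbelianGroup R_AbsRing N))
      with (@minus (CompleteNormedModule.AbelianGroup R_AbsRing (carrier h))) in *;
    change (@opp (NormedModule.AbelianGroup R_AbsRing N))
      with (@opp (CompleteNormedModule.AbelianGroup R_AbsRing (carrier h))) in *;
    change (@plus (NormedModule.AbelianMonoid R_AbsRing N))
      with (@plus (CompleteNormedModule.AbelianMonoid R_AbsRing (carrier h))) in *
  end.

(* Unlike [replace], this finds the redex up to conversion of the various
   canonical structure paths that lead to the same vector operation. *)
Tactic Notation "vreplace" constr(a) "with" constr(b) :=
  let E := fresh "E" in assert (E : a = b) by vec; rewrite E; clear E.
Tactic Notation "vreplace" constr(a) "with" constr(b) "in" hyp(h) :=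
  let E := fresh "E" in assert (E : a = b) by vec; rewrite E in h; clear E.

Section Hilbert2.

Context {H : HilbertSpace}.
Implicit Types x y z : H.

Lemma norm_scal_eq a x : norm (scal a x : H) = Rabs a * norm x.
Proof.
  assert (E : norm (scal a x) ^ 2 = (Rabs a * norm x) ^ 2).
  { rewrite -inner_norm; inner_expand; rewrite inner_norm.
    rewrite Rpow_mult_distr pow2_abs; ring. }
  pose proof (norm_pos (scal a x)); pose proof (norm_pos x); pose proof (Rabs_pos a).
  assert (0 <= Rabs a * norm x) by nra.
  nra.
Qed.

Lemma norm_scal_pos a x : 0 <= a -> norm (scal a x : H) = a * norm x.
Proof. intro; rewrite norm_scal_eq Rabs_pos_eq; auto. Qed.

Lemma norm_opp_eq x : norm (opp x) = norm x.
Proof. exact (norm_opp (V := H) x). Qed.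

Lemma norm_plus_le x y : norm (plus x y) <= norm x + norm y.
Proof. exact (norm_triangle (V := H) x y). Qed.

Lemma norm_minus_sym x y : norm (minus x y) = norm (minus y x).
Proof. rewrite -norm_opp_eq; f_equal; vec. Qed.

Lemma norm_minus_le x y : norm (minus x y) <= norm x + norm y.
Proof. unfold minus; rewrite -(norm_opp_eq y); apply norm_plus_le. Qed.

Lemma norm_minus_triangle y x z : norm (minus x z) <= norm (minus x y) + norm (minus y z).
Proof.
  replace (minus x z) with (plus (minus x y) (minus y z)) by vec.
  apply norm_plus_le.
Qed.

Lemma norm_le_minus x y : norm x <= norm y + norm (minus x y).
Proof.
  replace x with (plus y (minus x y)) at 1 by vec.
  apply norm_plus_le.
Qed.

Lemma norm_minus_ge x y : Rabs (norm x - norm y) <= norm (minus x y).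
Proof.
  apply Rabs_le; split.
  - pose proof (norm_le_minus y x) as T; rewrite norm_minus_sym in T; lra.
  - pose proof (norm_le_minus x y); lra.
Qed.

Lemma minus_self x : minus x x = (zero : H).
Proof. vec. Qed.

Lemma cauchy_schwarz x y : Rabs (inner x y) <= norm x * norm y.
Proof.
  destruct (Req_dec (norm y) 0) as [E | N].
  - apply norm_zero_eq in E; subst y.
    rewrite inner_zero_r Rabs_R0 norm_0; lra.
  - assert (Py : 0 < norm y) by (pose proof (norm_pos y); lra).
    (* Up to the factor [norm y ^ 2], this is the component of [x] orthogonal to [y]; its square
       being nonnegative is the claim. *)
    set (w := minus (scal (norm y ^ 2) x) (scal (inner x y) y)).
    assert (Q : 0 <= inner w w) by (rewrite inner_norm; apply pow2_ge_0).
    revert Q; unfold w; inner_expand.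
    rewrite !inner_norm. rewrite (inner_sym _ y x). intro Q.
    assert (Q' : 0 <= norm y ^ 2 * ((norm x * norm y) ^ 2 - inner x y ^ 2)) by nra.
    assert (0 < norm y ^ 2) by (apply pow_lt; auto).
    assert (inner x y ^ 2 <= (norm x * norm y) ^ 2) by nra.
    assert (0 <= norm x * norm y) by (apply Rmult_le_pos; apply norm_pos).
    apply Rabs_le; split; nra.
Qed.

Lemma inner_le x y : inner x y <= norm x * norm y.
Proof. eapply Rle_trans; [apply Rle_abs | apply cauchy_schwarz]. Qed.

Lemma norm_le_of_sq x c : 0 <= c -> inner x x <= c ^ 2 -> norm x <= c.
Proof. intros Hc; rewrite inner_norm; pose proof (norm_pos x); nra. Qed.

Lemma norm_sq_plus x y :
  inner (plus x y) (plus x y) = norm x ^ 2 + 2 * inner x y + norm y ^ 2.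
Proof. inner_expand; rewrite !inner_norm (inner_sym _ y x); ring. Qed.

Definition converges (u : nat -> H) (l : H) : Prop :=
  forall e, 0 < e -> exists N, forall n, (N <= n)%nat -> norm (minus (u n) l) < e.

(** Completeness speaks of Cauchy filters and uniform balls: the sequence becomes the filter
    [filtermap u eventually], and [norm_factor] converts a ball into a norm estimate. *)
Lemma cauchy_converges (u : nat -> H) :
  (forall e, 0 < e -> exists N, forall n m,
     (N <= n)%nat -> (n <= m)%nat -> norm (minus (u n) (u m)) < e) ->
  exists l, converges u l.
Proof.
  intro C.
  set (G := filtermap u eventually).
  assert (PG : ProperFilter G) by (apply filtermap_proper_filter, eventually_filter).
  assert (CG : cauchy G).
  { intro e. destruct (C (e / 2)) as [N HN].
    { apply Rmult_lt_0_compat; [apply cond_pos | lra]. }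
    exists (u N), N; intros n Hn; apply (norm_compat1 (V := H) (u N) (u n)).
    specialize (HN N n (le_n _) Hn); rewrite norm_minus_sym in HN.
    pose proof (cond_pos e) as Pe; eapply Rlt_trans; [exact HN | lra]. }
  exists (lim G); intros e He.
  assert (Hd : 0 < e / (2 * @norm_factor R_AbsRing H)).
  { apply Rdiv_lt_0_compat; auto. pose proof (@norm_factor_gt_0 _ H); lra. }
  destruct (complete_cauchy G PG CG (mkposreal _ Hd)) as [N HN].
  exists N; intros n Hn; specialize (HN n Hn).
  pose proof (norm_compat2 (V := H) _ _ _ HN) as B; simpl in B.
  pose proof (@norm_factor_gt_0 _ H).
  replace (@norm_factor R_AbsRing H * (e / (2 * @norm_factor R_AbsRing H))) with (e / 2) in B by (field; lra).
  eapply Rlt_trans; [exact B | lra].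
Qed.

Lemma converges_unique u l l' : converges u l -> converges u l' -> l = l'.
Proof.
  intros A B; apply minus_eq, norm_zero_eq.
  destruct (Rle_lt_or_eq_dec _ _ (norm_pos (minus l l'))) as [P | E]; auto.
  exfalso.
  destruct (A (norm (minus l l') / 2)) as [n Hn]; [lra |].
  destruct (B (norm (minus l l') / 2)) as [m Hm]; [lra |].
  specialize (Hn (max n m) (Nat.le_max_l _ _)); specialize (Hm (max n m) (Nat.le_max_r _ _)).
  pose proof (norm_minus_triangle (u (max n m)) l l') as T.
  rewrite (norm_minus_sym l (u (max n m))) in T; lra.
Qed.

End Hilbert2.

(** * One-sided differential inequalities *)

Lemma at_right_0_intro (Q : R -> Prop) d :
  0 < d -> (forall r, 0 < r < d -> Q r) -> at_right 0 Q.
Proof.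
  intros Hd HQ; exists (mkposreal d Hd); intros r Br Pr; apply HQ.
  change (Rabs (r - 0) < d) in Br; rewrite Rminus_0_r Rabs_pos_eq in Br; lra.
Qed.

Lemma at_right_0_elim (Q : R -> Prop) :
  at_right 0 Q -> exists d, 0 < d /\ forall r, 0 < r < d -> Q r.
Proof.
  intros [d Hd]; exists d; split; [apply cond_pos |].
  intros r Hr; apply Hd; [| lra].
  change (Rabs (r - 0) < d); rewrite Rminus_0_r Rabs_pos_eq; lra.
Qed.

Lemma at_right_0_lt d : 0 < d -> at_right 0 (fun r => 0 < r < d).
Proof. intro Hd; apply (at_right_0_intro _ d); auto. Qed.

(** The upper right Dini derivative of [f] at [t] is at most [d]. *)
Definition dini_le (f : R -> R) (t d : R) : Prop :=
  forall eta, 0 < eta -> at_right 0 (fun r => f (t + r) <= f t + r * (d + eta)).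

Definition rcont (f : R -> R) : Prop :=
  forall t, 0 <= t -> forall e, 0 < e ->
    exists d, 0 < d /\ forall s, 0 <= s -> Rabs (s - t) < d -> Rabs (f s - f t) < e.

Lemma dini_le_weaken f t d d' : d <= d' -> dini_le f t d -> dini_le f t d'.
Proof.
  intros Hd Hf eta He; specialize (Hf eta He).
  generalize (filter_and _ _ (at_right_0_lt 1 Rlt_0_1) Hf).
  apply filter_imp; intros r [Hr Hfr]; nra.
Qed.

Lemma dini_le_plus f g t d d' :
  dini_le f t d -> dini_le g t d' -> dini_le (fun s => f s + g s) t (d + d').
Proof.
  intros Hf Hg eta He.
  assert (He2 : 0 < eta / 2) by lra.
  generalize (filter_and _ _ (Hf _ He2) (Hg _ He2)).
  apply filter_imp; intros r [A B]; nra.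
Qed.

Lemma dini_le_scal k f t d :
  0 <= k -> dini_le f t d -> dini_le (fun s => k * f s) t (k * d).
Proof.
  intros Hk Hf eta He.
  assert (He2 : 0 < eta / (k + 1)) by (apply Rdiv_lt_0_compat; lra).
  assert (Hk2 : k * (eta / (k + 1)) <= eta).
  { apply (Rmult_le_reg_r (k + 1)); [lra |].
    field_simplify; [| lra]; nra. }
  generalize (filter_and _ _ (at_right_0_lt 1 Rlt_0_1) (Hf _ He2)).
  apply filter_imp; intros r [Hr A].
  apply (Rmult_le_compat_l k) in A; auto.
  assert (r * (k * (eta / (k + 1))) <= r * eta) by (apply Rmult_le_compat_l; lra).
  lra.
Qed.

Lemma derive_right phi t l :
  is_derive phi t l ->
  forall eta, 0 < eta ->
    at_right 0 (fun r => Rabs (phi (t + r) - phi t - r * l) <= eta * r).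
Proof.
  intros Hd eta He; apply is_derive_Reals in Hd.
  destruct (Hd eta He) as [d Hd'].
  apply (at_right_0_intro _ d); [apply cond_pos |]; intros r Hr.
  specialize (Hd' r ltac:(lra)); rewrite (Rabs_pos_eq r) in Hd'; [| lra].
  specialize (Hd' ltac:(lra)).
  replace (phi (t + r) - phi t - r * l) with (((phi (t + r) - phi t) / r - l) * r)
    by (field; lra).
  rewrite Rabs_mult (Rabs_pos_eq r); [| lra].
  apply Rmult_le_compat_r; lra.
Qed.

(** Continuous induction with slack: the times up to which [g s <= g 0 + eta * s] holds have a
    supremum, which belongs to them by continuity, and the Dini bound pushes it further unless it is
    [T]. Then [eta] tends to 0. *)
Lemma dini_nonincreasing g T :
  0 <= T -> rcont g -> (forall t, 0 <= t < T -> dini_le g t 0) -> g T <= g 0.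
Proof.
  intros HT Cg Dg.
  assert (W : forall eta, 0 < eta -> g T <= g 0 + eta * T).
  { intros eta He.
    set (E := fun t => 0 <= t <= T /\ forall s, 0 <= s <= t -> g s <= g 0 + eta * s).
    assert (E0 : E 0).
    { split; [lra |]; intros s Hs; replace s with 0 by lra; lra. }
    destruct (completeness E) as [m [Um Lm]].
    { exists T; intros t [Ht _]; lra. }
    { exists 0; exact E0. }
    assert (m0 : 0 <= m) by (apply Um; exact E0).
    assert (mT : m <= T) by (apply Lm; intros t [Ht _]; lra).
    assert (below : forall s, 0 <= s < m -> g s <= g 0 + eta * s).
    { intros s Hs. destruct (classic (exists t, E t /\ s < t)) as [[t [[_ Et] St]] | N].
      - apply Et; lra.
      - exfalso. assert (m <= s); [| lra].
        apply Lm; intros t Et; apply Rnot_lt_le; intro St; apply N; exists t; auto. }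
    assert (at_m : g m <= g 0 + eta * m).
    { destruct (Rle_lt_or_eq_dec _ _ m0) as [Pm | <-]; [| lra].
      apply Rle_plus_epsilon; intros e Pe.
      destruct (Cg m m0 e Pe) as [d [Pd Hd]].
      set (s := Rmax 0 (m - d / 2)).
      assert (0 <= s < m) by (split; [apply Rmax_l | apply Rmax_lub_lt; lra]).
      assert (m - d / 2 <= s) by apply Rmax_r.
      specialize (Hd s ltac:(lra)); specialize (below s ltac:(lra)).
      assert (Rabs (s - m) < d) by (apply Rabs_def1; lra).
      specialize (Hd ltac:(auto)); apply Rabs_def2 in Hd; nra. }
    destruct (Rle_lt_or_eq_dec _ _ mT) as [Lt | <-]; auto.
    exfalso.
    destruct (at_right_0_elim _ (Dg m (conj m0 Lt) eta He)) as [d [Pd Hd]].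
    set (d' := Rmin (d / 2) (T - m)).
    assert (0 < d') by (apply Rmin_pos; lra).
    assert (d' <= d / 2) by apply Rmin_l.
    assert (d' <= T - m) by apply Rmin_r.
    assert (Em : E (m + d')).
    { split; [lra |]; intros s Hs.
      destruct (Rlt_le_dec s m) as [A | A]; [apply below; lra |].
      destruct (Rle_lt_or_eq_dec _ _ A) as [B | <-]; auto.
      specialize (Hd (s - m) ltac:(lra)); replace (m + (s - m)) with s in Hd by ring.
      nra. }
    specialize (Um _ Em); lra. }
  apply Rle_plus_epsilon; intros e Pe.
  assert (P1 : 0 < e / (T + 1)) by (apply Rdiv_lt_0_compat; lra).
  specialize (W _ P1).
  assert (e / (T + 1) * T <= e); [| lra].
  apply (Rmult_le_reg_r (T + 1)); [lra |]; field_simplify; nra.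
Qed.

Lemma rcont_mult_exp f c : rcont f -> rcont (fun t => exp (c * t) * f t).
Proof.
  intros Cf t Ht e Pe.
  assert (Ce : continuity_pt (fun t => exp (c * t)) t).
  { apply derivable_continuous_pt; eexists; apply is_derive_Reals.
    evar_last; [auto_derive; trivial | reflexivity]. }
  set (a := Rabs (f t)); set (b := exp (c * t)).
  assert (0 <= a) by apply Rabs_pos. assert (0 < b) by apply exp_pos.
  set (e1 := e / (2 * (b + 1))); set (e2 := Rmin 1 (e / (2 * (a + 1)))).
  assert (P1 : 0 < e1) by (apply Rdiv_lt_0_compat; nra).
  assert (P2 : 0 < e2) by (apply Rmin_pos; [lra | apply Rdiv_lt_0_compat; nra]).
  destruct (Cf t Ht e1 P1) as [d1 [Pd1 Hd1]].
  destruct (Ce e2 P2) as [d2 [Pd2 Hd2]].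
  exists (Rmin d1 d2); split; [apply Rmin_pos; auto |]; intros s Ps Hs.
  assert (Rmin d1 d2 <= d1) by apply Rmin_l.
  assert (Rmin d1 d2 <= d2) by apply Rmin_r.
  assert (A : Rabs (f s - f t) < e1) by (apply Hd1; auto; lra).
  assert (B : Rabs (exp (c * s) - b) < e2).
  { destruct (Req_dec s t) as [-> | N].
    - unfold b; rewrite Rminus_diag Rabs_R0; auto.
    - apply (Hd2 s); split; [split; [exact I | auto] |].
      simpl; unfold R_dist; lra. }
  assert (e2 <= 1) by apply Rmin_l.
  assert (e2 <= e / (2 * (a + 1))) by apply Rmin_r.
  change (Rabs (exp (c * s) * f s - exp (c * t) * f t) < e).
  replace (exp (c * s) * f s - exp (c * t) * f t)
    with (exp (c * s) * (f s - f t) + (exp (c * s) - b) * f t) by (unfold b; ring).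
  eapply Rle_lt_trans; [apply Rabs_triang |]; rewrite !Rabs_mult.
  fold a; rewrite (Rabs_pos_eq (exp _)); [| left; apply exp_pos].
  assert (exp (c * s) <= b + 1) by (apply Rabs_def2 in B; lra).
  pose proof (exp_pos (c * s)).
  assert (exp (c * s) * Rabs (f s - f t) < e / 2).
  { apply Rle_lt_trans with ((b + 1) * Rabs (f s - f t)).
    - apply Rmult_le_compat_r; [apply Rabs_pos | auto].
    - replace (e / 2) with ((b + 1) * e1) by (unfold e1; field; lra).
      apply Rmult_lt_compat_l; lra. }
  assert (Rabs (exp (c * s) - b) * a <= e / 2); [| lra].
  apply Rle_trans with (e / (2 * (a + 1)) * (a + 1)).
  - apply Rmult_le_compat; try lra. apply Rabs_pos.
  - right; field; lra.
Qed.

(** The function [exp (- c t) f t] is nonincreasing. No sign is imposed on [f] or [c], since the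
    lemma is applied to differences [q - k p] and to [- p]. *)
Lemma dini_gronwall f c T :
  0 <= T -> rcont f -> (forall t, 0 <= t < T -> dini_le f t (c * f t)) ->
  f T <= exp (c * T) * f 0.
Proof.
  intros HT Cf Df.
  assert (W : exp (- c * T) * f T <= exp (- c * 0) * f 0).
  { apply (dini_nonincreasing (fun t => exp (- c * t) * f t)); auto.
    - apply rcont_mult_exp; auto.
    - intros t Ht eta He.
      set (K := exp (- c * t)); assert (PK : 0 < K) by apply exp_pos.
      set (B := exp (Rabs c)); assert (PB : 0 < B) by apply exp_pos.
      set (X := Rabs (f t)); assert (PX : 0 <= X) by apply Rabs_pos.
      assert (P1 : 0 < eta / (2 * K * B)) by (apply Rdiv_lt_0_compat; nra).
      assert (P2 : 0 < eta / (2 * K * (X + 1))) by (apply Rdiv_lt_0_compat; nra).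
      (* Multiplying [f (t + r) <= (1 + c r) f t + o(r)] by [exp (- c r)] puts this factor in front
         of [f t]; its vanishing derivative makes it [1 + o(r)]. *)
      assert (D : is_derive (fun r => exp (- c * r) * (1 + c * r)) 0 0).
      { auto_derive; trivial; rewrite !Rmult_0_r exp_0; ring. }
      generalize (filter_and _ _ (at_right_0_lt 1 Rlt_0_1)
        (filter_and _ _ (Df t Ht _ P1) (derive_right _ _ _ D _ P2))).
      apply filter_imp; intros r [Hr [A E]].
      rewrite Rplus_0_l !Rmult_0_r exp_0 Rplus_0_r Rmult_1_l Rminus_0_r in E.
      rewrite Rmult_plus_distr_l exp_plus; fold K.
      set (q := exp (- c * r)) in *.
      assert (Pq : 0 < q) by apply exp_pos.
      assert (qB : q <= B).
      { unfold q, B; destruct (Rle_lt_or_eq_dec (- c * r) (Rabs c)) as [Lt | Eq].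
        - pose proof (Rle_abs (- c)); rewrite Rabs_Ropp in H.
          pose proof (Rabs_pos c); nra.
        - left; apply exp_increasing; auto.
        - rewrite Eq; lra. }
      assert (S1 : q * (r * (eta / (2 * K * B))) <= B * (r * (eta / (2 * K * B)))).
      { apply Rmult_le_compat_r; auto; nra. }
      assert (S2 : (q * (1 + c * r) - 1) * f t <= eta / (2 * K * (X + 1)) * r * (X + 1)).
      { eapply Rle_trans; [apply Rle_abs |]; rewrite Rabs_mult.
        apply Rmult_le_compat; try apply Rabs_pos; auto; fold X; lra. }
      assert (S3 : q * f (t + r) <= q * (f t + r * (c * f t + eta / (2 * K * B))))
        by (apply Rmult_le_compat_l; lra).
      assert (S4 : K * (q * f (t + r)) <=
        K * (f t + eta / (2 * K * (X + 1)) * r * (X + 1) + B * (r * (eta / (2 * K * B)))))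
        by (apply Rmult_le_compat_l; lra).
      eapply Rle_trans; [right; apply Rmult_assoc |].
      eapply Rle_trans; [exact S4 |]; right; field; lra. }
  rewrite Rmult_0_r exp_0 Rmult_1_l in W.
  apply (Rmult_le_compat_l (exp (c * T))) in W; [| left; apply exp_pos].
  rewrite -Rmult_assoc -exp_plus in W.
  replace (c * T + - c * T) with 0 in W by ring.
  rewrite exp_0 in W; lra.
Qed.

Lemma rcont_plus f g : rcont f -> rcont g -> rcont (fun t => f t + g t).
Proof.
  intros Cf Cg t Ht e Pe.
  destruct (Cf t Ht (e / 2)) as [d1 [P1 H1]]; [lra |].
  destruct (Cg t Ht (e / 2)) as [d2 [P2 H2]]; [lra |].
  exists (Rmin d1 d2); split; [apply Rmin_pos; auto |]; intros s Ps Hs.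
  assert (Rmin d1 d2 <= d1) by apply Rmin_l.
  assert (Rmin d1 d2 <= d2) by apply Rmin_r.
  specialize (H1 s Ps ltac:(lra)); specialize (H2 s Ps ltac:(lra)).
  apply Rabs_def2 in H1; apply Rabs_def2 in H2; apply Rabs_def1; lra.
Qed.

Lemma rcont_const c : rcont (fun _ => c).
Proof.
  intros t _ e Pe; exists 1; split; [lra |]; intros; rewrite Rminus_diag Rabs_R0; auto.
Qed.

Lemma rcont_scal k f : rcont f -> rcont (fun t => k * f t).
Proof.
  intros Cf t Ht e Pe; pose proof (Rabs_pos k).
  destruct (Cf t Ht (e / (Rabs k + 1))) as [d [P1 H1]]; [apply Rdiv_lt_0_compat; lra |].
  exists d; split; auto; intros s Ps Hs; specialize (H1 s Ps Hs).
  rewrite -Rmult_minus_distr_l Rabs_mult.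
  apply Rle_lt_trans with ((Rabs k) * (e / (Rabs k + 1))).
  - apply Rmult_le_compat_l; lra.
  - apply (Rmult_lt_reg_r (Rabs k + 1)); [lra |]; field_simplify; nra.
Qed.

Lemma exp_decay k K e : 0 < k -> 0 < e ->
  exists T0, 0 <= T0 /\ forall t, T0 <= t -> K * exp (- k * t) < e.
Proof.
  intros Pk Pe. exists (Rmax 0 (K / (e * k))); split; [apply Rmax_l |]; intros t Ht.
  assert (T0 : 0 <= t) by (eapply Rle_trans; [apply Rmax_l | exact Ht]).
  assert (T1 : K / (e * k) <= t) by (eapply Rle_trans; [apply Rmax_r | exact Ht]).
  assert (K <= e * (k * t)).
  { apply (Rmult_le_compat_r (e * k)) in T1; [| nra].
    unfold Rdiv in T1; rewrite Rmult_assoc Rinv_l in T1; nra. }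
  assert (X : 1 + k * t <= exp (k * t)) by apply exp_ineq1_le.
  replace (- k * t) with (- (k * t)) by ring.
  rewrite exp_Ropp; pose proof (exp_pos (k * t)).
  apply (Rmult_lt_reg_r (exp (k * t))); auto.
  rewrite Rmult_assoc Rinv_l; nra.
Qed.

(** * Vector-valued right derivatives *)

Section Vectors.

Context {H : HilbertSpace}.
Implicit Types (y : R -> H) (u : nat -> H).

Lemma cauchy_of_exp u k K : 0 < k ->
  (forall n m, (n <= m)%nat -> norm (minus (u n) (u m)) <= K * exp (- k * INR n)) ->
  exists l, converges u l.
Proof.
  intros Pk HK; apply cauchy_converges; intros e Pe.
  destruct (exp_decay k K e Pk Pe) as [T0 [P0 HT]].
  destruct (INR_unbounded T0) as [N HN]; exists N; intros n m Nn nm.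
  eapply Rle_lt_trans; [apply HK; auto |]; apply HT.
  apply le_INR in Nn; lra.
Qed.

(** Banach's contraction principle on a sequentially closed set; the geometric rate [c ^ n] is read
    as [exp (- k n)] with [k = - ln c]. *)
Lemma fixed_point (V : H -> Prop) (phi : H -> H) c x0 :
  0 < c < 1 -> (forall u l, (forall n, V (u n)) -> converges u l -> V l) -> V x0 ->
  (forall x, V x -> V (phi x)) ->
  (forall x x', V x -> V x' -> norm (minus (phi x) (phi x')) <= c * norm (minus x x')) ->
  exists x, V x /\ phi x = x.
Proof.
  intros Hc Vcl V0 Vphi Lphi.
  set (u := fun n => Nat.iter n phi x0).
  assert (Vu : forall n, V (u n)) by (induction n; simpl; auto).
  set (d := norm (minus (u O) (u 1%nat))).
  assert (Pd : 0 <= d) by apply norm_pos.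
  assert (S1 : forall n, norm (minus (u n) (u (S n))) <= c ^ n * d).
  { induction n; [simpl; unfold d; simpl; lra |].
    eapply Rle_trans; [apply (Lphi (u n) (u (S n))); auto |].
    simpl pow; nra. }
  assert (Pc : forall n, 0 < c ^ n) by (intro; apply pow_lt; lra).
  (* Keeping the factor [1 - c ^ j] of the partial geometric sum makes the induction on [j] close
     exactly. *)
  assert (S2 : forall n j, norm (minus (u n) (u (n + j)%nat)) <= d / (1 - c) * c ^ n * (1 - c ^ j)).
  { induction j.
    - rewrite Nat.add_0_r minus_self norm_0; simpl; lra.
    - eapply Rle_trans; [apply (norm_minus_triangle (u (n + j)%nat)) |].
      rewrite Nat.add_succ_r. specialize (S1 (n + j)%nat); rewrite pow_add in S1.
      replace (d / (1 - c) * c ^ n * (1 - c ^ S j)) with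
        (d / (1 - c) * c ^ n * (1 - c ^ j) + c ^ n * c ^ j * d) by (simpl; field; lra).
      lra. }
  destruct (cauchy_of_exp u (- ln c) (d / (1 - c))) as [l Hl].
  { assert (ln c < ln 1) by (apply ln_increasing; lra). rewrite ln_1 in H0; lra. }
  { intros n m nm; replace m with (n + (m - n))%nat by lia.
    eapply Rle_trans; [apply S2 |].
    replace (exp (- - ln c * INR n)) with (c ^ n).
    2:{ rewrite Ropp_involutive -Rpower_pow; [| lra]; unfold Rpower; f_equal; ring. }
    pose proof (Pc n); pose proof (Pc (m - n)%nat).
    assert (0 <= d / (1 - c) * c ^ n).
    { apply Rmult_le_pos; [apply Rmult_le_pos; [lra | left; apply Rinv_0_lt_compat; lra] | lra]. }
    nra. }
  exists l; assert (Vl : V l) by (apply (Vcl u); auto).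
  split; auto. apply (converges_unique (fun n => u (S n))).
  - intros e Pe; destruct (Hl e Pe) as [N HN]; exists N; intros n Hn.
    eapply Rle_lt_trans; [apply (Lphi (u n) l); auto |].
    specialize (HN n Hn); pose proof (norm_pos (minus (u n) l)); nra.
  - intros e Pe; destruct (Hl e Pe) as [N HN]; exists N; intros n Hn; apply HN; lia.
Qed.

Definition vcont y : Prop :=
  forall t, 0 <= t -> forall e, 0 < e ->
    exists d, 0 < d /\
      forall s, 0 <= s -> Rabs (s - t) < d -> norm (minus (y s) (y t)) < e.

Lemma vcont_norm y : vcont y -> rcont (fun t => norm (y t)).
Proof.
  intros Cy t Ht e Pe; destruct (Cy t Ht e Pe) as [d [Pd Hd]].
  exists d; split; auto; intros s Ps Hs.
  eapply Rle_lt_trans; [apply norm_minus_ge | auto].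
Qed.

Lemma vcont_lip (T : H -> H) C y :
  (forall x x', norm (minus (T x) (T x')) <= C * norm (minus x x')) ->
  vcont y -> vcont (fun t => T (y t)).
Proof.
  intros HT Cy t Ht e Pe.
  destruct (Cy t Ht (e / (Rabs C + 1))) as [d [Pd Hd]].
  { apply Rdiv_lt_0_compat; pose proof (Rabs_pos C); lra. }
  exists d; split; auto; intros s Ps Hs; specialize (Hd s Ps Hs).
  eapply Rle_lt_trans; [apply HT |].
  pose proof (norm_pos (minus (y s) (y t))); pose proof (Rle_abs C); pose proof (Rabs_pos C).
  apply Rle_lt_trans with (Rabs C * (e / (Rabs C + 1))); [nra |].
  apply (Rmult_lt_reg_r (Rabs C + 1)); [lra |]; field_simplify; nra.
Qed.

Lemma vcont_minus y y' : vcont y -> vcont y' -> vcont (fun t => minus (y t) (y' t)).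
Proof.
  intros Cf Cg t Ht e Pe.
  destruct (Cf t Ht (e / 2)) as [d1 [P1 H1]]; [lra |].
  destruct (Cg t Ht (e / 2)) as [d2 [P2 H2]]; [lra |].
  exists (Rmin d1 d2); split; [apply Rmin_pos; auto |]; intros s Ps Hs.
  assert (Rmin d1 d2 <= d1) by apply Rmin_l.
  assert (Rmin d1 d2 <= d2) by apply Rmin_r.
  specialize (H1 s Ps ltac:(lra)); specialize (H2 s Ps ltac:(lra)).
  vreplace (minus (minus (y s) (y' s)) (minus (y t) (y' t)))
    with (minus (minus (y s) (y t)) (minus (y' s) (y' t))).
  eapply Rle_lt_trans; [apply norm_minus_le |]; lra.
Qed.

Lemma vcont_shift y t0 : 0 <= t0 -> vcont y -> vcont (fun t => y (t0 + t)).
Proof.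
  intros P0 Cy t Ht e Pe; destruct (Cy (t0 + t) ltac:(lra) e Pe) as [d [Pd Hd]].
  exists d; split; auto; intros s Ps Hs; apply Hd; [lra |].
  replace (t0 + s - (t0 + t)) with (s - t) by ring; auto.
Qed.

Definition small_o (g : R -> H) : Prop :=
  forall eta, 0 < eta -> at_right 0 (fun r => norm (g r) <= eta * r).

Lemma small_o_plus g g' : small_o g -> small_o g' -> small_o (fun r => plus (g r) (g' r)).
Proof.
  intros Hg Hg' eta He; assert (He2 : 0 < eta / 2) by lra.
  generalize (filter_and _ _ (Hg _ He2) (Hg' _ He2)); apply filter_imp; intros r [A B].
  eapply Rle_trans; [apply norm_plus_le | lra].
Qed.

Lemma small_o_dominated g g' C :
  0 <= C -> (forall r, 0 < r -> norm (g' r) <= C * norm (g r)) -> small_o g -> small_o g'.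
Proof.
  intros PC Hg' Hg eta He; assert (He2 : 0 < eta / (C + 1)) by (apply Rdiv_lt_0_compat; lra).
  generalize (filter_and _ _ (at_right_0_lt 1 Rlt_0_1) (Hg _ He2)).
  apply filter_imp; intros r [Hr A].
  eapply Rle_trans; [apply Hg'; lra |].
  apply Rle_trans with ((C + 1) * (eta / (C + 1) * r)).
  - pose proof (norm_pos (g r)); nra.
  - right; field; lra.
Qed.

Lemma small_o_ext g g' : (forall r, 0 < r -> g r = g' r) -> small_o g -> small_o g'.
Proof.
  intros E; apply (small_o_dominated _ _ 1); [lra |].
  intros r Pr; rewrite E; auto; lra.
Qed.

Definition right_diff y t l : Prop :=
  small_o (fun r => minus (minus (y (t + r)) (y t)) (scal r l)).

Lemma right_diff_minus y y' t l l' :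
  right_diff y t l -> right_diff y' t l' ->
  right_diff (fun s => minus (y s) (y' s)) t (minus l l').
Proof.
  intros A B; unfold right_diff in *.
  assert (B' : small_o (fun r => opp (minus (minus (y' (t + r)) (y' t)) (scal r l')))).
  { apply (small_o_dominated _ _ 1 Rle_0_1 (fun r _ => Req_le _ _ (eq_trans (norm_opp_eq _) (eq_sym (Rmult_1_l _)))) B). }
  eapply small_o_ext; [| apply (small_o_plus _ _ A B')].
  intros r Pr; vec.
Qed.

Lemma right_diff_norm y t l : right_diff y t l -> dini_le (fun s => norm (y s)) t (norm l).
Proof.
  intros Hy eta He; generalize (filter_and _ _ (at_right_0_lt 1 Rlt_0_1) (Hy eta He)).
  apply filter_imp; intros r [Hr A].
  vreplace (y (t + r)) with
    (plus (plus (y t) (scal r l)) (minus (minus (y (t + r)) (y t)) (scal r l))).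
  eapply Rle_trans; [apply norm_plus_le |].
  pose proof (norm_plus_le (y t) (scal r l)).
  rewrite norm_scal_pos in H0; lra.
Qed.

Lemma right_diff_sq y t l :
  right_diff y t l -> dini_le (fun s => norm (y s) ^ 2) t (2 * inner (y t) l).
Proof.
  intros Hy eta He.
  set (a := norm (y t)); set (b := norm l).
  assert (0 <= a) by apply norm_pos. assert (0 <= b) by apply norm_pos.
  (* In the expanded square, [e1] limits the terms containing the remainder [w] and [r0] limits the
     term [(r b) ^ 2], each to a quarter of [eta * r]. *)
  set (e1 := Rmin 1 (eta / (8 * (a + b + 1)))).
  assert (P1 : 0 < e1) by (apply Rmin_pos; [lra | apply Rdiv_lt_0_compat; lra]).
  assert (E1 : e1 <= 1) by apply Rmin_l.
  assert (E2 : e1 * (8 * (a + b + 1)) <= eta).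
  { apply Rle_trans with (eta / (8 * (a + b + 1)) * (8 * (a + b + 1))).
    - apply Rmult_le_compat_r; [lra | apply Rmin_r].
    - right; field; lra. }
  set (r0 := Rmin 1 (eta / (4 * (b ^ 2 + 1)))).
  assert (P2 : 0 < r0) by (apply Rmin_pos; [lra | apply Rdiv_lt_0_compat; nra]).
  assert (E3 : r0 <= 1) by apply Rmin_l.
  assert (E4 : r0 * (4 * (b ^ 2 + 1)) <= eta).
  { apply Rle_trans with (eta / (4 * (b ^ 2 + 1)) * (4 * (b ^ 2 + 1))).
    - apply Rmult_le_compat_r; [nra | apply Rmin_r].
    - right; field; nra. }
  generalize (filter_and _ _ (at_right_0_lt r0 P2) (Hy _ P1)).
  apply filter_imp; intros r [Hr A].
  set (w := minus (minus (y (t + r)) (y t)) (scal r l)) in *.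
  replace (y (t + r)) with (plus (plus (y t) (scal r l)) w) by (unfold w; vec).
  rewrite -inner_norm norm_sq_plus -(inner_norm _ (plus (y t) (scal r l))) norm_sq_plus.
  rewrite inner_scal_r norm_scal_pos; [| lra]; fold a b.
  assert (I1 : inner (plus (y t) (scal r l)) w <= (a + b) * (e1 * r)).
  { eapply Rle_trans; [apply inner_le |].
    apply Rmult_le_compat; try apply norm_pos; auto.
    eapply Rle_trans; [apply norm_plus_le |]; rewrite norm_scal_pos; [| lra].
    fold a b; nra. }
  assert (I2 : norm w ^ 2 <= e1 * r).
  { pose proof (norm_pos w). assert (norm w <= 1) by nra. nra. }
  assert (I3 : (r * b) ^ 2 <= r * (eta / 4)).
  { replace ((r * b) ^ 2) with (r * (r * b ^ 2)) by ring.
    apply Rmult_le_compat_l; nra. }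
  assert (I4 : 2 * ((a + b) * (e1 * r)) + e1 * r <= r * (eta / 4)).
  { replace (2 * ((a + b) * (e1 * r)) + e1 * r) with (r * (e1 * (2 * (a + b) + 1))) by ring.
    apply Rmult_le_compat_l; nra. }
  nra.
Qed.

(* This upgrades right derivatives to two-sided ones. *)
Lemma right_diff_mean_value y (l : H) (y' : R -> H) eta a b :
  0 <= a <= b -> vcont y ->
  (forall s, a <= s < b -> right_diff y s (y' s) /\ norm (minus (y' s) l) <= eta) ->
  norm (minus (minus (y b) (y a)) (scal (b - a) l)) <= eta * (b - a).
Proof.
  intros Hab Cy Dy.
  set (w := fun s => minus (minus (y (a + s)) (y a)) (scal s l)).
  assert (Cw : vcont w).
  { apply vcont_minus.
    - apply vcont_minus; [apply vcont_shift; auto; lra |].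
      intros t Ht e Pe; exists 1; split; [lra |]; intros; rewrite minus_self norm_0; auto.
    - intros t Ht e Pe; pose proof (norm_pos l).
      exists (e / (norm l + 1)); split; [apply Rdiv_lt_0_compat; lra |]; intros s Ps Hs.
      vreplace (minus (scal s l) (scal t l)) with (scal (s - t) l).
      rewrite norm_scal_eq.
      apply Rle_lt_trans with (e / (norm l + 1) * norm l); [apply Rmult_le_compat_r; lra |].
      apply (Rmult_lt_reg_r (norm l + 1)); [lra |]; field_simplify; nra. }
  (* The right derivative of [w] is [y' - l], of norm at most [eta], so [norm (w s) - eta * s] is
     nonincreasing. *)
  assert (G : norm (w (b - a)) + - eta * (b - a) <= norm (w 0) + - eta * 0).
  { apply (dini_nonincreasing (fun s => norm (w s) + - eta * s)); [lra | |].
    - apply rcont_plus; [apply vcont_norm; auto |].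
      apply rcont_scal; intros t Ht e Pe; exists e; auto.
    - intros t Ht. replace 0 with (eta + - eta) by ring. apply dini_le_plus.
      + destruct (Dy (a + t) ltac:(lra)) as [D1 D2].
        eapply dini_le_weaken; [apply D2 |].
        apply right_diff_norm; intros e Pe; generalize (D1 e Pe); apply filter_imp; intros r Hr.
        eapply Rle_trans; [| apply Hr]; right; f_equal; unfold w.
        replace (a + (t + r)) with (a + t + r) by ring. vec.
      + intros e Pe; generalize (at_right_0_lt 1 Rlt_0_1); apply filter_imp; intros; nra. }
  unfold w in G; replace (a + (b - a)) with b in G by ring.
  rewrite Rplus_0_r minus_self in G.
  vreplace (minus (zero : H) (scal 0 l)) with (zero : H) in G.
  rewrite norm_0 in G; lra.
Qed.

End Vectors.

(** * Finite orthonormal families *)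

Fixpoint rsum (n : nat) (f : nat -> R) : R :=
  match n with O => 0 | S m => rsum m f + f m end.

Lemma rsum_ext n f g : (forall i, (i < n)%nat -> f i = g i) -> rsum n f = rsum n g.
Proof. induction n; intro E; simpl; auto; rewrite E; [f_equal; auto | lia]. Qed.

Lemma rsum_le n f g : (forall i, (i < n)%nat -> f i <= g i) -> rsum n f <= rsum n g.
Proof.
  induction n; intro E; simpl; [lra |].
  pose proof (E n (Nat.lt_succ_diag_r n)). specialize (IHn ltac:(auto)); lra.
Qed.

Lemma rsum_scal n a f : rsum n (fun i => a * f i) = a * rsum n f.
Proof. induction n; simpl; [ring | rewrite IHn; ring]. Qed.

Lemma rsum_0 n f : (forall i, (i < n)%nat -> f i = 0) -> rsum n f = 0.
Proof. induction n; intro E; simpl; auto; rewrite E; [rewrite IHn; auto; ring | lia]. Qed.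

Lemma rsum_single n f j :
  (j < n)%nat -> (forall i, (i < n)%nat -> i <> j -> f i = 0) -> rsum n f = f j.
Proof.
  induction n; intros Hj E; [lia |]; simpl.
  destruct (Nat.eq_dec j n) as [-> | N].
  - rewrite rsum_0; [ring |]; intros i Hi; apply E; lia.
  - rewrite (E n) ?IHn; auto; try lia; ring.
Qed.

Section Orthonormal.

Context {H : HilbertSpace}.

Lemma lincomb_ext n c c' (e e' : nat -> H) :
  (forall i, (i < n)%nat -> c i = c' i /\ e i = e' i) -> lincomb n c e = lincomb n c' e'.
Proof.
  induction n; intro E; simpl; auto.
  destruct (E n (Nat.lt_succ_diag_r n)) as [-> ->]; f_equal; auto.
Qed.

Lemma lincomb_plus n c c' (e : nat -> H) :
  lincomb n (fun i => c i + c' i) e = plus (lincomb n c e) (lincomb n c' e).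
Proof. induction n; simpl; [vec | rewrite IHn; vec]. Qed.

Lemma lincomb_scal n a c (e : nat -> H) :
  lincomb n (fun i => a * c i) e = scal a (lincomb n c e).
Proof. induction n; simpl; [vec | rewrite IHn; vec]. Qed.

Lemma inner_lincomb_l n c (e : nat -> H) z :
  inner (lincomb n c e) z = rsum n (fun i => c i * inner (e i) z).
Proof. induction n; simpl; [apply inner_zero_l |]; inner_expand; rewrite IHn; auto. Qed.

Lemma inner_lincomb_r n c (e : nat -> H) z :
  inner z (lincomb n c e) = rsum n (fun i => c i * inner z (e i)).
Proof.
  rewrite inner_sym inner_lincomb_l; apply rsum_ext; intros; rewrite (inner_sym _ z); auto.
Qed.

Definition orthonormal n (e : nat -> H) : Prop :=
  (forall i, (i < n)%nat -> inner (e i) (e i) = 1) /\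
  (forall i j, (i < n)%nat -> (j < n)%nat -> i <> j -> inner (e i) (e j) = 0).

Definition proj n (e : nat -> H) (u : H) : H := lincomb n (fun i => inner u (e i)) e.

Context {n : nat} {e : nat -> H} (On : orthonormal n e).

Lemma inner_lincomb_coord c j : (j < n)%nat -> inner (lincomb n c e) (e j) = c j.
Proof.
  intro Hj; rewrite inner_lincomb_l (rsum_single n _ j Hj).
  - rewrite (proj1 On) //; ring.
  - intros i Hi N; rewrite (proj2 On) //; ring.
Qed.

Lemma inner_lincomb_lincomb c d :
  inner (lincomb n c e) (lincomb n d e) = rsum n (fun i => c i * d i).
Proof.
  rewrite inner_lincomb_r; apply rsum_ext; intros i Hi.
  rewrite inner_lincomb_coord; auto; ring.
Qed.

Lemma norm_lincomb c : norm (lincomb n c e) ^ 2 = rsum n (fun i => c i ^ 2).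
Proof. rewrite -inner_norm inner_lincomb_lincomb; apply rsum_ext; intros; ring. Qed.

Lemma proj_plus u v : proj n e (plus u v) = plus (proj n e u) (proj n e v).
Proof.
  unfold proj; rewrite -lincomb_plus; apply lincomb_ext; intros; split; auto.
  inner_expand; auto.
Qed.

Lemma proj_scal a u : proj n e (scal a u) = scal a (proj n e u).
Proof.
  unfold proj; rewrite -lincomb_scal; apply lincomb_ext; intros; split; auto.
  inner_expand; auto.
Qed.

Lemma proj_lincomb c : proj n e (lincomb n c e) = lincomb n c e.
Proof. apply lincomb_ext; intros; split; auto; apply inner_lincomb_coord; auto. Qed.

Lemma proj_idem u : proj n e (proj n e u) = proj n e u.
Proof. apply proj_lincomb. Qed.

Lemma proj_sym u v : inner (proj n e u) v = inner u (proj n e v).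
Proof.
  unfold proj; rewrite inner_lincomb_l inner_lincomb_r.
  apply rsum_ext; intros; rewrite (inner_sym _ (e i)); ring.
Qed.

Lemma proj_basis j : (j < n)%nat -> proj n e (e j) = e j.
Proof.
  intro Hj; apply minus_eq, norm_zero_eq; set (w := minus (proj n e (e j)) (e j)).
  assert (W : proj n e w = zero).
  { unfold w; vreplace (minus (proj n e (e j)) (e j)) with
      (plus (proj n e (e j)) (scal (-1) (e j))).
    rewrite proj_plus proj_scal proj_idem; vec. }
  assert (Z : inner w w = 0).
  { rewrite {1}/w inner_minus_l proj_sym W inner_zero_r (inner_sym _ (e j)).
    rewrite -(inner_lincomb_coord (fun i => inner w (e i)) j Hj).
    change (0 - inner (proj n e w) (e j) = 0); rewrite W inner_zero_l; ring. }
  rewrite inner_norm in Z; nra.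
Qed.

End Orthonormal.

(** * Orthogonal projections *)

Section Projection.

Context {H : HilbertSpace} (P : H -> H).

(** All that the later parts use of the projection; the spectral projection inherits it from the
    explicit finite sum [proj n e]. *)
Definition orthoprojector : Prop :=
  (forall u v, P (plus u v) = plus (P u) (P v)) /\
  (forall a u, P (scal a u) = scal a (P u)) /\
  (forall u, P (P u) = P u) /\
  (forall u v, inner (P u) v = inner u (P v)).

Lemma proj_orthoprojector n e : orthonormal n e -> (forall u, P u = proj n e u) -> orthoprojector.
Proof.
  intros On E; repeat split; intros; rewrite !E.
  - apply proj_plus; auto.
  - apply proj_scal; auto.
  - apply proj_idem; auto.
  - apply proj_sym; auto.
Qed.

Context (OP : orthoprojector).

Lemma P_plus u v : P (plus u v) = plus (P u) (P v).
Proof. apply OP. Qed.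

Lemma P_scal a u : P (scal a u) = scal a (P u).
Proof. apply OP. Qed.

Lemma P_idem u : P (P u) = P u.
Proof. apply OP. Qed.

Lemma P_sym u v : inner (P u) v = inner u (P v).
Proof. apply OP. Qed.

Lemma P_zero : P zero = zero.
Proof. vreplace (zero : H) with (scal 0 (zero : H)). rewrite P_scal; vec. Qed.

Lemma P_minus u v : P (minus u v) = minus (P u) (P v).
Proof. vreplace (minus u v) with (plus u (scal (-1) v)). rewrite P_plus P_scal; vec. Qed.

Lemma PQ u : P (complement_of P u) = zero.
Proof. unfold complement_of; rewrite P_minus P_idem; vec. Qed.

Lemma Q_minus u v : complement_of P (minus u v) = minus (complement_of P u) (complement_of P v).
Proof. unfold complement_of; rewrite P_minus; vec. Qed.

Lemma range_P u : range P u <-> P u = u.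
Proof. split; [intros [v ->]; apply P_idem | intro E; exists u; auto]. Qed.

Lemma range_Q u : range (complement_of P) u <-> P u = zero.
Proof.
  split; [intros [v ->]; apply PQ | intro E; exists u; unfold complement_of; rewrite E; vec].
Qed.

Lemma Q_of_P u : P u = u -> complement_of P u = zero.
Proof. intro E; unfold complement_of; rewrite E; vec. Qed.

Lemma Q_of_Q u : P u = zero -> complement_of P u = u.
Proof. intro E; unfold complement_of; rewrite E; vec. Qed.

Lemma PQ_sum u : plus (P u) (complement_of P u) = u.
Proof. vec. Qed.

Lemma pythagoras u : norm u ^ 2 = norm (P u) ^ 2 + norm (complement_of P u) ^ 2.
Proof.
  rewrite -!inner_norm; inner_expand.
  rewrite (P_sym u (P u)) P_idem (inner_sym _ (P u) u); ring.
Qed.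

Lemma P_le u : norm (P u) <= norm u.
Proof.
  pose proof (pythagoras u); pose proof (norm_pos u); pose proof (norm_pos (P u)).
  pose proof (pow2_ge_0 (norm (complement_of P u))); nra.
Qed.

Lemma Q_le u : norm (complement_of P u) <= norm u.
Proof.
  pose proof (pythagoras u); pose proof (norm_pos u); pose proof (norm_pos (complement_of P u)).
  pose proof (pow2_ge_0 (norm (P u))); nra.
Qed.

Lemma norm_PQ_le u : norm u <= norm (P u) + norm (complement_of P u).
Proof. rewrite -{1}(PQ_sum u); apply norm_plus_le. Qed.

Lemma inner_range_kernel p q : P p = p -> P q = zero -> inner p q = 0.
Proof. intros Ep Eq; rewrite -Ep P_sym Eq inner_zero_r; auto. Qed.

Lemma kernel_closed u l : (forall n : nat, P (u n) = zero) -> converges u l -> P l = zero.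
Proof.
  intros K C; apply norm_zero_eq.
  destruct (Rle_lt_or_eq_dec _ _ (norm_pos (P l))) as [L | E]; auto; exfalso.
  destruct (C _ L) as [N HN]; specialize (HN N (le_n _)).
  pose proof (P_le (minus (u N) l)) as B; rewrite P_minus K in B.
  vreplace (minus (zero : H) (P l)) with (opp (P l)) in B; rewrite norm_opp_eq in B; lra.
Qed.

Lemma range_closed u l : (forall n : nat, P (u n) = u n) -> converges u l -> P l = l.
Proof.
  intros K C; apply minus_eq, norm_zero_eq.
  destruct (Rle_lt_or_eq_dec _ _ (norm_pos (minus (P l) l))) as [L | E]; auto; exfalso.
  destruct (C _ L) as [N HN]; specialize (HN N (le_n _)).
  pose proof (Q_le (minus (u N) l)) as B; unfold complement_of in B; rewrite P_minus K in B.
  vreplace (minus (minus (u N) l) (minus (u N) (P l))) with (minus (P l) l) in B; lra.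
Qed.

End Projection.

(** * Spectral decomposition *)

Section Spectral.

Context {H : HilbertSpace} {D : H -> Prop} {A : H -> H}.
Context (SA : self_adjoint D A) (NN : nonnegative D A).

Lemma D_zero : D zero.
Proof. apply SA. Qed.

Lemma D_plus x y : D x -> D y -> D (plus x y).
Proof. intros; apply SA; auto. Qed.

Lemma A_plus x y : D x -> D y -> A (plus x y) = plus (A x) (A y).
Proof. intros; apply (proj1 (proj2 (proj1 SA))); auto. Qed.

Lemma D_scal a x : D x -> D (scal a x).
Proof. intros; apply SA; auto. Qed.

Lemma A_scal a x : D x -> A (scal a x) = scal a (A x).
Proof. intros; apply (proj2 (proj2 (proj1 SA))); auto. Qed.

Lemma D_minus x y : D x -> D y -> D (minus x y).
Proof.
  intros; vreplace (minus x y) with (plus x (scal (-1) y)).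
  apply D_plus; auto; apply D_scal; auto.
Qed.

Lemma A_minus x y : D x -> D y -> A (minus x y) = minus (A x) (A y).
Proof.
  intros Dx Dy; vreplace (minus x y) with (plus x (scal (-1) y)).
  rewrite A_plus; auto using D_scal; rewrite A_scal; auto; vec.
Qed.

Lemma A_zero : A zero = zero.
Proof.
  vreplace (zero : H) with (scal 0 (zero : H)); rewrite A_scal; [vec | apply D_zero].
Qed.

Lemma A_sym x y : D x -> D y -> inner (A x) y = inner x (A y).
Proof.
  intros Dx Dy; destruct SA as [_ [_ S]].
  apply (proj2 (S y (A y)) (conj Dy eq_refl)); auto.
Qed.

Lemma D_dense u d : 0 < d -> exists v, D v /\ norm (minus u v) < d.
Proof. intro; apply SA; auto. Qed.

Lemma lincomb_eigen n c (e : nat -> H) l :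
  (forall i, (i < n)%nat -> D (e i) /\ A (e i) = scal (l i) (e i)) ->
  D (lincomb n c e) /\ A (lincomb n c e) = lincomb n (fun i => l i * c i) e.
Proof.
  induction n; intro E; simpl; [split; [apply D_zero | apply A_zero] |].
  destruct IHn as [D1 A1]; [auto |]; destruct (E n (Nat.lt_succ_diag_r n)) as [D2 A2].
  split; [apply D_plus; auto; apply D_scal; auto |].
  rewrite A_plus; auto using D_scal; rewrite A1 A_scal // A2; vec.
Qed.

Context (Lam : R).

Definition low_eigenvector (x : H) : Prop :=
  D x /\ exists lambda : R, 0 <= lambda <= Lam /\ A x = scal lambda x.

Lemma low_eigenvector_scal a x : low_eigenvector x -> low_eigenvector (scal a x).
Proof.
  intros [Dx [l [Hl E]]]; split; [apply D_scal; auto |]; exists l; split; auto.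
  rewrite A_scal // E; vec.
Qed.

Lemma eigenvectors_orthogonal x y l m :
  D x -> D y -> A x = scal l x -> A y = scal m y -> l <> m -> inner x y = 0.
Proof.
  intros Dx Dy Ex Ey N; pose proof (A_sym x y Dx Dy) as S; rewrite Ex Ey in S.
  revert S; inner_expand; intro S.
  apply (Rmult_eq_reg_l (l - m)); lra.
Qed.

Definition low_family n (e : nat -> H) : Prop :=
  orthonormal n e /\ forall i, (i < n)%nat -> low_eigenvector (e i).

Definition update (e : nat -> H) n x : nat -> H :=
  fun i => if Nat.eqb i n then x else e i.

Lemma update_eq e n x : update e n x n = x.
Proof. unfold update; rewrite Nat.eqb_refl; auto. Qed.

Lemma update_lt e n x i : (i < n)%nat -> update e n x i = e i.
Proof. intro; unfold update; destruct (Nat.eqb_spec i n); [lia | auto]. Qed.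

(** Gram-Schmidt stays inside the eigenspace: [x] is orthogonal to every [e i] with a different
    eigenvalue, so subtracting [proj n e x] removes only eigenvectors for the eigenvalue of [x]
    itself. *)
Lemma low_family_extend n e x :
  low_family n e -> low_eigenvector x -> x <> proj n e x ->
  exists x', low_family (S n) (update e n x').
Proof.
  intros [On Le] [Dx [nu [Hnu Ex]]] N.
  destruct (choice (fun i l => (i < n)%nat ->
    D (e i) /\ 0 <= l <= Lam /\ A (e i) = scal l (e i))) as [l Hl].
  { intro i; destruct (classic (i < n)%nat) as [Hi | Hi].
    - destruct (Le i Hi) as [Di [li Hli]]; exists li; intros _; tauto.
    - exists 0; intro; contradiction. }
  set (w := minus x (proj n e x)).
  destruct (lincomb_eigen n (fun i => inner x (e i)) e l) as [D1 A1].
  { intros i Hi; destruct (Hl i Hi) as [? [_ ?]]; auto. }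
  assert (Dw : D w) by (apply D_minus; auto).
  assert (Ew : A w = scal nu w).
  { unfold w; rewrite A_minus // Ex /proj A1.
    rewrite (lincomb_ext n _ (fun i => nu * inner x (e i)) e e).
    - rewrite lincomb_scal; vec.
    - intros i Hi; split; auto; destruct (Hl i Hi) as [Di [_ Ei]].
      destruct (Req_dec (l i) nu) as [-> | Ne]; auto.
      rewrite (eigenvectors_orthogonal x (e i) nu (l i)); auto; ring. }
  assert (Nw : 0 < norm w).
  { destruct (Rle_lt_or_eq_dec _ _ (norm_pos w)) as [? | Z]; auto; exfalso; apply N.
    apply minus_eq, norm_zero_eq; auto. }
  assert (Ow : forall i, (i < n)%nat -> inner w (e i) = 0).
  { intros i Hi; unfold w; rewrite inner_minus_l /proj inner_lincomb_coord //; ring. }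
  clearbody w; exists (scal (/ norm w) w); split; [split |].
  - intros i Hi; destruct (Nat.eq_dec i n) as [-> | Ni].
    + rewrite update_eq; inner_expand; rewrite inner_norm; field; lra.
    + rewrite !update_lt; try lia; apply On; lia.
  - intros i j Hi Hj Nij; destruct (Nat.eq_dec i n) as [-> | Ni].
    + rewrite update_eq update_lt; [| lia]; inner_expand; rewrite Ow; [ring | lia].
    + destruct (Nat.eq_dec j n) as [-> | Nj].
      * rewrite update_eq update_lt; [| lia]; inner_expand.
        rewrite inner_sym Ow; [ring | lia].
      * rewrite !update_lt; try lia; apply On; lia.
  - intros i Hi; destruct (Nat.eq_dec i n) as [-> | Ni].
    + rewrite update_eq; apply low_eigenvector_scal; split; auto; exists nu; auto.
    + rewrite update_lt; [| lia]; apply Le; lia.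
Qed.

(** The eigenvalues are bounded, hence so are the vectors [(A - l0) e_n], which the resolvent maps
    back to [e_n]. Compactness would make a subsequence of [e_n] converge, but orthonormal vectors
    are at mutual distance [sqrt 2]. *)
Lemma no_infinite_low_family (CR : compact_resolvent D A) (e : nat -> H) :
  ~ forall n, low_family n e.
Proof.
  intro LF; destruct CR as [l0 [T [[_ [TA _]] CT]]].
  assert (Le : forall n, low_eigenvector (e n)) by (intro n; apply (LF (S n)); lia).
  assert (Ne : forall n, norm (e n) = 1).
  { intro n; pose proof (proj1 (proj1 (LF (S n))) n (Nat.lt_succ_diag_r n)) as I.
    rewrite inner_norm in I; pose proof (norm_pos (e n)); nra. }
  destruct (CT (fun n => minus (A (e n)) (scal l0 (e n))) (Lam + Rabs l0)) as [l [phi [Mphi Hl]]].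
  { intro n; destruct (Le n) as [_ [nu [Hnu E]]]; rewrite E.
    eapply Rle_trans; [apply norm_minus_le |]; rewrite !norm_scal_eq Ne.
    rewrite (Rabs_pos_eq nu); lra. }
  assert (Pd : 0 < 1 / (2 * @norm_factor R_AbsRing H)).
  { apply Rdiv_lt_0_compat; [lra |]; pose proof (@norm_factor_gt_0 R_AbsRing H); lra. }
  rewrite filterlim_locally in Hl; destruct (Hl (mkposreal _ Pd)) as [N HN].
  assert (B : forall n, (N <= n)%nat -> norm (minus (e (phi n)) l) < 1 / 2).
  { intros n Hn; specialize (HN n Hn).
    rewrite TA in HN; [| apply Le | exact I].
    pose proof (norm_compat2 (V := H) _ _ _ HN) as B; simpl in B.
    eapply Rlt_le_trans; [exact B |]; right; field.
    pose proof (@norm_factor_gt_0 R_AbsRing H); lra. }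
  pose proof (B N (le_n _)) as B1; pose proof (B (S N) (Nat.le_succ_diag_r _)) as B2.
  pose proof (norm_minus_triangle l (e (phi N)) (e (phi (S N)))) as T1.
  rewrite (norm_minus_sym l) in T1.
  specialize (Mphi N (S N) (Nat.lt_succ_diag_r N)).
  assert (S2 : norm (minus (e (phi N)) (e (phi (S N)))) ^ 2 = 2).
  { rewrite -inner_norm; inner_expand; rewrite !inner_norm !Ne.
    pose proof (proj2 (proj1 (LF (S (phi (S N)))))) as O.
    rewrite !O; try lia; ring. }
  pose proof (norm_pos (minus (e (phi N)) (e (phi (S N))))); nra.
Qed.

(** If no finite family exhausted the low eigenvectors, extending by choice at every stage would
    produce an infinite one. *)
Lemma low_basis (CR : compact_resolvent D A) :
  exists n e, low_family n e /\ forall x, low_eigenvector x -> x = proj n e x.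
Proof.
  apply NNPP; intro N.
  assert (Ex : forall n e, low_family n e -> exists x, low_family (S n) (update e n x)).
  { intros n e LF; apply NNPP; intro Nx; apply N; exists n, e; split; auto; intros x Lx.
    apply NNPP; intro Ne; apply Nx; apply (low_family_extend n e x); auto. }
  set (next := fun n e => epsilon (inhabits (zero : H)) (fun x => low_family (S n) (update e n x))).
  set (fam := nat_rect (fun _ => nat -> H) (fun _ => zero) (fun n e => update e n (next n e))).
  assert (LF : forall n, low_family n (fam n)).
  { induction n as [| n IH].
    - split; [split |]; intros; lia.
    - apply (epsilon_spec (inhabits (zero : H)) (fun x => low_family (S n) (update (fam n) n x))).
      apply Ex; auto. }
  (* Entry [i] never changes after stage [S i], so the diagonal collects all the families into one
     sequence. *)
  assert (Eq : forall n i, (i < n)%nat -> fam n i = fam (S i) i).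
  { induction n; intros i Hi; [lia |].
    destruct (Nat.eq_dec i n) as [-> | Ni]; auto.
    rewrite -IHn; [| lia]; apply update_lt; lia. }
  apply (no_infinite_low_family CR (fun i => fam (S i) i)); intro n.
  destruct (LF n) as [[O1 O2] L]; split; [split |].
  - intros i Hi; rewrite -(Eq n) //; auto.
  - intros i j Hi Hj; rewrite -(Eq n i) // -(Eq n j) //; auto.
  - intros i Hi; rewrite -(Eq n) //; auto.
Qed.

(** A finite-dimensional span is already closed: a vector approximated by fixed points of [proj n e]
    is itself fixed. *)
Lemma low_spectral_subspace n e :
  low_family n e -> (forall x, low_eigenvector x -> x = proj n e x) ->
  forall u, spectral_subspace D A (fun x => 0 <= x <= Lam) u <-> proj n e u = u.
Proof.
  intros [On Le] Be u.
  pose proof (proj_orthoprojector (proj n e) n e On (fun u => eq_refl)) as OP.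
  split.
  - intro Cu; apply minus_eq, norm_zero_eq.
    destruct (Rle_lt_or_eq_dec _ _ (norm_pos (minus (proj n e u) u))) as [L | E]; auto; exfalso.
    destruct (Cu _ L) as [v [[m [c [f [Hf ->]]]] Hv]].
    assert (Ev : proj n e (lincomb m c f) = lincomb m c f).
    { clear - Hf Be OP; induction m; simpl; [apply P_zero; auto |].
      rewrite (P_plus _ OP) (P_scal _ OP) IHm; auto.
      rewrite -Be; auto. apply Hf; lia. }
    pose proof (Q_le _ OP (minus u (lincomb m c f))) as B.
    unfold complement_of in B; rewrite (P_minus _ OP) Ev in B.
    vreplace (minus (minus u (lincomb m c f)) (minus (proj n e u) (lincomb m c f)))
      with (minus u (proj n e u)) in B.
    rewrite (norm_minus_sym u (proj n e u)) in B; lra.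
  - intros E d Pd; exists u; split.
    + exists n, (fun i => inner u (e i)), e; split; [| symmetry; exact E].
      intros i Hi; apply (Le i Hi).
    + rewrite minus_self norm_0; auto.
Qed.

(** Uniqueness of orthogonal projections: the difference of the two images of [u] lies in the
    subspace and is orthogonal to it. *)
Lemma spectral_projection_proj P n e :
  low_family n e -> (forall x, low_eigenvector x -> x = proj n e x) ->
  is_spectral_projection D A (fun x => 0 <= x <= Lam) P ->
  forall u, P u = proj n e u.
Proof.
  intros LF Be SP u; destruct (SP u) as [Vu Ou].
  pose proof (low_spectral_subspace n e LF Be) as SV.
  pose proof (proj_orthoprojector (proj n e) n e (proj1 LF) (fun u => eq_refl)) as OP.
  apply minus_eq, norm_zero_eq; set (w := minus (P u) (proj n e u)).
  assert (Ew : proj n e w = w).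
  { unfold w; rewrite (P_minus _ OP) (P_idem _ OP) (proj1 (SV _) Vu); auto. }
  assert (Z : inner w w = 0).
  { specialize (Ou w (proj2 (SV w) Ew)).
    replace (inner w w) with (inner (minus u (proj n e u)) w - inner (minus u (P u)) w)
      by (unfold w; inner_expand; ring).
    rewrite Ou Rminus_0_r -{1}Ew -(P_sym _ OP) (P_minus _ OP) (P_idem _ OP).
    rewrite minus_self inner_zero_l; auto. }
  rewrite inner_norm in Z; nra.
Qed.

End Spectral.

(** * Spectrum and quadratic form on the range and the kernel of [P] *)

Section SpectralBounds.

Context {H : HilbertSpace} {D : H -> Prop} {A : H -> H}.
Context (SA : self_adjoint D A) (NN : nonnegative D A) (CR : compact_resolvent D A).
Context {Lam : R} (Lam_pos : 0 < Lam) {P : H -> H}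
  (SP : is_spectral_projection D A (fun x => 0 <= x <= Lam) P).

Lemma spectral_basis : exists n e l, orthonormal n e /\ (forall u, P u = proj n e u) /\
  (forall i, (i < n)%nat -> D (e i) /\ A (e i) = scal (l i) (e i) /\ 0 <= l i <= Lam) /\
  (forall x, low_eigenvector (D := D) (A := A) Lam x -> P x = x).
Proof.
  destruct (low_basis SA Lam CR) as [n [e [LF Be]]].
  destruct (choice (fun i l => (i < n)%nat ->
    D (e i) /\ A (e i) = scal l (e i) /\ 0 <= l <= Lam)) as [l Hl].
  { intro i; destruct (classic (i < n)%nat) as [Hi | Hi].
    - destruct (proj2 LF i Hi) as [Di [li Hli]]; exists li; intros _; tauto.
    - exists 0; intro; contradiction. }
  pose proof (spectral_projection_proj Lam P n e LF Be SP) as E.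
  exists n, e, l; repeat split; try (apply LF); auto; try (apply Hl; auto).
  intros x Lx; rewrite E; symmetry; auto.
Qed.

Lemma spectral_orthoprojector : orthoprojector P.
Proof.
  destruct spectral_basis as [n [e [l [On [E _]]]]].
  apply (proj_orthoprojector P n e); auto.
Qed.

Let OP := spectral_orthoprojector.

Lemma range_P_finite_dimensional : exists n, has_dimension (range P) n.
Proof.
  destruct spectral_basis as [n [e [l [On [E _]]]]]; exists n, e; split.
  - intro u; rewrite (range_P _ OP) E; split.
    + intro Eu; exists (fun i => inner u (e i)); symmetry; exact Eu.
    + intros [c ->]; apply proj_lincomb; auto.
  - intros c Z i Hi; rewrite -(inner_lincomb_coord On c i Hi) Z; apply inner_zero_l.
Qed.

Lemma D_P u : D (P u).
Proof.
  destruct spectral_basis as [n [e [l [On [E [L _]]]]]]; rewrite E.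
  apply (lincomb_eigen SA n _ e l); intros i Hi; destruct (L i Hi) as [? [? _]]; auto.
Qed.

Lemma A_P u : D u -> P (A u) = A (P u).
Proof.
  intro Du; destruct spectral_basis as [n [e [l [On [E [L _]]]]]]; rewrite !E.
  assert (Le : forall i, (i < n)%nat -> D (e i) /\ A (e i) = scal (l i) (e i))
    by (intros i Hi; destruct (L i Hi) as [? [? _]]; auto).
  unfold proj; rewrite (proj2 (lincomb_eigen SA n _ e l Le)).
  apply lincomb_ext; intros i Hi; split; auto; destruct (Le i Hi) as [Di Ei].
  rewrite (A_sym SA) // Ei; inner_expand; auto.
Qed.

Lemma norm_A_P p : P p = p -> norm (A p) <= Lam * norm p.
Proof.
  intro Ep; destruct spectral_basis as [n [e [l [On [E [L _]]]]]].
  apply norm_le_of_sq; [pose proof (norm_pos p); nra |].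
  rewrite -Ep E /proj.
  rewrite (proj2 (lincomb_eigen SA n _ e l _)).
  2:{ intros i Hi; destruct (L i Hi) as [? [? _]]; auto. }
  rewrite inner_lincomb_lincomb // Rpow_mult_distr norm_lincomb // -rsum_scal.
  apply rsum_le; intros i Hi; destruct (L i Hi) as [_ [_ Hl]].
  set (c := inner p (e i)).
  replace (l i * c * (l i * c)) with (l i ^ 2 * c ^ 2) by ring.
  apply Rmult_le_compat_r; nra.
Qed.

Lemma eigenvalue_in_spectrum x nu :
  D x -> P x = x -> x <> zero -> A x = scal nu x -> spectrum D A (range P) nu.
Proof.
  intros Dx Px Nx Ex [T [_ [TA _]]]; apply Nx.
  rewrite -(TA x) //; [| apply (range_P _ OP); auto].
  rewrite -(TA zero); [| apply (D_zero SA) | apply (range_P _ OP); apply P_zero; auto].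
  f_equal; rewrite Ex (A_zero SA); vec.
Qed.

Lemma norm_lincomb_le n c (e : nat -> H) :
  norm (lincomb n c e) <= rsum n (fun i => Rabs (c i) * norm (e i)).
Proof.
  induction n; simpl; [rewrite norm_0; lra |].
  eapply Rle_trans; [apply norm_plus_le |]; rewrite norm_scal_eq; lra.
Qed.

(** Outside [[0, Lam]] no [l i] equals [nu], and the diagonal operator with entries [1 / (l i - nu)]
    is an explicit bounded resolvent. *)
Lemma spectrum_range_P nu : spectrum D A (range P) nu -> 0 <= nu <= Lam.
Proof.
  destruct spectral_basis as [n [e [l [On [E [L _]]]]]].
  assert (Le : forall i, (i < n)%nat -> D (e i) /\ A (e i) = scal (l i) (e i))
    by (intros i Hi; destruct (L i Hi) as [? [? _]]; auto).
  intro Sp; apply NNPP; intro N; apply Sp; clear Sp.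
  assert (Ne : forall i, (i < n)%nat -> l i - nu <> 0).
  { intros i Hi Z; apply N; replace nu with (l i) by lra; apply L; auto. }
  set (T := fun y => lincomb n (fun i => inner y (e i) / (l i - nu)) e).
  assert (D1 : forall y, D (T y)) by (intro; apply (lincomb_eigen SA n _ e l Le)).
  assert (A1 : forall y, minus (A (T y)) (scal nu (T y)) = P y).
  { intro y; unfold T; rewrite (proj2 (lincomb_eigen SA n _ e l Le)) E /proj.
    set (c := fun i => inner y (e i) / (l i - nu)).
    vreplace (minus (lincomb n (fun i => l i * c i) e) (scal nu (lincomb n c e)))
      with (plus (lincomb n (fun i => l i * c i) e) (scal (- nu) (lincomb n c e))).
    rewrite -lincomb_scal -lincomb_plus.
    apply lincomb_ext; intros i Hi; split; auto; unfold c; field; auto. }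
  exists T; split; [| split].
  - intros y Vy; split; [| split]; auto.
    + apply (range_P _ OP); rewrite E; apply proj_lincomb; auto.
    + rewrite A1; apply (range_P _ OP); auto.
  - intros x Dx Vx; apply (range_P _ OP) in Vx.
    transitivity (proj n e x); [| rewrite -E; exact Vx].
    apply lincomb_ext; intros i Hi; split; auto.
    inner_expand; rewrite (A_sym SA) //; [| apply Le; auto].
    rewrite (proj2 (Le i Hi)); inner_expand; field; auto.
  - exists (rsum n (fun i => / Rabs (l i - nu) * 1)); intros y _.
    eapply Rle_trans; [apply norm_lincomb_le |].
    rewrite Rmult_comm -rsum_scal; apply rsum_le; intros i Hi.
    assert (N1 : norm (e i) = 1).
    { pose proof (proj1 On i Hi) as I; rewrite inner_norm in I; pose proof (norm_pos (e i)); nra. }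
    rewrite N1 /Rdiv Rabs_mult Rabs_inv !Rmult_1_r.
    apply Rmult_le_compat_r.
    + left; apply Rinv_0_lt_compat, Rabs_pos_lt; auto.
    + pose proof (cauchy_schwarz y (e i)) as C; rewrite N1 in C; lra.
Qed.

Lemma beta_bounds : 0 <= beta D A P <= Lam /\
  forall nu, spectrum D A (range P) nu -> nu <= beta D A P.
Proof.
  unfold beta; pose proof (Lub_Rbar_correct (spectrum D A (range P))) as [U V].
  assert (B : Rbar_le (Lub_Rbar (spectrum D A (range P))) Lam).
  { apply V; intros nu Hnu; apply (spectrum_range_P nu Hnu). }
  destruct (Lub_Rbar (spectrum D A (range P))) as [r | |]; simpl in B; try contradiction.
  - split.
    (* A finite supremum cannot be negative: the spectrum lies in [[0, Lam]], so it would be empty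
       and its supremum [m_infty]. *)
    + split; auto; apply Rnot_lt_le; intro Nr; simpl in Nr.
      assert (Z : Rbar_le r m_infty); [| exact Z].
      apply V; intros nu Hnu; exfalso.
      pose proof (U nu Hnu) as Z; simpl in Z; pose proof (spectrum_range_P nu Hnu); simpl in Nr; lra.
    + intros nu Hnu; apply (U nu Hnu).
  (* The spectrum is empty here, and [real m_infty] is 0. *)
  - simpl; split; [lra |]; intros nu Hnu; destruct (U nu Hnu).
Qed.

Lemma form_range_P p : P p = p -> inner (A p) p <= beta D A P * norm p ^ 2.
Proof.
  intro Ep; destruct spectral_basis as [n [e [l [On [E [L _]]]]]].
  rewrite -Ep E /proj.
  rewrite (proj2 (lincomb_eigen SA n _ e l _)).
  2:{ intros i Hi; destruct (L i Hi) as [? [? _]]; auto. }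
  rewrite inner_lincomb_lincomb // norm_lincomb // -rsum_scal.
  apply rsum_le; intros i Hi; destruct (L i Hi) as [Di [Ei Hl]].
  set (c := inner p (e i)).
  replace (l i * c * c) with (l i * c ^ 2) by ring.
  apply Rmult_le_compat_r; [nra |]; apply beta_bounds.
  apply (eigenvalue_in_spectrum (e i)); auto.
  - rewrite E; apply proj_basis; auto.
  - intro Z; pose proof (proj1 On i Hi) as I; rewrite Z inner_zero_l in I; lra.
Qed.

Lemma D_Q u : D u -> D (complement_of P u).
Proof. intro Du; apply (D_minus SA); auto; apply D_P. Qed.

Lemma kernel_dense q d : 0 < d -> P q = zero ->
  exists x, D x /\ P x = zero /\ norm (minus q x) < d.
Proof.
  intros Pd Pq; destruct (D_dense SA q d Pd) as [v [Dv Hv]].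
  exists (complement_of P v); split; [apply D_Q; auto |]; split; [apply PQ; auto |].
  rewrite -{1}(Q_of_Q _ q Pq) -(Q_minus _ OP).
  eapply Rle_lt_trans; [apply Q_le; auto | auto].
Qed.

(** This keeps the numerical range on the kernel, and with it the infimum behind [lambda_plus], from
    being taken over nothing: a trivial kernel would give [H] the finite dimension of [range P]. *)
Lemma kernel_nontrivial : ~ finite_dimensional (@whole H) ->
  exists q, D q /\ P q = zero /\ q <> zero.
Proof.
  intro Inf; apply NNPP; intro N; apply Inf.
  destruct range_P_finite_dimensional as [n [e [B1 B2]]]; exists n, e; split; auto.
  intro u; rewrite -B1 (range_P _ OP); split; [intros _ | intros _; exact I].
  symmetry; apply minus_eq, norm_zero_eq.
  destruct (Rle_lt_or_eq_dec _ _ (norm_pos (complement_of P u))) as [L | E]; auto; exfalso.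
  destruct (kernel_dense (complement_of P u) _ L (PQ _ OP u)) as [x [Dx [Px Hx]]].
  assert (x = zero) as ->.
  { apply NNPP; intro Nx; apply N; exists x; auto. }
  vreplace (minus (complement_of P u) (zero : H)) with (complement_of P u) in Hx; lra.
Qed.

(** The injectivity half of the Fredholm alternative for [1 - c T]. If the bound failed, compactness
    would turn almost-null unit vectors into a unit vector [w] with [w = c T w], that is
    [A w = (l0 + c) w]; then [P] fixes [w] as a low eigenvector and also annihilates it. *)
Lemma bounded_below_on_kernel l0 T c :
  is_resolvent D A whole l0 T -> compact_operator T -> l0 + c <= Lam ->
  (forall a x, T (scal a x) = scal a (T x)) ->
  (forall x y, T (minus x y) = minus (T x) (T y)) ->
  exists d, 0 < d <= 1 /\
    forall x, P x = zero -> d * norm x <= norm (minus x (scal c (T x))).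
Proof.
  intros [TD [TA [C HC]]] CT Hc Tscal Tminus; apply NNPP; intro N.
  destruct (choice (fun (n : nat) x => P x = zero /\ norm x = 1 /\
    norm (minus x (scal c (T x))) < / (INR n + 1))) as [x Hx].
  { intro n; apply NNPP; intro Nn; apply N; exists (/ (INR n + 1)); pose proof (pos_INR n).
    split; [split; [apply Rinv_0_lt_compat; lra | rewrite -Rinv_1; apply Rinv_le_contravar; lra] |].
    intros y Py; apply Rnot_lt_le; intro Ly; apply Nn.
    assert (0 < norm y).
    { destruct (Rle_lt_or_eq_dec _ _ (norm_pos y)) as [? | Z]; auto.
      rewrite -Z Rmult_0_r in Ly; pose proof (norm_pos (minus y (scal c (T y)))); lra. }
    assert (0 < / norm y) by (apply Rinv_0_lt_compat; auto).
    exists (scal (/ norm y) y); split; [rewrite (P_scal _ OP) Py; vec |]; split.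
    - rewrite norm_scal_pos; [field; lra | lra].
    - rewrite Tscal; vreplace (minus (scal (/ norm y) y) (scal c (scal (/ norm y) (T y))))
        with (scal (/ norm y) (minus y (scal c (T y)))).
      rewrite norm_scal_pos; [| lra].
      apply (Rmult_lt_reg_l (norm y)); auto; rewrite -Rmult_assoc Rinv_r; lra. }
  destruct (CT x 1) as [l [phi [Mphi Hl]]]; [intro n; right; apply Hx |].
  assert (Cl : converges (fun n => T (x (phi n))) l).
  { intros e Pe.
    assert (Pd : 0 < e / @norm_factor R_AbsRing H).
    { apply Rdiv_lt_0_compat; [lra |]; pose proof (@norm_factor_gt_0 R_AbsRing H); lra. }
    rewrite filterlim_locally in Hl; destruct (Hl (mkposreal _ Pd)) as [M HM].
    exists M; intros n Hn; specialize (HM n Hn).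
    pose proof (norm_compat2 (V := H) _ _ _ HM) as B; simpl in B.
    eapply Rlt_le_trans; [exact B |]; right; field.
    pose proof (@norm_factor_gt_0 R_AbsRing H); lra. }
  assert (Gphi : forall n, (n <= phi n)%nat).
  { induction n; [lia |]; specialize (Mphi n (S n) (Nat.lt_succ_diag_r n)); lia. }
  set (w := scal c l).
  (* Since [x - c T x] tends to 0 along the sequence and [T x] tends to [l], the vectors [x]
     themselves converge to [c l]. *)
  assert (Cw : converges (fun n => x (phi n)) w).
  { intros e Pe; pose proof (Rabs_pos c).
    destruct (Cl (e / (2 * (Rabs c + 1)))) as [M1 H1]; [apply Rdiv_lt_0_compat; lra |].
    destruct (INR_unbounded (2 / e)) as [M2 H2].
    exists (max M1 M2); intros n Hn; specialize (H1 n ltac:(lia)).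
    vreplace (minus (x (phi n)) w) with
      (plus (minus (x (phi n)) (scal c (T (x (phi n))))) (scal c (minus (T (x (phi n))) l))).
    eapply Rle_lt_trans; [apply norm_plus_le |]; rewrite norm_scal_eq.
    destruct (Hx (phi n)) as [_ [_ B]].
    assert (M3 : INR M2 <= INR (phi n)) by (apply le_INR; specialize (Gphi n); lia).
    assert (/ (INR (phi n) + 1) <= e / 2).
    { replace (e / 2) with (/ (2 / e)) by (field; lra).
      apply Rinv_le_contravar; [apply Rdiv_lt_0_compat; lra | lra]. }
    assert (Rabs c * norm (minus (T (x (phi n))) l) <= e / 2); [| lra].
    apply Rle_trans with ((Rabs c + 1) * (e / (2 * (Rabs c + 1)))).
    - pose proof (norm_pos (minus (T (x (phi n))) l)); nra.
    - right; field; lra. }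
  assert (Pw : P w = zero).
  { apply (kernel_closed _ OP (fun n => x (phi n))); auto; intro; apply Hx. }
  assert (Nw : norm w = 1).
  { apply cond_eq; intros e Pe; destruct (Cw e Pe) as [M HM]; specialize (HM M (le_n _)).
    destruct (Hx (phi M)) as [_ [N1 _]]; rewrite -N1 Rabs_minus_sym.
    eapply Rle_lt_trans; [apply norm_minus_ge | auto]. }
  assert (Tw : T w = l).
  { apply (converges_unique (fun n => T (x (phi n)))); auto.
    intros e Pe; pose proof (Rabs_pos C).
    destruct (Cw (e / (Rabs C + 1))) as [M HM]; [apply Rdiv_lt_0_compat; lra |].
    exists M; intros n Hn; specialize (HM n Hn); rewrite -Tminus.
    eapply Rle_lt_trans; [apply HC; exact I |].
    pose proof (norm_pos (minus (x (phi n)) w)); pose proof (Rle_abs C).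
    apply Rle_lt_trans with (Rabs C * (e / (Rabs C + 1))); [nra |].
    apply (Rmult_lt_reg_r (Rabs C + 1)); [lra |]; field_simplify; nra. }
  destruct (TD w I) as [Dw [_ Ew]]; rewrite Tw in Dw Ew.
  assert (Aw : A w = scal (l0 + c) w).
  { unfold w at 1; rewrite (A_scal SA) //.
    vreplace (A l) with (plus (minus (A l) (scal l0 l)) (scal l0 l)); rewrite Ew.
    unfold w; vec. }
  assert (DW : D w) by (apply (D_scal SA); auto).
  clearbody w.
  destruct spectral_basis as [n [e [ll [_ [_ [_ Lo]]]]]].
  rewrite (Lo w) in Pw.
  - rewrite Pw norm_0 in Nw; lra.
  (* Nonnegativity of [A], tested on the unit vector [w], supplies [0 <= l0 + c]. *)
  - split; auto; exists (l0 + c); split; auto; split; auto.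
    pose proof (NN w DW) as F; rewrite Aw in F; revert F; inner_expand.
    rewrite inner_norm Nw; lra.
Qed.

(** With [c = nu - l0], the equation [(A - nu) x = y] is equivalent to [x - c T x = T y]. The task
    is thus to invert the bounded operator [S = 1 - c T] on the kernel of [P]. *)
Lemma resolvent_on_kernel nu : nu <= Lam ->
  exists R0, is_resolvent D A (range (complement_of P)) nu R0.
Proof.
  intro Hnu; destruct CR as [l0 [T [RT CT]]].
  pose proof RT as [TD [TA [C HC]]].
  assert (TE : forall x y, D x -> minus (A x) (scal l0 x) = y -> T y = x).
  { intros x y Dx <-; apply TA; auto; exact I. }
  assert (Tscal : forall a x, T (scal a x) = scal a (T x)).
  { intros a x; destruct (TD x I) as [Dx [_ Ex]]; apply TE; [apply (D_scal SA); auto |].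
    rewrite (A_scal SA) //; transitivity (scal a (minus (A (T x)) (scal l0 (T x))));
      [vec | rewrite Ex; auto]. }
  assert (Tminus : forall x y, T (minus x y) = minus (T x) (T y)).
  { intros x y; destruct (TD x I) as [Dx [_ Ex]]; destruct (TD y I) as [Dy [_ Ey]].
    apply TE; [apply (D_minus SA); auto |].
    rewrite (A_minus SA) //.
    transitivity (minus (minus (A (T x)) (scal l0 (T x))) (minus (A (T y)) (scal l0 (T y))));
      [vec | rewrite Ex Ey; auto]. }
  assert (Tsym : forall x y, inner (T x) y = inner x (T y)).
  { intros x y; destruct (TD x I) as [Dx [_ Ex]]; destruct (TD y I) as [Dy [_ Ey]].
    transitivity (inner (T x) (minus (A (T y)) (scal l0 (T y)))); [rewrite Ey; auto |].
    transitivity (inner (minus (A (T x)) (scal l0 (T x))) (T y)); [| rewrite Ex; auto].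
    inner_expand; rewrite (A_sym SA) //; ring. }
  assert (TP : forall x, P x = zero -> P (T x) = zero).
  { intros x Px; destruct spectral_basis as [n [e [l [On [E [L _]]]]]].
    rewrite E; vreplace (zero : H) with (scal 0 (zero : H)).
    rewrite /proj (lincomb_ext n _ (fun i => 0 * 0) e e);
      [rewrite (lincomb_scal n 0 (fun _ => 0)); vec |].
    intros i Hi; split; auto; destruct (L i Hi) as [Di [Ei _]].
    assert (I0 : inner x (e i) = 0).
    { rewrite inner_sym; apply (inner_range_kernel _ OP); auto.
      rewrite E; apply proj_basis; auto. }
    (* An eigenvalue equal to [l0] would force the resolvent [T] to send zero to both [e i] and
       zero. *)
    assert (Ne : l i - l0 <> 0).
    { intro Z; assert (Te : T zero = e i).
      { apply TE; auto; rewrite Ei; replace l0 with (l i) by lra; vec. }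
      assert (T0 : T zero = zero) by (apply TE; [apply (D_zero SA) | rewrite (A_zero SA); vec]).
      pose proof (proj1 On i Hi) as I1; rewrite -Te T0 inner_zero_l in I1; lra. }
    destruct (TD x I) as [Dx [_ Ex]].
    rewrite -Ex in I0; revert I0; inner_expand; rewrite (A_sym SA) // Ei; inner_expand; intro I0.
    apply (Rmult_eq_reg_l (l i - l0)); auto; lra. }
  set (c := nu - l0).
  destruct (bounded_below_on_kernel l0 T c RT CT ltac:(unfold c; lra) Tscal Tminus)
    as [d [Hd Bd]].
  set (S := fun x => minus x (scal c (T x))).
  assert (SE : forall x, S x = minus x (scal c (T x))) by reflexivity.
  change (forall x, P x = zero -> d * norm x <= norm (S x)) in Bd; clearbody S.
  assert (Sminus : forall x y, S (minus x y) = minus (S x) (S y))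
    by (intros; rewrite !SE Tminus; vec).
  assert (Ssym : forall x y, inner (S x) y = inner x (S y)).
  { intros; rewrite !SE; inner_expand; rewrite Tsym; ring. }
  assert (SPz : forall x, P x = zero -> P (S x) = zero).
  { intros x Px; rewrite SE (P_minus _ OP) (P_scal _ OP) Px TP //; vec. }
  set (K := 1 + Rabs c * Rabs C).
  assert (PK : 1 <= K) by (unfold K; pose proof (Rabs_pos c); pose proof (Rabs_pos C); nra).
  assert (SK : forall x, norm (S x) <= K * norm x).
  { intro x; rewrite SE; eapply Rle_trans; [apply norm_minus_le |]; rewrite norm_scal_eq.
    unfold K; rewrite Rmult_plus_distr_r Rmult_1_l Rmult_assoc; apply Rplus_le_compat_l.
    apply Rmult_le_compat_l; [apply Rabs_pos |].
    eapply Rle_trans; [apply HC; exact I |]; apply Rmult_le_compat_r; [apply norm_pos | apply Rle_abs]. }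
  (* [S] is symmetric and bounded below, so that Richardson's iteration for
     [S (S x) = y] contracts. *)
  assert (Surj : forall y, P y = zero -> exists x, P x = zero /\ S x = y).
  { intros y Py.
    (* Since [norm (S (S z)) <= K * norm (S z)], this step size gives [norm (z - om S (S z)) ^ 2 <=
       norm z ^ 2 - om * norm (S z) ^ 2 <= (1 - om d ^ 2) * norm z ^ 2], which is at most the square
       of the contraction factor. *)
    set (om := / K ^ 2). assert (K2 : 0 < K ^ 2) by nra.
    assert (Pom : 0 < om) by (apply Rinv_0_lt_compat; auto).
    assert (Eom : om * K ^ 2 = 1) by (apply Rinv_l; lra).
    assert (Hom : om * d ^ 2 <= 1).
    { rewrite -Eom; apply Rmult_le_compat_l; [lra |].
      apply Rle_trans with (1 ^ 2); [apply pow_incr | apply pow_incr]; lra. }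
    assert (Podd : 0 < om * d ^ 2) by (apply Rmult_lt_0_compat; auto; nra).
    destruct (fixed_point (fun x => P x = zero)
      (fun x => minus x (scal om (minus (S (S x)) y))) (1 - om * d ^ 2 / 2) zero) as [x [Px Fx]].
    - lra.
    - intros u l Ku Cu; apply (kernel_closed _ OP u); auto.
    - apply P_zero; auto.
    - intros x Px; rewrite (P_minus _ OP) (P_scal _ OP) (P_minus _ OP) Px Py SPz; [vec |].
      apply SPz; auto.
    - intros x x' Px Px'.
      vreplace (minus (minus x (scal om (minus (S (S x)) y)))
                      (minus x' (scal om (minus (S (S x')) y))))
        with (minus (minus x x') (scal om (minus (S (S x)) (S (S x'))))).
      rewrite -!Sminus; set (z := minus x x').
      assert (Pz : P z = zero) by (unfold z; rewrite (P_minus _ OP) Px Px'; vec).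
      clearbody z; pose proof (norm_pos z) as Nz.
      apply norm_le_of_sq; [apply Rmult_le_pos; lra |].
      assert (E : inner (minus z (scal om (S (S z)))) (minus z (scal om (S (S z)))) =
        norm z ^ 2 - 2 * om * norm (S z) ^ 2 + om ^ 2 * norm (S (S z)) ^ 2).
      { inner_expand; rewrite (inner_sym _ z (S (S z))) (Ssym (S z) z) !inner_norm; ring. }
      rewrite E.
      assert (B1 : norm (S (S z)) ^ 2 <= K ^ 2 * norm (S z) ^ 2).
      { rewrite -Rpow_mult_distr; apply pow_incr; split; [apply norm_pos | apply SK]. }
      assert (B2 : d ^ 2 * norm z ^ 2 <= norm (S z) ^ 2).
      { rewrite -Rpow_mult_distr; apply pow_incr; split; [nra | apply Bd; auto]. }
      apply Rle_trans with (norm z ^ 2 - om * norm (S z) ^ 2).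
      + assert (om ^ 2 * norm (S (S z)) ^ 2 <= om * norm (S z) ^ 2); [| lra].
        replace (om * norm (S z) ^ 2) with (om ^ 2 * (K ^ 2 * norm (S z) ^ 2)).
        * apply Rmult_le_compat_l; [nra | auto].
        * transitivity (om * (om * K ^ 2) * norm (S z) ^ 2); [ring | rewrite Eom; ring].
      + rewrite Rpow_mult_distr.
        assert (om * (d ^ 2 * norm z ^ 2) <= om * norm (S z) ^ 2) by (apply Rmult_le_compat_l; lra).
        assert (0 <= norm z ^ 2) by nra.
        assert (0 <= (om * d ^ 2 / 2) ^ 2 * norm z ^ 2) by (apply Rmult_le_pos; auto; nra).
        nra.
    - exists (S x); split; [apply SPz; auto |].
      apply minus_eq; vreplace (minus (S (S x)) y)
        with (scal (/ om) (minus x (minus x (scal om (minus (S (S x)) y))))).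
      rewrite Fx; vec. }
  set (R0 := fun y => epsilon (inhabits (zero : H)) (fun x => P x = zero /\ S x = T y)).
  assert (HR : forall y, P y = zero -> P (R0 y) = zero /\ S (R0 y) = T y).
  { intros y Py; apply (epsilon_spec (inhabits (zero : H)) (fun x => P x = zero /\ S x = T y)).
    apply Surj; auto. }
  exists R0; split; [| split].
  - intros y Vy; apply (range_Q _ OP) in Vy; destruct (HR y Vy) as [Px Sx].
    rewrite (range_Q _ OP).
    (* Rewriting [S x = T y] as [x = T (y + c x)] shows that [x] lies in the domain and lets
       [A - l0] cancel [T]. *)
    assert (Ex : R0 y = T (minus y (scal (- c) (R0 y)))).
    { rewrite Tminus Tscal -Sx SE; vec. }
    destruct (TD (minus y (scal (- c) (R0 y))) I) as [D1 [_ E1]].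
    rewrite -Ex in D1 E1; split; auto; split; auto.
    replace nu with (l0 + c) by (unfold c; ring).
    vreplace (minus (A (R0 y)) (scal (l0 + c) (R0 y)))
      with (minus (minus (A (R0 y)) (scal l0 (R0 y))) (scal c (R0 y))).
    rewrite E1; vec.
  - intros x Dx Vx; apply (range_Q _ OP) in Vx.
    set (y := minus (A x) (scal nu x)).
    assert (Py : P y = zero).
    { unfold y; rewrite (P_minus _ OP) (P_scal _ OP) A_P // Vx (A_zero SA); vec. }
    destruct (HR y Py) as [Px Sx].
    assert (Sx' : S x = T y).
    { rewrite SE; transitivity (minus (T (minus (A x) (scal l0 x))) (T (scal c x))).
      - rewrite (TA x Dx I) Tscal; auto.
      - rewrite -Tminus; f_equal; unfold y, c; vec. }
    apply minus_eq, norm_zero_eq.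
    pose proof (Bd (minus (R0 y) x)) as B.
    rewrite (P_minus _ OP) Px Vx Sminus Sx Sx' !minus_self norm_0 in B.
    specialize (B eq_refl); pose proof (norm_pos (minus (R0 y) x)); nra.
  - exists (Rabs C / d); intros y Vy; apply (range_Q _ OP) in Vy; destruct (HR y Vy) as [Px Sx].
    pose proof (Bd _ Px) as B; rewrite Sx in B.
    pose proof (HC y I); pose proof (norm_pos y); pose proof (Rle_abs C).
    apply (Rmult_le_reg_l d); [lra |].
    replace (d * (Rabs C / d * norm y)) with (Rabs C * norm y) by (field; lra); nra.
Qed.

(** A bounded inverse of [B = A - m] would make its nonnegative form coercive: with [B z = q],
    Cauchy-Schwarz for the form gives [norm q ^ 4 <= inner (B q) q * inner q z], and [inner q z] is
    at most a constant times [norm q ^ 2]. This contradicts [m] being approached. *)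
Lemma numerical_infimum_in_spectrum m :
  (forall q, D q -> P q = zero -> m * norm q ^ 2 <= inner (A q) q) ->
  (forall m', m < m' -> exists q, D q /\ P q = zero /\ inner (A q) q < m' * norm q ^ 2) ->
  spectrum D A (range (complement_of P)) m.
Proof.
  intros LB Inf [T [TD [TA [C HC]]]].
  set (C' := Rabs C + 1). assert (PC : 0 < C') by (unfold C'; pose proof (Rabs_pos C); lra).
  assert (PiC : 0 < / C') by (apply Rinv_0_lt_compat; auto).
  destruct (Inf (m + / C')) as [q [Dq [Pq Hq]]]; [lra |].
  set (B := fun x => minus (A x) (scal m x)).
  assert (Vq : range (complement_of P) q) by (apply (range_Q _ OP); auto).
  destruct (TD q Vq) as [Dz [Vz Bz]]; set (z := T q) in *; change (B z = q) in Bz.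
  apply (range_Q _ OP) in Vz.
  (* Cauchy-Schwarz for the nonnegative form [inner (B x) y], at [x = q, y = z] *)
  assert (Bq : inner (B q) z = norm q ^ 2).
  { transitivity (inner q (B z)); [| rewrite Bz inner_norm; auto].
    unfold B; inner_expand; rewrite (A_sym SA) //; ring. }
  set (f := inner (B q) q).
  assert (Ef : f = inner (A q) q - m * norm q ^ 2)
    by (unfold f, B; inner_expand; rewrite inner_norm; auto).
  assert (G : forall s, 0 <= f - 2 * s * norm q ^ 2 + s ^ 2 * inner q z).
  { intro s; pose proof (LB (minus q (scal s z)) (D_minus SA _ _ Dq (D_scal SA _ _ Dz))) as L.
    rewrite (P_minus _ OP) (P_scal _ OP) Pq Vz in L.
    specialize (L ltac:(vec)); rewrite -inner_norm in L.
    assert (L' : 0 <= inner (B (minus q (scal s z))) (minus q (scal s z)))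
      by (unfold B; rewrite inner_minus_l inner_scal_l; lra).
    assert (EB : B (minus q (scal s z)) = minus (B q) (scal s (B z))).
    { unfold B; rewrite (A_minus SA) ?(A_scal SA) //; [vec | apply (D_scal SA); auto]. }
    rewrite EB Bz in L'; clearbody B; revert L'; inner_expand; rewrite -/f Bq inner_norm; lra. }
  assert (Hz : inner q z <= C' * norm q ^ 2).
  { eapply Rle_trans; [apply inner_le |].
    pose proof (HC q Vq) as HCq; fold z in HCq.
    pose proof (norm_pos q); pose proof (Rle_abs C); unfold C'; nra. }
  (* At this [s] the quadratic in [G] yields [f >= norm q ^ 2 / C'], against the choice of [q] with
     form below [(m + / C') * norm q ^ 2]. *)
  specialize (G (/ C')).
  assert (Hf : f < / C' * norm q ^ 2) by (rewrite Ef; lra).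
  assert ((/ C') ^ 2 * inner q z <= / C' * norm q ^ 2); [| lra].
  apply Rle_trans with ((/ C') ^ 2 * (C' * norm q ^ 2)).
  - apply Rmult_le_compat_l; [nra | auto].
  - right; field; lra.
Qed.

(** The best form bound [m] on the kernel is the supremum of [W]. It belongs to the spectrum, so the
    spectral infimum is finite and at most [m], and the form bound holds with [lambda_plus] too;
    resolvents below the cutoff bound that infimum from below. *)
Lemma lambda_plus_bounds : ~ finite_dimensional (@whole H) ->
  Lam <= lambda_plus D A P /\
  forall q, D q -> P q = zero -> lambda_plus D A P * norm q ^ 2 <= inner (A q) q.
Proof.
  intro Inf; destruct (kernel_nontrivial Inf) as [q0 [Dq0 [Pq0 Nq0]]].
  set (W := fun m => forall q, D q -> P q = zero -> m * norm q ^ 2 <= inner (A q) q).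
  assert (N0 : 0 < norm q0 ^ 2).
  { destruct (Rle_lt_or_eq_dec _ _ (norm_pos q0)) as [? | Z]; [nra |].
    exfalso; apply Nq0, norm_zero_eq; auto. }
  destruct (completeness W) as [m [Um Lm]].
  { exists (inner (A q0) q0 / norm q0 ^ 2); intros m Wm; specialize (Wm q0 Dq0 Pq0).
    apply (Rmult_le_reg_r (norm q0 ^ 2)); auto.
    replace (inner (A q0) q0 / norm q0 ^ 2 * norm q0 ^ 2) with (inner (A q0) q0); auto.
    field; intro Z; rewrite Z in N0; simpl in N0; lra. }
  { exists 0; intros q Dq _; pose proof (NN q Dq); lra. }
  assert (Wm : W m).
  { intros q Dq Pq; apply Rnot_lt_le; intro L.
    assert (0 <= norm q ^ 2) by apply pow2_ge_0.
    assert (Nq : 0 < norm q ^ 2).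
    { destruct (Rle_lt_or_eq_dec _ _ H0) as [? | Z]; auto.
      rewrite -Z in L; pose proof (NN q Dq); lra. }
    assert (B : m <= inner (A q) q / norm q ^ 2).
    { apply Lm; intros m' Wm'; apply (Rmult_le_reg_r (norm q ^ 2)); auto.
      eapply Rle_trans; [apply Wm'; auto |]; right; field.
      intro Z; rewrite Z in Nq; simpl in Nq; lra. }
    apply (Rmult_le_compat_r (norm q ^ 2)) in B; auto.
    replace (inner (A q) q / norm q ^ 2 * norm q ^ 2) with (inner (A q) q) in B; [lra |].
    field; intro Z; rewrite Z in Nq; simpl in Nq; lra. }
  assert (Sm : spectrum D A (range (complement_of P)) m).
  { apply numerical_infimum_in_spectrum; auto.
    intros m' Hm'; apply NNPP; intro N; assert (m' <= m); [| lra].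
    apply Um; intros q Dq Pq; apply Rnot_lt_le; intro L; apply N; exists q; auto. }
  unfold lambda_plus.
  pose proof (Glb_Rbar_correct (spectrum D A (range (complement_of P)))) as [U V].
  assert (B : Rbar_le Lam (Glb_Rbar (spectrum D A (range (complement_of P))))).
  { apply V; intros nu Snu; simpl; apply Rnot_lt_le; intro L; apply Snu.
    apply resolvent_on_kernel; lra. }
  pose proof (U m Sm) as Gm.
  destruct (Glb_Rbar (spectrum D A (range (complement_of P)))) as [r | |];
    simpl in *; try contradiction.
  split; auto; intros q Dq Pq; eapply Rle_trans; [| apply Wm; auto].
  apply Rmult_le_compat_r; auto; apply pow2_ge_0.
Qed.

End SpectralBounds.

(** * Strongly continuous semigroups *)

Lemma rcont_sq f : rcont f -> rcont (fun t => f t ^ 2).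
Proof.
  intros Cf t Ht e Pe; pose proof (Rabs_pos (f t)) as P0.
  destruct (Cf t Ht (Rmin 1 (e / (2 * Rabs (f t) + 2)))) as [d [Pd Hd]].
  { apply Rmin_pos; [lra | apply Rdiv_lt_0_compat; lra]. }
  exists d; split; auto; intros s Ps Hs; specialize (Hd s Ps Hs).
  pose proof (Rmin_l 1 (e / (2 * Rabs (f t) + 2))).
  pose proof (Rmin_r 1 (e / (2 * Rabs (f t) + 2))).
  replace (f s ^ 2 - f t ^ 2) with ((f s - f t) * ((f s - f t) + 2 * f t)) by ring.
  rewrite Rabs_mult; pose proof (Rabs_pos (f s - f t)).
  assert (B : Rabs (f s - f t + 2 * f t) <= 2 * Rabs (f t) + 1).
  { eapply Rle_trans; [apply Rabs_triang |]; rewrite Rabs_mult (Rabs_pos_eq 2); lra. }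
  apply Rle_lt_trans with (e / (2 * Rabs (f t) + 2) * (2 * Rabs (f t) + 1)).
  - apply Rmult_le_compat; try apply Rabs_pos; lra.
  - apply (Rmult_lt_reg_r (2 * Rabs (f t) + 2)); [lra |].
    replace (e / (2 * Rabs (f t) + 2) * (2 * Rabs (f t) + 1) * (2 * Rabs (f t) + 2))
      with (e * (2 * Rabs (f t) + 1)) by (field; lra).
    apply Rmult_lt_compat_l; lra.
Qed.

Section Linear.

Context {H : HilbertSpace}.

Lemma linear_minus (l : H -> H) x y : is_linear l -> l (minus x y) = minus (l x) (l y).
Proof.
  intro Hl; vreplace (minus x y) with (plus x (scal (-1) y)).
  rewrite (linear_plus _ Hl) (linear_scal _ Hl); vec.
Qed.

Lemma linear_bounded (l : H -> H) : is_linear l ->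
  exists C, 0 < C /\ forall x, norm (l x) <= C * norm x.
Proof. intros [_ _ [C [PC HC]]]; exists C; auto. Qed.

Lemma Riemann_sum_linear (l : H -> H) (f : R -> H) ptd : is_linear l ->
  Riemann_sum (fun s => l (f s)) ptd = l (Riemann_sum f ptd).
Proof.
  intro Hl; apply (SF_cons_ind (fun ptd => Riemann_sum (fun s => l (f s)) ptd = l (Riemann_sum f ptd))).
  - intro x0. unfold Riemann_sum; simpl.
    vreplace (zero : H) with (scal 0 (zero : H)); rewrite (linear_scal _ Hl); vec.
  - intros h s IH; rewrite !Riemann_sum_cons IH.
    rewrite (linear_plus _ Hl) (linear_scal _ Hl); auto.
Qed.

Lemma is_RInt_linear (l : H -> H) (f : R -> H) a b I : is_linear l ->
  is_RInt f a b I -> is_RInt (fun s => l (f s)) a b (l I).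
Proof.
  intros Hl HI; unfold is_RInt.
  apply (filterlim_ext (fun ptd => l (scal (sign (b - a)) (Riemann_sum f ptd)))).
  - intro ptd; rewrite Riemann_sum_linear //; apply (linear_scal _ Hl).
  - eapply filterlim_comp; [exact HI |]; apply (linear_cont l I Hl).
Qed.

End Linear.

Section Semigroup.

Context {H : HilbertSpace} {E : R -> H -> H} (C0 : C0_semigroup E).

Lemma E_linear t : 0 <= t -> is_linear (E t).
Proof. apply C0. Qed.

Lemma E_0 x : E 0 x = x.
Proof. apply C0. Qed.

Lemma E_plus s t x : 0 <= s -> 0 <= t -> E (s + t) x = E s (E t x).
Proof. apply C0. Qed.

Lemma E_minus t x y : 0 <= t -> E t (minus x y) = minus (E t x) (E t y).
Proof. intro; apply linear_minus, E_linear; auto. Qed.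

Lemma E_scal t a x : 0 <= t -> E t (scal a x) = scal a (E t x).
Proof. intro; apply (linear_scal _ (E_linear t ltac:(auto))). Qed.

Lemma at_right_norm (f : R -> H) l :
  filterlim f (at_right 0) (locally l) <->
  forall e, 0 < e -> at_right 0 (fun r => norm (minus (f r) l) < e).
Proof.
  rewrite (filterlim_locally_ball_norm (K := R_AbsRing) (U := H)); split.
  - intros Hf e Pe; apply (Hf (mkposreal e Pe)).
  - intros Hf e; apply Hf, cond_pos.
Qed.

Lemma E_right_0 x e : 0 < e -> at_right 0 (fun r => norm (minus (E r x) x) < e).
Proof. apply at_right_norm, C0. Qed.

(* Uniform boundedness by nested balls: if [E] were unbounded near [0], some vector
   would have an unbounded orbit near [0]. *)
Lemma E_bounded_near_0 :
  exists K d, 1 <= K /\ 0 < d /\ forall t x, 0 <= t <= d -> norm (E t x) <= K * norm x.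
Proof.
  apply NNPP; intro N.
  assert (Unb : forall K d, 0 < K -> 0 < d ->
    exists t x, 0 < t <= d /\ K * norm x < norm (E t x)).
  { intros K d PK Pd; apply NNPP; intro N'; apply N; exists (K + 1), d.
    split; [lra |]; split; auto; intros t x [Ht Hd].
    pose proof (norm_pos x).
    destruct (Rle_lt_or_eq_dec _ _ Ht) as [Pt | <-]; [| rewrite E_0; nra].
    apply Rnot_lt_le; intro L; apply N'; exists t, x; split; [lra | nra]. }
  assert (Step : forall n x r, 0 < r -> exists x' r',
    norm (minus x' x) <= r / 2 /\ 0 < r' <= r / 2 /\
    exists t, 0 < t <= / (INR n + 1) /\
      forall y, norm (minus y x') <= r' -> INR n <= norm (E t y)).
  { intros n x r Pr; pose proof (pos_INR n) as Pn.
    destruct (Unb (2 * (INR n + 1) / r) (/ (INR n + 1))) as [t [xi [Ht Hxi]]].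
    { apply Rdiv_lt_0_compat; lra. } { apply Rinv_0_lt_compat; lra. }
    assert (Pt : 0 <= t) by lra.
    assert (Nxi : 0 < norm xi).
    { destruct (Rle_lt_or_eq_dec _ _ (norm_pos xi)) as [? | Z]; auto; exfalso.
      symmetry in Z; apply norm_zero_eq in Z; subst xi.
      destruct (linear_bounded _ (E_linear t Pt)) as [B [_ HB]].
      specialize (HB zero); rewrite norm_0 in HB, Hxi; lra. }
    set (w := scal (r / 2 / norm xi) xi).
    assert (Nw : norm w = r / 2).
    { unfold w; rewrite norm_scal_pos; [field; lra |].
      left; apply Rdiv_lt_0_compat; lra. }
    assert (Ew : INR n + 1 <= norm (E t w)).
    { unfold w; rewrite E_scal // norm_scal_pos; [| left; apply Rdiv_lt_0_compat; lra].
      apply Rle_trans with (r / 2 / norm xi * (2 * (INR n + 1) / r * norm xi)).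
      - right; field; lra.
      - apply Rmult_le_compat_l; [left; apply Rdiv_lt_0_compat; lra | lra]. }
    (* The images of [x + w] and [x - w] differ by [2 E t w], so at least one of them is as large as
       [E t w]. *)
    assert (Ch : exists x', norm (minus x' x) <= r / 2 /\ INR n + 1 <= norm (E t x')).
    { destruct (Rle_lt_dec (INR n + 1) (norm (E t (plus x w)))) as [L | L].
      - exists (plus x w); split; auto.
        vreplace (minus (plus x w) x) with w; lra.
      - exists (minus x w); split.
        + vreplace (minus (minus x w) x) with (opp w); rewrite norm_opp_eq; lra.
        + assert (T : norm (scal 2 (E t w)) <= norm (E t (plus x w)) + norm (E t (minus x w))).
          { vreplace (scal 2 (E t w)) with
              (minus (plus (E t x) (E t w)) (minus (E t x) (E t w))).
            rewrite -(E_minus t) // -(linear_plus _ (E_linear t Pt)).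
            apply norm_minus_le. }
          rewrite norm_scal_pos in T; lra. }
    destruct Ch as [x' [Hx' Ex']].
    destruct (linear_bounded _ (E_linear t Pt)) as [B [PB HB]].
    (* On a ball of radius [/ B] the values of [E t] vary by at most 1, which costs [INR n + 1] no
       more than dropping to [INR n]. *)
    exists x', (Rmin (r / 2) (/ B)); split; auto; split.
    - split; [apply Rmin_pos; [lra | apply Rinv_0_lt_compat; auto] | apply Rmin_l].
    - exists t; split; auto; intros y Hy.
      assert (norm (minus (E t x') (E t y)) <= 1).
      { rewrite -E_minus // norm_minus_sym in Hy *; eapply Rle_trans; [apply HB |].
        apply Rle_trans with (B * / B); [| rewrite Rinv_r; lra].
        apply Rmult_le_compat_l; [lra |].
        eapply Rle_trans; [exact Hy | apply Rmin_r]. }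
      pose proof (norm_le_minus (E t x') (E t y)); lra. }
  destruct (choice (fun (s : nat * (H * R)) (s' : H * R) => let '(n, (x, r)) := s in
    0 < r -> norm (minus (fst s') x) <= r / 2 /\ 0 < snd s' <= r / 2 /\
    exists t, 0 < t <= / (INR n + 1) /\
      forall y, norm (minus y (fst s')) <= snd s' -> INR n <= norm (E t y))) as [f Hf].
  { intros [n [x r]]; destruct (Rlt_dec 0 r) as [Pr | Nr].
    - destruct (Step n x r Pr) as [x' [r' S]]; exists (x', r'); auto.
    - exists (x, r); intro; contradiction. }
  set (s := nat_rect (fun _ => (H * R)%type) ((zero : H), 1) (fun n p => f (n, p))).
  set (x := fun n => fst (s n)); set (r := fun n => snd (s n)).
  assert (Pr : forall n, 0 < r n).
  { induction n; [unfold r; simpl; lra |].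
    pose proof (Hf (n, (x n, r n)) IHn) as [_ [S _]].
    unfold r, x in *; simpl in *; rewrite -surjective_pairing in S; lra. }
  assert (S : forall n, norm (minus (x (S n)) (x n)) <= r n / 2 /\ 0 < r (S n) <= r n / 2 /\
    exists t, 0 < t <= / (INR n + 1) /\
      forall y, norm (minus y (x (S n))) <= r (S n) -> INR n <= norm (E t y)).
  { intro n; pose proof (Hf (n, (x n, r n)) (Pr n)) as S.
    unfold r, x in *; simpl in *; rewrite -surjective_pairing in S; exact S. }
  assert (Nest : forall n j, norm (minus (x (n + j)%nat) (x n)) <= r n - r (n + j)%nat).
  { induction j; [rewrite Nat.add_0_r minus_self norm_0; lra |].
    rewrite Nat.add_succ_r; destruct (S (n + j)%nat) as [S1 [S2 _]].
    pose proof (norm_minus_triangle (x (n + j)%nat) (x (Datatypes.S (n + j))) (x n)); lra. }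
  assert (Rn : forall n, r n <= exp (- ln 2 * INR n)).
  { induction n; [unfold r; simpl; rewrite Rmult_0_r exp_0; lra |].
    destruct (S n) as [_ [S2 _]]; rewrite S_INR Rmult_plus_distr_l exp_plus Rmult_1_r.
    rewrite exp_Ropp exp_ln; lra. }
  destruct (cauchy_of_exp x (ln 2) 1) as [l Hl].
  { rewrite -ln_1; apply ln_increasing; lra. }
  { intros n m nm; replace m with (n + (m - n))%nat by lia.
    rewrite norm_minus_sym; eapply Rle_trans; [apply Nest |].
    pose proof (Pr (n + (m - n))%nat); specialize (Rn n); lra. }
  assert (Il : forall n, norm (minus l (x n)) <= r n).
  { intro n; apply Rle_plus_epsilon; intros e Pe; destruct (Hl e Pe) as [M HM].
    specialize (HM (n + M)%nat ltac:(lia)).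
    pose proof (norm_minus_triangle (x (n + M)%nat) l (x n)) as T.
    rewrite (norm_minus_sym l (x (n + M)%nat)) in T.
    specialize (Nest n M); pose proof (Pr (n + M)%nat); lra. }
  destruct (at_right_0_elim _ (E_right_0 l 1 Rlt_0_1)) as [d [Pd Hd]].
  (* For this [n] the time [t <= / (INR n + 1)] is below [d], where [E t l] stays within 1 of [l],
     although its norm is at least [INR n > norm l + 1]. *)
  destruct (INR_unbounded (/ d + norm l + 1)) as [n Hn].
  destruct (S n) as [_ [_ [t [Ht HB]]]].
  assert (Pid : 0 < / d) by (apply Rinv_0_lt_compat; auto).
  pose proof (norm_pos l).
  assert (Lt : / (INR n + 1) < d).
  { rewrite -(Rinv_inv d); apply Rinv_lt_contravar; [apply Rmult_lt_0_compat |]; lra. }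
  specialize (HB l (Il _)); specialize (Hd t ltac:(lra)).
  pose proof (norm_le_minus (E t l) l); lra.
Qed.

Lemma E_bounded T : 0 <= T ->
  exists K, 1 <= K /\ forall t x, 0 <= t <= T -> norm (E t x) <= K * norm x.
Proof.
  intro PT; destruct E_bounded_near_0 as [K [d [PK [Pd HK]]]].
  assert (B : forall n t x, 0 <= t <= INR n * d -> norm (E t x) <= K ^ n * norm x).
  { induction n; intros t x Ht.
    - simpl in *; replace t with 0 by lra; rewrite E_0; lra.
    - rewrite S_INR in Ht; pose proof (norm_pos x).
      assert (1 <= K ^ n) by (apply pow_R1_Rle; auto).
      destruct (Rle_lt_dec t d) as [L | L].
      + eapply Rle_trans; [apply HK; lra |]; simpl; apply Rmult_le_compat_r; nra.
      + replace t with (d + (t - d)) by ring; rewrite E_plus; try lra.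
        eapply Rle_trans; [apply HK; lra |].
        simpl; rewrite Rmult_assoc; apply Rmult_le_compat_l; [lra | apply IHn; lra]. }
  destruct (INR_unbounded (T / d)) as [n Hn]; exists (K ^ n); split; [apply pow_R1_Rle; auto |].
  intros t x Ht; apply B; split; [lra |].
  apply Rle_trans with (T / d * d); [| apply Rmult_le_compat_r; lra].
  replace (T / d * d) with T by (field; lra); lra.
Qed.

(** The definition gives continuity only from the right at 0. Continuity from the left at [t] uses
    [E t x - E s x = E s (E (t - s) x - x)] and a bound on [E s] uniform in [s]. *)
Lemma E_vcont x : vcont (fun t => E t x).
Proof.
  intros t Ht e Pe; destruct (E_bounded (t + 1)) as [K [PK HK]]; [lra |].
  assert (PeK : 0 < e / K) by (apply Rdiv_lt_0_compat; lra).
  destruct (at_right_0_elim _ (E_right_0 x (e / K) PeK)) as [d [Pd Hd]].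
  exists (Rmin d 1); split; [apply Rmin_pos; lra |]; intros s Ps Hs.
  pose proof (Rmin_l d 1); pose proof (Rmin_r d 1).
  assert (W : forall a b, 0 <= a -> a < b -> b - a < Rmin d 1 -> a <= t + 1 ->
    norm (minus (E b x) (E a x)) < e).
  { intros a b Pa ab ba at1; replace b with (a + (b - a)) by ring.
    rewrite E_plus; try lra; rewrite -E_minus //.
    eapply Rle_lt_trans; [apply HK; lra |].
    replace e with (K * (e / K)) by (field; lra).
    apply Rmult_lt_compat_l; [lra |]; apply Hd; lra. }
  destruct (Rtotal_order s t) as [L | [-> | L]].
  - rewrite norm_minus_sym; apply W; auto; [| lra].
    rewrite Rabs_left in Hs; lra.
  - rewrite minus_self norm_0; auto.
  - apply W; auto; [| lra]. rewrite Rabs_right in Hs; lra.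
Qed.

(** * Generator and energy estimates *)

Context {D : H -> Prop} {G : H -> H}.
Context (gen : forall x y,
    filterlim (fun t : R => scal (/ t) (minus (E t x) x)) (at_right 0) (locally y)
    <-> D x /\ y = opp (G x)).

Lemma gen_small_o x y :
  small_o (fun r => minus (minus (E r x) x) (scal r y)) <-> D x /\ y = opp (G x).
Proof.
  rewrite -gen at_right_norm.
  assert (Q : forall r, 0 < r -> norm (minus (minus (E r x) x) (scal r y)) =
    r * norm (minus (scal (/ r) (minus (E r x) x)) y)).
  { intros r Pr; rewrite -norm_scal_pos; [| lra]; f_equal; vec. }
  split; intros Hs e Pe.
  - assert (Pe2 : 0 < e / 2) by lra.
    generalize (filter_and _ _ (at_right_0_lt 1 Rlt_0_1) (Hs _ Pe2)).
    apply filter_imp; intros r [Hr L]; rewrite Q in L; [| lra].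
    assert (0 < r * e) by (apply Rmult_lt_0_compat; lra).
    apply (Rmult_lt_reg_l r); [lra |]; eapply Rle_lt_trans; [exact L | lra].
  - generalize (filter_and _ _ (at_right_0_lt 1 Rlt_0_1) (Hs _ Pe)).
    apply filter_imp; intros r [Hr L]; rewrite Q; [| lra].
    rewrite Rmult_comm; eapply Rle_trans; [apply Rmult_le_compat_r; [lra | left; exact L] | lra].
Qed.

Lemma gen_D x : D x -> small_o (fun r => minus (minus (E r x) x) (scal r (opp (G x)))).
Proof. intro Dx; apply gen_small_o; auto. Qed.

(** The bounded operator [E t] commutes with [E r], so it carries the difference quotients of [x] to
    those of [E t x]; the generator's domain is exactly where these converge. *)
Lemma E_D t x : 0 <= t -> D x -> D (E t x) /\ E t (opp (G x)) = opp (G (E t x)).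
Proof.
  intros Pt Dx; apply gen_small_o.
  destruct (linear_bounded _ (E_linear t Pt)) as [K [PK HK]].
  apply (small_o_dominated (fun r => minus (minus (E r x) x) (scal r (opp (G x)))) _ K);
    [lra | | apply gen_D; auto].
  intros r Pr; rewrite -E_plus; try lra; rewrite Rplus_comm E_plus; try lra.
  rewrite -E_minus // -E_scal // -E_minus //.
Qed.

Lemma E_right_diff t x : 0 <= t -> D x -> right_diff (fun s => E s x) t (opp (G (E t x))).
Proof.
  intros Pt Dx; destruct (E_D t x Pt Dx) as [DE _].
  apply (small_o_ext (fun r => minus (minus (E r (E t x)) (E t x)) (scal r (opp (G (E t x))))));
    [| apply gen_D; auto].
  intros r Pr; rewrite -E_plus; try lra; rewrite (Rplus_comm r t); auto.
Qed.

(** Gronwall for the squared norm. The curve is arbitrary because [E_P] applies this to a difference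
    that is not an orbit a priori. *)
Lemma energy_decay a (y : R -> H) : vcont y ->
  (forall t, 0 <= t -> right_diff y t (opp (G (y t))) /\
     a * norm (y t) ^ 2 <= inner (G (y t)) (y t)) ->
  forall t, 0 <= t -> norm (y t) <= exp (- a * t) * norm (y 0).
Proof.
  intros Cy Dy t Pt.
  assert (S : norm (y t) ^ 2 <= exp (- 2 * a * t) * norm (y 0) ^ 2).
  { apply (dini_gronwall (fun s => norm (y s) ^ 2)); auto.
    - apply rcont_sq, vcont_norm; auto.
    - intros s Hs; destruct (Dy s ltac:(lra)) as [Ds Fs].
      eapply dini_le_weaken; [| apply right_diff_sq; exact Ds].
      rewrite inner_opp_r inner_sym; lra. }
  replace (- 2 * a * t) with (- a * t + - a * t) in S by ring; rewrite exp_plus in S.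
  pose proof (exp_pos (- a * t)); pose proof (norm_pos (y 0)); pose proof (norm_pos (y t)).
  assert (0 <= exp (- a * t) * norm (y 0)) by nra.
  nra.
Qed.

Context (dense : forall u d, 0 < d -> exists v, D v /\ norm (minus u v) < d).
Context (G_nonneg : forall x, D x -> 0 <= inner (G x) x).

(** A sharp bound on the domain extends by density, the crude bound [K] controlling the error of
    approximation; [V] is the whole space or the kernel of [P]. *)
Lemma bound_of_dense (V : H -> Prop) (S : H -> H) K c :
  (forall x y, S (minus x y) = minus (S x) (S y)) ->
  (forall x, norm (S x) <= K * norm x) -> 0 <= c ->
  (forall u d, 0 < d -> V u -> exists v, V v /\ D v /\ norm (minus u v) < d) ->
  (forall x, V x -> D x -> norm (S x) <= c * norm x) ->
  forall x, V x -> norm (S x) <= c * norm x.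
Proof.
  intros Sm SK Pc dV HD x Vx; apply Rle_plus_epsilon; intros e Pe.
  set (B := Rabs K + c + 1). assert (PB : 0 < B) by (unfold B; pose proof (Rabs_pos K); lra).
  destruct (dV x (e / B)) as [v [Vv [Dv Hv]]]; auto; [apply Rdiv_lt_0_compat; auto |].
  pose proof (norm_le_minus (S x) (S v)) as L1; rewrite -Sm in L1.
  pose proof (SK (minus x v)) as L2; specialize (HD v Vv Dv).
  pose proof (norm_le_minus v x) as L3; rewrite (norm_minus_sym v) in L3.
  pose proof (Rle_abs K); pose proof (norm_pos (minus x v)).
  assert (norm (S x) <= c * norm x + B * norm (minus x v)) by (unfold B; nra).
  assert (B * norm (minus x v) <= e); [| lra].
  replace e with (B * (e / B)) by (field; lra).
  apply Rmult_le_compat_l; lra.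
Qed.

Lemma E_contraction t x : 0 <= t -> norm (E t x) <= norm x.
Proof.
  intro Pt; destruct (E_bounded t Pt) as [K [PK HK]].
  rewrite -(Rmult_1_l (norm x)).
  apply (bound_of_dense (fun _ => True) (E t) K 1); auto; try lra.
  - intros; apply E_minus; auto.
  - intros; apply HK; lra.
  - intros u d Pd _; destruct (dense u d Pd) as [v Hv]; exists v; tauto.
  - intros y _ Dy; rewrite -{2}(E_0 y).
    replace 1 with (exp (- 0 * t)) by (rewrite Ropp_0 Rmult_0_l exp_0; auto).
    apply (energy_decay 0 (fun s => E s y)); auto; [apply E_vcont |].
    intros s Ps; split; [apply E_right_diff; auto |].
    rewrite Rmult_0_l; apply G_nonneg, E_D; auto.
Qed.

(** * The semigroup on the range and the kernel of [P] *)

Context {P : H -> H} (OP : orthoprojector P).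
Context (DP : forall x, D x -> D (P x)) (GP : forall x, D x -> P (G x) = G (P x)).
Context (DM : forall x y, D x -> D y -> D (minus x y))
  (GM : forall x y, D x -> D y -> G (minus x y) = minus (G x) (G y)).

Lemma right_diff_P y t l : right_diff y t l -> right_diff (fun s => P (y s)) t (P l).
Proof.
  intro Hy; eapply (small_o_dominated _ _ 1); [lra | | exact Hy].
  intros r Pr; rewrite -(P_scal _ OP) -!(P_minus _ OP) Rmult_1_l; apply P_le; auto.
Qed.

Lemma P_lip x x' : norm (minus (P x) (P x')) <= 1 * norm (minus x x').
Proof. rewrite -(P_minus _ OP) Rmult_1_l; apply P_le; auto. Qed.

(** For [x] in the domain, [P (E s x) - E s (P x)] starts at zero and solves the linear equation,
    hence vanishes by its energy estimate. *)
Lemma E_P t x : 0 <= t -> P (E t x) = E t (P x).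
Proof.
  intro Pt; apply minus_eq, norm_zero_eq, Rle_antisym; [| apply norm_pos].
  rewrite -(Rmult_0_l (norm x)).
  apply (bound_of_dense (fun _ => True) (fun x => minus (P (E t x)) (E t (P x))) 2 0); auto; try lra.
  - intros u v; rewrite (E_minus t) // (P_minus _ OP) (P_minus _ OP u) (E_minus t) //; vec.
  - intro u; eapply Rle_trans; [apply norm_minus_le |].
    pose proof (P_le _ OP (E t u)); pose proof (E_contraction t u Pt).
    pose proof (P_le _ OP u); pose proof (E_contraction t (P u) Pt); lra.
  - intros u d Pd _; destruct (dense u d Pd) as [v Hv]; exists v; tauto.
  - intros y _ Dy; rewrite Rmult_0_l.
    set (w := fun s => minus (P (E s y)) (E s (P y))).
    assert (W0 : w 0 = zero) by (unfold w; rewrite !E_0; vec).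
    pose proof (energy_decay 0 w) as ED; rewrite W0 norm_0 in ED.
      assert (B : norm (w t) <= exp (- 0 * t) * 0); [| rewrite Rmult_0_r in B; exact B].
    apply ED; auto.
    + apply vcont_minus; [| apply E_vcont].
      apply (vcont_lip P 1); [apply P_lip | apply E_vcont].
    + intros s Ps; destruct (E_D s y Ps Dy) as [D1 _].
      destruct (E_D s (P y) Ps (DP y Dy)) as [D2 _]; split.
      * unfold w at 2; rewrite GM //; [| apply DP; auto].
        vreplace (opp (minus (G (P (E s y))) (G (E s (P y)))))
          with (minus (opp (G (P (E s y)))) (opp (G (E s (P y))))).
        apply right_diff_minus; [| apply E_right_diff; auto].
        rewrite -GP //.
        vreplace (opp (P (G (E s y)))) with (scal (-1) (P (G (E s y)))).
        rewrite -(P_scal _ OP).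
        vreplace (scal (-1) (G (E s y))) with (opp (G (E s y))).
        apply right_diff_P, E_right_diff; auto.
      * rewrite Rmult_0_l; apply G_nonneg, DM; auto.
Qed.

Lemma E_decay a : (forall q, D q -> P q = zero -> a * norm q ^ 2 <= inner (G q) q) ->
  (forall q d, 0 < d -> P q = zero -> exists x, D x /\ P x = zero /\ norm (minus q x) < d) ->
  forall t q, 0 <= t -> P q = zero -> norm (E t q) <= exp (- a * t) * norm q.
Proof.
  intros Ga dQ t q Pt Pq.
  apply (bound_of_dense (fun q => P q = zero) (E t) 1); auto.
  - intros; apply E_minus; auto.
  - intros; rewrite Rmult_1_l; apply E_contraction; auto.
  - left; apply exp_pos.
  - intros u d Pd Pu; destruct (dQ u d Pd Pu) as [v Hv]; exists v; tauto.
  - intros y Py Dy; rewrite -{2}(E_0 y).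
    apply (energy_decay a (fun s => E s y)); auto; [apply E_vcont |].
    intros s Ps; split; [apply E_right_diff; auto |].
    apply Ga; [apply E_D; auto |].
    rewrite E_P // Py; vreplace (zero : H) with (scal 0 (zero : H)); rewrite E_scal //; vec.
Qed.

(** * Mild solutions *)

Context {F : H -> H} {L : R} (L_pos : 0 < L)
  (F_lip : forall u w, norm (minus (F u) (F w)) <= L * norm (minus u w)).

(* All later estimates use this first-order expansion of a mild solution instead
   of the variation-of-constants integral. *)
Definition trajectory (v : R -> H) : Prop :=
  vcont v /\ forall t, 0 <= t ->
    small_o (fun r => minus (v (t + r)) (plus (E r (v t)) (scal r (F (v t))))).

Lemma vcont_halfline (v : R -> H) : continuous_on_halfline v -> vcont v.
Proof.
  intros Cv t Ht e Pe; specialize (Cv t Ht).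
  rewrite (filterlim_locally_ball_norm (K := R_AbsRing) (U := H)) in Cv.
  destruct (Cv (mkposreal e Pe)) as [d Hd]; exists d; split; [apply cond_pos |].
  intros s Ps Hs; apply (Hd s); auto.
Qed.

(** Split the integral up to [t + r] at [t]. The first piece is [E r] applied to the integral up to
    [t] and combines with the initial term into [E r (v t)]; on the second piece the integrand is
    close to [F (v t)]. *)
Lemma mild_trajectory u0 v : is_mild_solution E F u0 v -> trajectory v.
Proof.
  intros [Cv Mv]; apply vcont_halfline in Cv; split; auto; intros t Pt eta Pe.
  set (FF := F (v t)).
  assert (P1 : 0 < eta / (2 * L)) by (apply Rdiv_lt_0_compat; lra).
  destruct (Cv t Pt _ P1) as [d [Pd Hd]].
  assert (P2 : 0 < eta / 2) by lra.
  destruct (at_right_0_elim _ (E_right_0 FF _ P2)) as [d' [Pd' Hd']].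
  apply (at_right_0_intro _ (Rmin d d')); [apply Rmin_pos; auto |]; intros r Hr.
  pose proof (Rmin_l d d'); pose proof (Rmin_r d d').
  destruct (Mv t Pt) as [Ext Et]; destruct (Mv (t + r) ltac:(lra)) as [Exr Er].
  set (f := fun s => E (t + r - s) (F (v s))) in *.
  assert (X1 : ex_RInt f 0 t) by (apply (ex_RInt_Chasles_1 f 0 t (t + r)); auto; lra).
  assert (X2 : ex_RInt f t (t + r)) by (apply (ex_RInt_Chasles_2 f 0 t (t + r)); auto; lra).
  assert (J1 : RInt f 0 t = E r (RInt (fun s => E (t - s) (F (v s))) 0 t)).
  { apply is_RInt_unique.
    apply (is_RInt_ext (fun s => E r (E (t - s) (F (v s))))).
    - rewrite Rmin_left // Rmax_right //; intros s Hs; unfold f.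
      rewrite -E_plus; try lra; f_equal; ring.
    - apply is_RInt_linear; [apply E_linear; lra | apply RInt_correct; auto]. }
  assert (Z : minus (v (t + r)) (plus (E r (v t)) (scal r FF)) =
    minus (RInt f t (t + r)) (scal (t + r - t) FF)).
  { rewrite Er -(RInt_Chasles f 0 t (t + r)) // J1 Et.
    rewrite (linear_plus _ (E_linear r ltac:(lra))) (Rplus_comm t r) E_plus; try lra.
    replace (r + t - t) with r by ring; vec. }
  rewrite Z.
  assert (IR : is_RInt (fun s => minus (f s) FF) t (t + r)
    (minus (RInt f t (t + r)) (scal (t + r - t) FF))).
  { apply (is_RInt_minus (V := H)); [apply RInt_correct; auto | apply (is_RInt_const (V := H))]. }
  replace (eta * r) with ((t + r - t) * eta) by ring.
  eapply (norm_RInt_le_const (V := H)); [lra | | exact IR].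
  intros s Hs; change (norm (minus (f s) FF) <= eta); unfold f.
  eapply Rle_trans; [apply (norm_minus_triangle (E (t + r - s) FF)) |].
  rewrite -E_minus; [| lra].
  assert (B1 : norm (E (t + r - s) (minus (F (v s)) FF)) <= eta / 2).
  { eapply Rle_trans; [apply E_contraction; lra |].
    eapply Rle_trans; [apply F_lip |].
    replace (eta / 2) with (L * (eta / (2 * L))) by (field; lra).
    apply Rmult_le_compat_l; [lra |]; left; apply Hd; [lra |].
    rewrite Rabs_pos_eq; lra. }
  assert (B2 : norm (minus (E (t + r - s) FF) FF) <= eta / 2); [| lra].
  (* The right limit at 0 says nothing about time 0 itself, so the endpoint is treated apart. *)
  destruct (Req_dec s (t + r)) as [-> | Ns].
  - rewrite Rminus_diag E_0 minus_self norm_0; lra.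
  - left; apply Hd'; lra.
Qed.

End Semigroup.

(** * Cone condition and squeezing *)

Section Dynamics.

Context {H : HilbertSpace} {P : H -> H} (OP : orthoprojector P).
Context {E : R -> H -> H} (E_lin : forall t, 0 <= t -> is_linear (E t))
  (E_le : forall t x, 0 <= t -> norm (E t x) <= norm x)
  (EP : forall t x, 0 <= t -> P (E t x) = E t (P x)).
Context {alpha beta Lam : R}
  (E_dec : forall t q, 0 <= t -> P q = zero -> norm (E t q) <= exp (- alpha * t) * norm q).
Context {A : H -> H}
  (E_low : forall p, P p = p -> small_o (fun r => minus (minus (E r p) p) (scal r (opp (A p)))))
  (A_form : forall p, P p = p -> inner (A p) p <= beta * norm p ^ 2)
  (A_le : forall p, P p = p -> norm (A p) <= Lam * norm p).

Let Q := complement_of P.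

(** The expansion in [trajectory] with a free forcing value [g]: unlike being a trajectory, it
    passes to differences. *)
Definition euler (y : R -> H) t g : Prop :=
  small_o (fun r => minus (y (t + r)) (plus (E r (y t)) (scal r g))).

Lemma euler_minus y y' t g g' : euler y t g -> euler y' t g' ->
  euler (fun s => minus (y s) (y' s)) t (minus g g').
Proof.
  intros A1 A2.
  assert (A3 : small_o (fun r => opp (minus (y' (t + r)) (plus (E r (y' t)) (scal r g'))))).
  { apply (small_o_dominated _ _ 1 Rle_0_1 (fun r _ => Req_le _ _ (eq_trans (norm_opp_eq _) (eq_sym (Rmult_1_l _)))) A2). }
  eapply small_o_ext; [| apply (small_o_plus _ _ A1 A3)].
  intros r Pr; simpl; rewrite (linear_minus _ _ _ (E_lin r ltac:(lra))); vec.
Qed.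

Lemma euler_norm y t g : euler y t g -> dini_le (fun s => norm (y s)) t (norm g).
Proof.
  intros Hy eta Pe; generalize (filter_and _ _ (at_right_0_lt 1 Rlt_0_1) (Hy eta Pe)).
  apply filter_imp; intros r [Hr B].
  pose proof (norm_le_minus (y (t + r)) (plus (E r (y t)) (scal r g))) as T1.
  pose proof (norm_plus_le (E r (y t)) (scal r g)) as T2.
  rewrite norm_scal_pos in T2; [| lra].
  pose proof (E_le r (y t) ltac:(lra)); lra.
Qed.

(** On the kernel of [P] the factor [exp (- alpha r) = 1 - alpha r + o(r)] from the decay of [E]
    supplies the damping; no derivative of the [Q] component is taken. *)
Lemma euler_Q y t g : euler y t g ->
  dini_le (fun s => norm (Q (y s))) t (- alpha * norm (Q (y t)) + norm g).
Proof.
  intros Hy eta Pe; set (a := norm (Q (y t))).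
  assert (Pa : 0 <= a) by apply norm_pos.
  assert (P1 : 0 < eta / 2) by lra.
  assert (P2 : 0 < eta / (2 * (a + 1))) by (apply Rdiv_lt_0_compat; lra).
  assert (De : is_derive (fun r => exp (- alpha * r)) 0 (- alpha)).
  { auto_derive; trivial; rewrite Rmult_0_r exp_0; ring. }
  generalize (filter_and _ _ (at_right_0_lt 1 Rlt_0_1)
    (filter_and _ _ (Hy _ P1) (derive_right _ _ _ De _ P2))).
  apply filter_imp; intros r [Hr [B1 B2]].
  rewrite Rplus_0_l Rmult_0_r exp_0 in B2.
  set (o := minus (y (t + r)) (plus (E r (y t)) (scal r g))) in *.
  assert (EQ : Q (y (t + r)) = plus (plus (E r (Q (y t))) (scal r (Q g))) (Q o)).
  { unfold Q, complement_of, o; rewrite (P_minus _ OP) (P_plus _ OP) (P_scal _ OP) EP; [| lra].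
    rewrite (linear_minus _ _ _ (E_lin r ltac:(lra))); vec. }
  rewrite EQ; eapply Rle_trans; [apply norm_plus_le |].
  pose proof (norm_plus_le (E r (Q (y t))) (scal r (Q g))) as T.
  rewrite norm_scal_pos in T; [| lra].
  pose proof (Q_le _ OP g) as T2; pose proof (Q_le _ OP o) as T3; fold Q in T2, T3.
  pose proof (E_dec r (Q (y t)) ltac:(lra) (PQ _ OP _)) as T4; fold a in T4.
  assert (T5 : exp (- alpha * r) * a <= (1 - alpha * r) * a + eta / 2 * r).
  { assert (exp (- alpha * r) <= 1 - alpha * r + eta / (2 * (a + 1)) * r).
    { pose proof (Rle_abs (exp (- alpha * r) - 1 - r * - alpha)); lra. }
    apply Rle_trans with ((1 - alpha * r + eta / (2 * (a + 1)) * r) * a).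
    - apply Rmult_le_compat_r; auto.
    - assert (eta / (2 * (a + 1)) * r * a <= eta / 2 * r); [| lra].
      apply Rle_trans with (eta / (2 * (a + 1)) * r * (a + 1)).
      + apply Rmult_le_compat_l; [left; apply Rmult_lt_0_compat; lra | lra].
      + right; field; lra. }
  assert (r * norm (Q g) <= r * norm g) by (apply Rmult_le_compat_l; lra).
  lra.
Qed.

Lemma euler_P y t g : euler y t g ->
  right_diff (fun s => P (y s)) t (minus (P g) (A (P (y t)))).
Proof.
  intro Hy.
  assert (S1 : small_o (fun r => P (minus (y (t + r)) (plus (E r (y t)) (scal r g))))).
  { eapply (small_o_dominated _ _ 1); [lra | | exact Hy].
    intros r Pr; rewrite Rmult_1_l; apply P_le; auto. }
  eapply small_o_ext; [| apply (small_o_plus _ _ S1 (E_low _ (P_idem _ OP (y t))))].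
  intros r Pr; simpl; rewrite (P_minus _ OP) (P_plus _ OP) (P_scal _ OP) EP; [| lra]; vec.
Qed.

(** Pairing [p - r A p] with [p] and using the form bound gives [norm (p - r A p) >= (1 - r beta) *
    norm p]. The sign is reversed so that a lower growth bound becomes a Dini bound from above. *)
Lemma euler_P_lower y t g : euler y t g ->
  dini_le (fun s => - norm (P (y s))) t (beta * norm (P (y t)) + norm g).
Proof.
  intros Hy eta Pe; generalize (filter_and _ _ (at_right_0_lt 1 Rlt_0_1) (euler_P y t g Hy eta Pe)).
  apply filter_imp; intros r [Hr B].
  set (p := P (y t)) in *; set (p' := P (y (t + r))) in *.
  assert (Pp : P p = p) by apply (P_idem _ OP).
  assert (N1 : (1 - r * beta) * norm p <= norm (minus p (scal r (A p)))).
  { destruct (Rle_lt_or_eq_dec _ _ (norm_pos p)) as [Np | Z]; [| rewrite -Z Rmult_0_r; apply norm_pos].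
    pose proof (inner_le (minus p (scal r (A p))) p) as I.
    pose proof (A_form p Pp) as F.
    assert (I2 : inner (minus p (scal r (A p))) p = norm p ^ 2 - r * inner (A p) p)
      by (clearbody p; inner_expand; rewrite inner_norm; ring).
    rewrite I2 in I; apply (Rmult_le_reg_r (norm p)); auto.
    assert (r * inner (A p) p <= r * (beta * norm p ^ 2)) by (apply Rmult_le_compat_l; lra).
    lra. }
  pose proof (norm_le_minus (minus p (scal r (A p))) p') as T1.
  assert (T2 : norm (minus (minus p (scal r (A p))) p') <= r * norm g + eta * r).
  { vreplace (minus (minus p (scal r (A p))) p') with
      (minus (opp (scal r (P g))) (minus (minus p' p) (scal r (minus (P g) (A p))))).
    eapply Rle_trans; [apply norm_minus_le |]; apply Rplus_le_compat; [| exact B].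
    rewrite norm_opp_eq norm_scal_pos; [| lra].
    apply Rmult_le_compat_l; [lra | apply P_le; auto]. }
  lra.
Qed.

Context {F : H -> H} {L M : R} (L_pos : 0 < L) (M_pos : 0 < M)
  (F_le : forall u, norm (F u) <= M)
  (F_lip : forall u w, norm (minus (F u) (F w)) <= L * norm (minus u w)).
Context (beta_nonneg : 0 <= beta) (Lam_pos : 0 < Lam) (gap : 8 * L <= alpha - beta).

Notation traj := (trajectory (E := E) (F := F)).

Lemma trajectory_shift v t0 : 0 <= t0 -> traj v -> traj (fun t => v (t0 + t)).
Proof.
  intros P0 [Cv Tv]; split; [apply vcont_shift; auto |].
  intros t Pt; eapply small_o_ext; [| apply (Tv (t0 + t)); lra].
  intros r Pr; simpl; rewrite Rplus_assoc; auto.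
Qed.

Definition pdist (v w : R -> H) t := norm (P (minus (v t) (w t))).
Definition qdist (v w : R -> H) t := norm (Q (minus (v t) (w t))).

Lemma pdist_ge_0 v w t : 0 <= pdist v w t.
Proof. apply norm_pos. Qed.

Lemma dist_le v w t : norm (minus (v t) (w t)) <= qdist v w t + pdist v w t.
Proof. rewrite Rplus_comm; apply norm_PQ_le. Qed.

Lemma rcont_lin f k g : rcont f -> rcont g -> rcont (fun t => f t - k * g t).
Proof.
  intros Cf Cg; pose proof (rcont_plus _ _ Cf (rcont_scal (- k) _ Cg)) as R.
  intros s Ps e Pe; destruct (R s Ps e Pe) as [d [Pd Hd]]; exists d; split; auto.
  intros s' Ps' Hs'; specialize (Hd s' Ps' Hs').
  replace (f s' - k * g s' - (f s - k * g s)) with (f s' + - k * g s' - (f s + - k * g s)) by ring.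
  auto.
Qed.

(** * Cones for the difference of two trajectories *)

Section TwoTrajectories.

Context (v w : R -> H) (Tv : traj v) (Tw : traj w).

Lemma vcont_diff : vcont (fun t => minus (v t) (w t)).
Proof. apply vcont_minus; [apply Tv | apply Tw]. Qed.

Lemma rcont_pdist : rcont (pdist v w).
Proof. apply vcont_norm, (vcont_lip P 1); [apply P_lip; auto | apply vcont_diff]. Qed.

Lemma rcont_qdist : rcont (qdist v w).
Proof.
  apply vcont_norm, (vcont_lip Q 1); [intros; unfold Q | apply vcont_diff].
  rewrite -(Q_minus _ OP) Rmult_1_l; apply Q_le; auto.
Qed.

Lemma euler_diff t : 0 <= t ->
  euler (fun s => minus (v s) (w s)) t (minus (F (v t)) (F (w t))).
Proof. intro; apply euler_minus; [apply Tv | apply Tw]; auto. Qed.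

Lemma trajectory_lip t : 0 <= t ->
  norm (minus (v t) (w t)) <= exp (L * t) * norm (minus (v 0) (w 0)).
Proof.
  intro Pt; apply (dini_gronwall (fun s => norm (minus (v s) (w s)))); auto.
  - apply vcont_norm, vcont_diff.
  - intros s Hs; eapply dini_le_weaken; [apply F_lip |].
    apply euler_norm, euler_diff; lra.
Qed.

Lemma forcing_le t : norm (minus (F (v t)) (F (w t))) <= L * (qdist v w t + pdist v w t).
Proof.
  eapply Rle_trans; [apply F_lip |]; apply Rmult_le_compat_l; [lra | apply dist_le].
Qed.

Lemma dini_qdist t : 0 <= t ->
  dini_le (qdist v w) t (- alpha * qdist v w t + L * (qdist v w t + pdist v w t)).
Proof.
  intro Pt; eapply dini_le_weaken; [| apply euler_Q, (euler_diff t Pt)].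
  apply Rplus_le_compat_l, forcing_le.
Qed.

Lemma dini_pdist t : 0 <= t ->
  dini_le (fun s => - pdist v w s) t
    (beta * pdist v w t + L * (qdist v w t + pdist v w t)).
Proof.
  intro Pt; eapply dini_le_weaken; [| apply euler_P_lower, (euler_diff t Pt)].
  apply Rplus_le_compat_l, forcing_le.
Qed.

Lemma cone_gronwall k t : 0 <= k -> (1 + k) ^ 2 * L <= (alpha - beta) * k -> 0 <= t ->
  qdist v w t - k * pdist v w t <=
  exp ((- alpha + (1 + k) * L) * t) * (qdist v w 0 - k * pdist v w 0).
Proof.
  intros Pk Hk Pt; apply (dini_gronwall (fun s => qdist v w s - k * pdist v w s)); auto.
  - apply rcont_lin; [apply rcont_qdist | apply rcont_pdist].
  - intros s Hs.
    pose proof (dini_le_plus _ _ _ _ _ (dini_qdist s ltac:(lra))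
      (dini_le_scal k _ _ _ Pk (dini_pdist s ltac:(lra)))) as Dd.
    intros e Pe; generalize (filter_and _ _ (at_right_0_lt 1 Rlt_0_1) (Dd e Pe)).
    apply filter_imp; intros r [Hr B].
    pose proof (pdist_ge_0 v w s) as Pb.
    (* After the multiple of [q - k p] is split off, the remaining coefficient of [p] is
       [(1 + k) ^ 2 * L - (alpha - beta) * k]. *)
    assert (G : (1 + k) ^ 2 * L * pdist v w s <= (alpha - beta) * k * pdist v w s)
      by (apply Rmult_le_compat_r; auto).
    assert (G2 : 0 <= r * ((alpha - beta) * k * pdist v w s - (1 + k) ^ 2 * L * pdist v w s))
      by (apply Rmult_le_pos; lra).
    nra.
Qed.

Lemma cone_invariant k t : 0 <= k -> (1 + k) ^ 2 * L <= (alpha - beta) * k -> 0 <= t ->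
  qdist v w 0 <= k * pdist v w 0 -> qdist v w t <= k * pdist v w t.
Proof.
  intros Pk Hk Pt H0; pose proof (cone_gronwall k t Pk Hk Pt).
  pose proof (exp_pos ((- alpha + (1 + k) * L) * t)); nra.
Qed.

Lemma cone_lower t : 0 <= t -> qdist v w 0 <= pdist v w 0 ->
  exp (- (beta + 2 * L) * t) * pdist v w 0 <= pdist v w t.
Proof.
  intros Pt H0.
  assert (G : - pdist v w t <= exp (- (beta + 2 * L) * t) * - pdist v w 0); [| lra].
  apply (dini_gronwall (fun s => - pdist v w s)); auto.
  - intros s Ps e Pe; destruct (rcont_pdist s Ps e Pe) as [d [Pd Hd]]; exists d; split; auto.
    intros s' Ps' Hs'; specialize (Hd s' Ps' Hs').
    replace (- pdist v w s' - - pdist v w s) with (- (pdist v w s' - pdist v w s)) by ring.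
    rewrite Rabs_Ropp; auto.
  - intros s Hs; eapply dini_le_weaken; [| apply dini_pdist; lra].
    pose proof (cone_invariant 1 s ltac:(lra) ltac:(nra) ltac:(lra) ltac:(lra)); nra.
Qed.

End TwoTrajectories.

(** Cone invariance read backwards: [q - p] is nonnegative at [T], where [p] vanishes, and
    [cone_gronwall] from [t] to [T] multiplies by a positive factor, so it was nonnegative at [t].
    With [p <= q], the inequality for [q] closes. *)
Lemma squeeze v w T : traj v -> traj w -> 0 <= T -> P (v T) = P (w T) ->
  forall t, 0 <= t <= T ->
    pdist v w t <= qdist v w t /\ qdist v w t <= exp (- (alpha - 2 * L) * t) * qdist v w 0.
Proof.
  intros Tv Tw PT ET.
  assert (C : forall t, 0 <= t <= T -> pdist v w t <= qdist v w t).
  { intros t Ht.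
    pose proof (cone_gronwall _ _ (trajectory_shift v t ltac:(lra) Tv)
      (trajectory_shift w t ltac:(lra) Tw) 1 (T - t) ltac:(lra) ltac:(nra) ltac:(lra)) as G.
    unfold pdist, qdist in G; replace (t + (T - t)) with T in G by ring.
    rewrite Rplus_0_r (P_minus _ OP (v T)) ET minus_self norm_0 in G.
    pose proof (norm_pos (Q (minus (v T) (w T)))).
    pose proof (exp_pos ((- alpha + (1 + 1) * L) * (T - t))).
    unfold pdist, qdist; nra. }
  intros t Ht; split; [apply C; auto |].
  apply (dini_gronwall (qdist v w)); [lra | apply rcont_qdist; auto |].
  intros s Hs; eapply dini_le_weaken; [| apply dini_qdist; auto; lra].
  pose proof (C s ltac:(lra)); nra.
Qed.

Lemma squeeze_final v w T : traj v -> traj w -> 0 <= T -> P (v T) = P (w T) ->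
  norm (minus (v T) (w T)) <= exp (- (alpha - 2 * L) * T) * qdist v w 0.
Proof.
  intros Tv Tw PT ET; destruct (squeeze v w T Tv Tw PT ET T) as [_ B]; [lra |].
  eapply Rle_trans; [| exact B]; eapply Rle_trans; [apply dist_le |].
  unfold pdist; rewrite (P_minus _ OP) ET minus_self norm_0; lra.
Qed.

(** The norm of the [Q] component has derivative at most [- alpha] times itself plus [M], and
    [M <= alpha * R]. *)
Lemma Q_absorbing v R : traj v -> M / alpha <= R -> norm (Q (v 0)) <= R ->
  forall t, 0 <= t -> norm (Q (v t)) <= R.
Proof.
  intros Tv HR H0 t Pt.
  assert (Pal : 0 < alpha) by lra.
  assert (HM : M <= alpha * R).
  { apply (Rmult_le_compat_l alpha) in HR; [| lra].
    replace (alpha * (M / alpha)) with M in HR by (field; lra); auto. }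
  assert (G : norm (Q (v t)) - R * 1 <= exp (- alpha * t) * (norm (Q (v 0)) - R * 1)).
  { apply (dini_gronwall (fun s => norm (Q (v s)) - R * 1)); auto.
    - apply (rcont_lin (fun s => norm (Q (v s))) R (fun _ => 1)); [| apply rcont_const].
      apply vcont_norm, (vcont_lip Q 1); [intros; unfold Q | apply Tv].
      rewrite -(Q_minus _ OP) Rmult_1_l; apply Q_le; auto.
    - intros s Hs; pose proof (euler_Q v s (F (v s)) (proj2 Tv s ltac:(lra))) as Dq.
      intros e Pe; generalize (filter_and _ _ (at_right_0_lt 1 Rlt_0_1) (Dq e Pe)).
      apply filter_imp; intros r [Hr B]; pose proof (F_le (v s)); nra. }
  pose proof (exp_pos (- alpha * t)); nra.
Qed.

(** * The invariant graph *)

Context {S : R -> H -> H} (S_traj : forall u, traj (fun t => S t u)) (S_0 : forall u, S 0 u = u).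

Lemma S_lip t u u' : 0 <= t -> norm (minus (S t u) (S t u')) <= exp (L * t) * norm (minus u u').
Proof.
  intro Pt; pose proof (trajectory_lip _ _ (S_traj u) (S_traj u') t Pt) as B.
  simpl in B; rewrite !S_0 in B; exact B.
Qed.

(** The hypotheses provide one trajectory per initial value; the semigroup law is uniqueness, that
    is [trajectory_lip] with equal initial values. *)
Lemma S_plus s t u : 0 <= s -> 0 <= t -> S (s + t) u = S t (S s u).
Proof.
  intros Ps Pt; apply minus_eq, norm_zero_eq, Rle_antisym; [| apply norm_pos].
  pose proof (trajectory_lip _ _ (trajectory_shift _ s Ps (S_traj u)) (S_traj (S s u)) t Pt) as B.
  simpl in B; rewrite Rplus_0_r S_0 minus_self norm_0 Rmult_0_r in B; exact B.
Qed.

(** * Images of graphs under the flow *)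

Definition cone k (X : H -> Prop) : Prop := forall u u', X u -> X u' ->
  norm (Q (minus u u')) <= k * norm (P (minus u u')).

(** Together with [cone k X], which makes [P] injective on [X], this says that [X] is a graph over
    the whole of [range P]. *)
Definition full (X : H -> Prop) : Prop := forall p, P p = p -> exists u, X u /\ P u = p.

Definition image t (X : H -> Prop) : H -> Prop := fun u => exists w, X w /\ u = S t w.

Lemma cone_image k t X : 0 <= k -> (1 + k) ^ 2 * L <= (alpha - beta) * k -> 0 <= t ->
  cone k X -> cone k (image t X).
Proof.
  intros Pk Hk Pt CX u u' [w [Xw ->]] [w' [Xw' ->]].
  apply (cone_invariant _ _ (S_traj w) (S_traj w') k t Pk Hk Pt).
  unfold pdist, qdist; rewrite !S_0; apply CX; auto.
Qed.

(** On [range P] the operator [A] is bounded by the cutoff [Lam], so the [P] components have a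
    derivative whose difference is at most [Lam + L] times the distance of the trajectories. *)
Lemma P_increment v w s : traj v -> traj w -> 0 <= s ->
  norm (minus (minus (P (v s)) (P (w s))) (minus (P (v 0)) (P (w 0)))) <=
  (Lam + L) * exp (L * s) * norm (minus (v 0) (w 0)) * s.
Proof.
  intros Tv Tw Ps; set (C := (Lam + L) * exp (L * s) * norm (minus (v 0) (w 0))).
  pose proof (right_diff_mean_value (fun t => P (minus (v t) (w t))) zero
    (fun t => minus (P (minus (F (v t)) (F (w t)))) (A (P (minus (v t) (w t))))) C 0 s) as B.
  simpl in B; rewrite !(P_minus _ OP (v _)) in B.
  vreplace (minus (minus (minus (P (v s)) (P (w s))) (minus (P (v 0)) (P (w 0)))) (scal (s - 0) (zero : H)))
    with (minus (minus (P (v s)) (P (w s))) (minus (P (v 0)) (P (w 0)))) in B.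
  rewrite Rminus_0_r in B; apply B; [lra | |].
  - apply (vcont_lip P 1); [apply P_lip; auto | apply vcont_diff; auto].
  - intros t Ht; split; [apply euler_P, euler_diff; auto; lra |].
    set (z := minus (v t) (w t)).
    vreplace (minus (minus (P (minus (F (v t)) (F (w t)))) (A (P z))) (zero : H))
      with (minus (P (minus (F (v t)) (F (w t)))) (A (P z))).
    eapply Rle_trans; [apply norm_minus_le |].
    pose proof (P_le _ OP (minus (F (v t)) (F (w t)))) as B1.
    pose proof (F_lip (v t) (w t)) as B2; fold z in B2.
    pose proof (A_le (P z) (P_idem _ OP z)) as B3; pose proof (P_le _ OP z) as B4.
    pose proof (trajectory_lip _ _ Tv Tw t ltac:(lra)) as B5; fold z in B5.
    assert (B6 : exp (L * t) <= exp (L * s)).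
    { destruct (Rle_lt_or_eq_dec (L * t) (L * s)) as [Lt | Eq]; [nra | |].
      - left; apply exp_increasing; auto.
      - rewrite Eq; lra. }
    pose proof (norm_pos (minus (v 0) (w 0))) as B7.
    assert (B8 : norm z <= exp (L * s) * norm (minus (v 0) (w 0))) by nra.
    apply Rle_trans with ((Lam + L) * norm z); [nra |].
    unfold C; rewrite Rmult_assoc; apply Rmult_le_compat_l; lra.
Qed.

(** The preimage is a fixed point of [p1 + (p - P (S s (x p)))]. The number 12 is [2 * 3 * 2]:
    distances in the cone are at most twice those of the [P] components, [exp (L * s) <= 3], and the
    contraction factor is to be [1 / 2]. *)
Lemma full_image_small s X : 0 <= s -> s * (12 * (Lam + L)) <= 1 ->
  cone 1 X -> full X -> full (image s X).
Proof.
  intros Ps Hs CX FX p1 Pp1.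
  destruct (choice (fun p u => P p = p -> X u /\ P u = p)) as [x Hx].
  { intro p; destruct (classic (P p = p)) as [Pp | N].
    - destruct (FX p Pp) as [u Hu]; exists u; auto.
    - exists zero; intro; contradiction. }
  destruct (fixed_point (fun p => P p = p) (fun p => plus p1 (minus p (P (S s (x p))))) (1 / 2) p1)
    as [p [Pp Fp]]; auto; [lra | | | |].
  - intros u l Ku Cu; apply (range_closed _ OP u); auto.
  - intros p Pp; rewrite (P_plus _ OP) (P_minus _ OP) (P_idem _ OP) Pp1 Pp; auto.
  - intros p p' Pp Pp'; destruct (Hx p Pp) as [Xx Px]; destruct (Hx p' Pp') as [Xx' Px'].
    pose proof (P_increment _ _ s (S_traj (x p)) (S_traj (x p')) Ps) as B.
    simpl in B; rewrite !S_0 Px Px' in B.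
    vreplace (minus (plus p1 (minus p (P (S s (x p))))) (plus p1 (minus p' (P (S s (x p'))))))
      with (opp (minus (minus (P (S s (x p))) (P (S s (x p')))) (minus p p'))).
    rewrite norm_opp_eq; eapply Rle_trans; [exact B |].
    assert (B1 : norm (minus (x p) (x p')) <= 2 * norm (minus p p')).
    { pose proof (CX _ _ Xx Xx') as C; pose proof (norm_PQ_le P (minus (x p) (x p'))) as T.
      rewrite (P_minus _ OP) Px Px' in C T; unfold Q in C; lra. }
    assert (B2 : exp (L * s) <= 3).
    { eapply Rle_trans; [| apply exp_le_3].
      destruct (Rle_lt_or_eq_dec (L * s) 1) as [Lt | ->]; [nra | | lra].
      left; apply exp_increasing; auto. }
    pose proof (exp_pos (L * s)).
    pose proof (norm_pos (minus p p')) as N.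
    assert (B3 : (Lam + L) * exp (L * s) <= (Lam + L) * 3) by (apply Rmult_le_compat_l; lra).
    assert (B4 : (Lam + L) * exp (L * s) * norm (minus (x p) (x p')) <=
      (Lam + L) * 3 * (2 * norm (minus p p')))
      by (apply Rmult_le_compat; auto; [nra | apply norm_pos]).
    apply (Rmult_le_compat_r s) in B4; auto.
    eapply Rle_trans; [exact B4 |]; nra.
  - exists (S s (x p)); split.
    + exists (x p); split; auto; apply Hx; auto.
    + apply minus_eq.
      vreplace (minus (P (S s (x p))) p1) with (minus p (plus p1 (minus p (P (S s (x p)))))).
      rewrite Fp minus_self; auto.
Qed.

(** The admissible short time does not depend on [X], and images keep the cone condition, so equal
    short steps reach any [t]. *)
Lemma full_image t X : 0 <= t -> cone 1 X -> full X -> full (image t X).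
Proof.
  intros Pt CX FX.
  destruct (INR_unbounded (t * (12 * (Lam + L)))) as [n Hn].
  assert (Pn : 0 < INR n) by nra.
  set (s := t / INR n).
  assert (Ps : 0 <= s) by (apply Rmult_le_pos; auto; left; apply Rinv_0_lt_compat; auto).
  assert (Hs : s * (12 * (Lam + L)) <= 1).
  { apply (Rmult_le_reg_r (INR n)); auto.
    replace (s * (12 * (Lam + L)) * INR n) with (t * (12 * (Lam + L)))
      by (unfold s; field; lra); lra. }
  assert (I : forall m, cone 1 (image (INR m * s) X) /\ full (image (INR m * s) X)).
  { induction m as [| m [C1 F1]].
    - simpl; rewrite Rmult_0_l; split.
      + apply cone_image; auto; nra.
      + intros p Pp; destruct (FX p Pp) as [u [Xu Pu]]; exists u; split; auto.
        exists u; auto.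
    - assert (Pm : 0 <= INR m * s) by (apply Rmult_le_pos; auto; apply pos_INR).
      rewrite S_INR Rmult_plus_distr_r Rmult_1_l; split.
      + apply cone_image; auto; nra.
      + intros p Pp; destruct (full_image_small s _ Ps Hs C1 F1 p Pp) as [u [[w [[w' [Xw' ->]] ->]] Pu]].
        exists (S s (S (INR m * s) w')); split; auto.
        exists w'; split; auto; symmetry; apply S_plus; auto. }
  destruct (I n) as [_ Fn]; replace (INR n * s) with t in Fn; auto.
  unfold s; field; lra.
Qed.

(** * The limit of the flat slices *)

Definition slice T : H -> Prop := image T (fun p => P p = p).

(** The lower limit of the slices in the sense of Kuratowski. Stated for sets rather than for graph
    maps, it passes directly through the flow and through limits. *)
Definition manifold : H -> Prop := fun u => forall e, 0 < e ->
  exists T0, 0 <= T0 /\ forall T, T0 <= T -> exists x, slice T x /\ norm (minus u x) < e.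

Lemma cone_flat k : 0 <= k -> cone k (fun p => P p = p).
Proof.
  intros Pk u u' Pu Pu'; unfold Q; rewrite (Q_minus _ OP) (Q_of_P _ u Pu) (Q_of_P _ u' Pu').
  rewrite minus_self norm_0; apply Rmult_le_pos; auto; apply norm_pos.
Qed.

Lemma slice_cone k T : 0 <= k -> (1 + k) ^ 2 * L <= (alpha - beta) * k -> 0 <= T ->
  cone k (slice T).
Proof. intros; apply cone_image; auto; apply cone_flat; auto. Qed.

Lemma slice_full T : 0 <= T -> full (slice T).
Proof.
  intro PT; apply full_image; auto; [apply cone_flat; lra |].
  intros p Pp; exists p; auto.
Qed.

Lemma alpha_pos : 0 < alpha.
Proof. lra. Qed.

Lemma M_alpha_pos : 0 < M / alpha.
Proof. apply Rdiv_lt_0_compat; [auto | apply alpha_pos]. Qed.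

Lemma S_Q_le R t u : M / alpha <= R -> norm (Q u) <= R -> 0 <= t -> norm (Q (S t u)) <= R.
Proof.
  intros HR Hu Pt; apply (Q_absorbing (fun t => S t u)); auto; rewrite S_0; auto.
Qed.

Lemma Q_slice T x : 0 <= T -> slice T x -> norm (Q x) <= M / alpha.
Proof.
  intros PT [p [Pp ->]]; apply S_Q_le; auto; [lra |].
  unfold Q; rewrite (Q_of_P _ p Pp) norm_0; left; apply M_alpha_pos.
Qed.

Lemma slice_near_history T R x y : 0 <= T -> slice T x -> norm (Q y) <= R ->
  P x = P (S T y) -> norm (minus x (S T y)) <= exp (- (alpha - 2 * L) * T) * R.
Proof.
  intros PT [p [Pp ->]] Hy Px.
  eapply Rle_trans; [apply (squeeze_final _ _ T (S_traj p) (S_traj y) PT Px) |].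
  apply Rmult_le_compat_l; [left; apply exp_pos |].
  unfold qdist; rewrite !S_0; unfold Q; rewrite (Q_minus _ OP) (Q_of_P _ p Pp).
  vreplace (minus (zero : H) (complement_of P y)) with (opp (complement_of P y)).
  rewrite norm_opp_eq; exact Hy.
Qed.

(** A point of the later slice was, [T] before the end, a point of [slice (T' - T)], whose [Q]
    component is at most [M / alpha]; squeezing acts over the remaining time [T]. *)
Lemma slice_dist T T' x x' : 0 <= T <= T' -> slice T x -> slice T' x' -> P x = P x' ->
  norm (minus x x') <= exp (- (alpha - 2 * L) * T) * (M / alpha).
Proof.
  intros HT Sx [p' [Pp' ->]] Px.
  revert Px; replace T' with ((T' - T) + T) by ring; rewrite S_plus; try lra; intro Px.
  apply slice_near_history; auto; [lra |].
  apply (Q_slice (T' - T)); [lra | exists p'; auto].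
Qed.

Lemma slice_decay R e : 0 < e ->
  exists T0, 0 <= T0 /\ forall T, T0 <= T -> exp (- (alpha - 2 * L) * T) * R < e.
Proof.
  intro Pe; destruct (exp_decay (alpha - 2 * L) R e) as [T0 [P0 HT]]; auto; [lra |].
  exists T0; split; auto; intros T HT0; rewrite Rmult_comm; apply HT; auto.
Qed.

Lemma history_manifold R u :
  (forall T, 0 <= T -> exists y, norm (Q y) <= R /\ u = S T y) -> manifold u.
Proof.
  intros Hu e Pe; destruct (slice_decay R e Pe) as [T0 [P0 HT]]; exists T0; split; auto.
  intros T HT0; destruct (Hu T ltac:(lra)) as [y [Hy ->]].
  destruct (slice_full T ltac:(lra) (P (S T y)) (P_idem _ OP _)) as [x [Sx Px]].
  exists x; split; auto; rewrite norm_minus_sym.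
  eapply Rle_lt_trans; [apply (slice_near_history T R) | apply HT]; auto; lra.
Qed.

Lemma manifold_closed (w : nat -> H) u : (forall n, manifold (w n)) -> converges w u -> manifold u.
Proof.
  intros Mw Cw e Pe; destruct (Cw (e / 2)) as [N HN]; [lra |].
  destruct (Mw N (e / 2)) as [T0 [P0 HT]]; [lra |].
  exists T0; split; auto; intros T HT0; destruct (HT T HT0) as [x [Sx Hx]].
  exists x; split; auto; pose proof (norm_minus_triangle (w N) u x) as B.
  specialize (HN N (le_n _)); rewrite (norm_minus_sym u (w N)) in B; lra.
Qed.

(** The points over [p] in the slices at integer times form a Cauchy sequence. Its limit is close to
    the slice at a real time [T] by comparison with a later integer slice. *)
Lemma manifold_full : full manifold.
Proof.
  intros p Pp.
  destruct (choice (fun (n : nat) x => slice (INR n) x /\ P x = p)) as [x Hx].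
  { intro n; apply slice_full; auto; apply pos_INR. }
  destruct (cauchy_of_exp x (alpha - 2 * L) (M / alpha)) as [u Hu]; [lra | |].
  { intros n m nm; rewrite Rmult_comm; apply (slice_dist _ (INR m)); try apply Hx.
    - split; [apply pos_INR | apply le_INR; auto].
    - transitivity p; [| symmetry]; apply Hx. }
  assert (Pu : P u = p).
  { apply minus_eq.
    rewrite -{1}Pp -(P_minus _ OP); apply (kernel_closed _ OP (fun n => minus (x n) p)).
    - intro n; rewrite (P_minus _ OP) Pp (proj2 (Hx n)); vec.
    - intros e Pe; destruct (Hu e Pe) as [N HN]; exists N; intros n Hn.
      vreplace (minus (minus (x n) p) (minus u p)) with (minus (x n) u); auto. }
  exists u; split; auto; intros e Pe.
  destruct (slice_decay (M / alpha) (e / 2)) as [T0 [P0 HT]]; [lra |].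
  exists T0; split; auto; intros T HT0.
  destruct (slice_full T ltac:(lra) p Pp) as [y [Sy Py]].
  exists y; split; auto.
  destruct (Hu (e / 2)) as [N HN]; [lra |]; destruct (INR_unbounded T) as [n0 Hn0].
  set (n := max N n0); specialize (HN n (Nat.le_max_l _ _)).
  assert (Tn : T <= INR n).
  { pose proof (le_INR n0 n (Nat.le_max_r _ _)); lra. }
  pose proof (slice_dist T (INR n) y (x n) (conj (Rle_trans _ _ _ P0 HT0) Tn) Sy
    (proj1 (Hx n)) (eq_trans Py (eq_sym (proj2 (Hx n))))) as B1.
  pose proof (HT T HT0) as B2.
  pose proof (norm_minus_triangle (x n) u y) as B3.
  rewrite (norm_minus_sym u (x n)) (norm_minus_sym (x n) y) in B3; lra.
Qed.

Lemma manifold_cone k : 0 <= k -> (1 + k) ^ 2 * L <= (alpha - beta) * k -> cone k manifold.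
Proof.
  intros Pk Hk u u' Mu Mu'; apply Rle_plus_epsilon; intros e Pe.
  (* Two approximation errors occur, and their sum enters once through [Q] and [k] times through
     [P]. *)
  assert (Pd : 0 < e / (2 * (1 + k))) by (apply Rdiv_lt_0_compat; lra).
  destruct (Mu _ Pd) as [T0 [P0 HT]]; destruct (Mu' _ Pd) as [T0' [P0' HT']].
  set (T := Rmax T0 T0').
  destruct (HT T (Rmax_l _ _)) as [x [Sx Hx]]; destruct (HT' T (Rmax_r _ _)) as [x' [Sx' Hx']].
  assert (PT : 0 <= T) by (eapply Rle_trans; [exact P0 | apply Rmax_l]).
  pose proof (slice_cone k T Pk Hk PT x x' Sx Sx') as C.
  set (d := minus (minus u u') (minus x x')).
  assert (Hd : norm d <= e / (1 + k)).
  { vreplace d with (minus (minus u x) (minus u' x')).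
    eapply Rle_trans; [apply norm_minus_le |].
    replace (e / (1 + k)) with (e / (2 * (1 + k)) + e / (2 * (1 + k))) by (field; lra); lra. }
  assert (B1 : norm (Q (minus u u')) <= norm (Q (minus x x')) + norm d).
  { eapply Rle_trans; [apply (norm_le_minus _ (Q (minus x x'))) |]; apply Rplus_le_compat_l.
    unfold Q; rewrite -(Q_minus _ OP); apply Q_le; auto. }
  assert (B2 : norm (P (minus x x')) <= norm (P (minus u u')) + norm d).
  { eapply Rle_trans; [apply (norm_le_minus _ (P (minus u u'))) |]; apply Rplus_le_compat_l.
    rewrite norm_minus_sym -(P_minus _ OP); apply P_le; auto. }
  assert (B3 : (1 + k) * norm d <= e).
  { replace e with ((1 + k) * (e / (1 + k))) by (field; lra).
    apply Rmult_le_compat_l; lra. }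
  apply (Rmult_le_compat_l k) in B2; auto; lra.
Qed.

Lemma manifold_unique u u' : manifold u -> manifold u' -> P u = P u' -> u = u'.
Proof.
  intros Mu Mu' E1; apply minus_eq, norm_zero_eq, Rle_antisym; [| apply norm_pos].
  pose proof (manifold_cone 1 ltac:(lra) ltac:(nra) u u' Mu Mu') as C.
  pose proof (norm_PQ_le P (minus u u')) as T; unfold Q in C.
  rewrite (P_minus _ OP) E1 minus_self norm_0 in C T; canon; lra.
Qed.

Lemma Q_manifold u : manifold u -> norm (Q u) <= M / alpha.
Proof.
  intro Mu; apply Rle_plus_epsilon; intros e Pe; destruct (Mu e Pe) as [T0 [P0 HT]].
  destruct (HT T0 (Rle_refl _)) as [x [Sx Hx]].
  pose proof (Q_slice T0 x P0 Sx); pose proof (norm_le_minus (Q u) (Q x)) as B.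
  unfold Q in B at 3 4; rewrite -(Q_minus _ OP) in B.
  pose proof (Q_le _ OP (minus u x)); canon; lra.
Qed.

Lemma S_manifold t u : 0 <= t -> manifold u -> manifold (S t u).
Proof.
  intros Pt Mu e Pe; pose proof (exp_pos (L * t)).
  destruct (Mu (e / exp (L * t))) as [T0 [P0 HT]]; [apply Rdiv_lt_0_compat; auto |].
  exists (T0 + t); split; [lra |]; intros T HT0.
  destruct (HT (T - t) ltac:(lra)) as [x [[p [Pp ->]] Hx]].
  exists (S T p); split; [exists p; auto |].
  replace T with ((T - t) + t) at 1 by ring; rewrite S_plus; try lra.
  eapply Rle_lt_trans; [apply S_lip; auto |].
  replace e with (exp (L * t) * (e / exp (L * t))) by (field; lra).
  apply Rmult_lt_compat_l; auto.
Qed.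

Lemma manifold_preimage t p : 0 <= t -> P p = p -> exists w, manifold w /\ P (S t w) = p.
Proof.
  intros Pt Pp.
  destruct (full_image t manifold Pt (manifold_cone 1 ltac:(lra) ltac:(nra)) manifold_full p Pp)
    as [u [[w [Mw ->]] Pu]]; exists w; auto.
Qed.

(** For the backward inclusion, a point of the manifold whose image has the right [P] component
    suffices: the image lies on the manifold, where [P] is injective. *)
Lemma manifold_invariant : invariant S manifold.
Proof.
  intros t Pt u; split.
  - intro Mu; destruct (manifold_preimage t (P u) Pt (P_idem _ OP u)) as [w [Mw Pw]].
    exists w; split; auto; apply manifold_unique; auto; apply S_manifold; auto.
  - intros [w [Mw ->]]; apply S_manifold; auto.
Qed.

Lemma compact_bounded (K : H -> Prop) : compact_set K -> bounded_set K.
Proof.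
  intro CK; apply NNPP; intro N.
  destruct (choice (fun (n : nat) u => K u /\ INR n < norm u)) as [u Hu].
  { intro n; apply NNPP; intro N'; apply N; exists (INR n); intros u Ku.
    apply Rnot_lt_le; intro Lu; apply N'; exists u; auto. }
  destruct (CK u (fun n => proj1 (Hu n))) as [l [_ [phi [Mphi Hl]]]].
  assert (Gphi : forall n, (n <= phi n)%nat).
  { induction n; [lia |]; specialize (Mphi n (Datatypes.S n) (Nat.lt_succ_diag_r n)); lia. }
  rewrite (filterlim_locally_ball_norm (K := R_AbsRing) (U := H)) in Hl.
  destruct (Hl (mkposreal 1 Rlt_0_1)) as [N1 HN].
  destruct (INR_unbounded (norm l + 1)) as [N2 HN2].
  set (n := max N1 N2); specialize (HN n (Nat.le_max_l _ _)).
  change (norm (minus (u (phi n)) l) < 1) in HN.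
  pose proof (norm_le_minus (u (phi n)) l) as B.
  destruct (Hu (phi n)) as [_ Hn].
  assert (INR N2 <= INR (phi n)) by (apply le_INR; specialize (Gphi n); lia).
  canon; lra.
Qed.

(** Invariance gives every point of [K] a past of any length inside [K], and compactness bounds
    these pasts. *)
Lemma attractor_manifold K : global_attractor S K -> forall u, K u -> manifold u.
Proof.
  intros [CK [IK _]] u Ku; destruct (compact_bounded K CK) as [R HR].
  apply (history_manifold R); intros T PT.
  destruct (proj1 (IK T PT u) Ku) as [y [Ky ->]]; exists y; split; auto.
  eapply Rle_trans; [apply Q_le; auto | auto].
Qed.

(** * Exponential tracking *)

Lemma tracking u0 : exists w0, manifold w0 /\ forall t, 0 <= t ->
  norm (minus (S t u0) (S t w0)) <= 2 * exp (- (alpha - 2 * L) * t) * norm (minus u0 w0).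
Proof.
  destruct (choice (fun (n : nat) w => manifold w /\ P (S (INR n) w) = P (S (INR n) u0)))
    as [w Hw].
  { intro n; apply manifold_preimage; [apply pos_INR | apply P_idem; auto]. }
  set (kap := alpha - 2 * L).
  (* Only the [Q] components of [u0 - w n] are bounded uniformly beforehand; squeezing asks for no
     control of the [P] components. *)
  set (R := norm (Q u0) + M / alpha).
  assert (PR : 0 <= R).
  { unfold R; pose proof (norm_pos (Q u0)); pose proof M_alpha_pos; lra. }
  assert (HR : forall n, norm (Q (minus u0 (w n))) <= R).
  { intro n; unfold Q; rewrite (Q_minus _ OP); eapply Rle_trans; [apply norm_minus_le |].
    apply Rplus_le_compat_l, Q_manifold, Hw. }
  assert (Sq : forall (n : nat) t, 0 <= t <= INR n ->
    norm (minus (S t u0) (S t (w n))) <= 2 * exp (- kap * t) * norm (Q (minus u0 (w n)))).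
  { intros n t Ht.
    destruct (squeeze _ _ (INR n) (S_traj u0) (S_traj (w n)) (pos_INR n)
      (eq_sym (proj2 (Hw n))) t Ht) as [B1 B2].
    eapply Rle_trans; [apply (dist_le (fun t => S t u0) (fun t => S t (w n))) |].
    unfold qdist in B2 at 2; rewrite !S_0 in B2; unfold kap; lra. }
  (* At time [n] both [w n] and [w m] are within [2 R exp (- kap n)] of [u0]. Returning to time 0 by
     [cone_lower] costs [exp ((beta + 2 L) n)], and the cone doubles [4 R]. *)
  destruct (cauchy_of_exp w (alpha - beta - 4 * L) (8 * R)) as [w0 Hw0]; [lra | |].
  { intros n m nm; destruct (Hw n) as [Mn Pn]; destruct (Hw m) as [Mm Pm].
    pose proof (pos_INR n) as Pn0.
    pose proof (le_INR n m nm) as nm'.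
    pose proof (manifold_cone 1 ltac:(lra) ltac:(nra) _ _ Mn Mm) as C.
    pose proof (cone_lower _ _ (S_traj (w n)) (S_traj (w m)) (INR n) Pn0) as CL.
    unfold pdist, qdist in CL; rewrite !S_0 in CL; specialize (CL ltac:(lra)).
    assert (B : norm (P (minus (S (INR n) (w n)) (S (INR n) (w m)))) <= 4 * exp (- kap * INR n) * R).
    { eapply Rle_trans; [apply P_le; auto |].
      eapply Rle_trans; [apply (norm_minus_triangle (S (INR n) u0)) |].
      rewrite (norm_minus_sym (S (INR n) (w n))).
      pose proof (Sq n (INR n) ltac:(lra)) as S1; pose proof (Sq m (INR n) ltac:(lra)) as S2.
      pose proof (HR n); pose proof (HR m); pose proof (exp_pos (- kap * INR n)).
      assert (exp (- kap * INR n) * norm (Q (minus u0 (w n))) <= exp (- kap * INR n) * R)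
        by (apply Rmult_le_compat_l; lra).
      assert (exp (- kap * INR n) * norm (Q (minus u0 (w m))) <= exp (- kap * INR n) * R)
        by (apply Rmult_le_compat_l; lra).
      lra. }
    assert (B2 : norm (P (minus (w n) (w m))) <= 4 * R * exp (- (alpha - beta - 4 * L) * INR n)).
    { replace (- (alpha - beta - 4 * L) * INR n)
        with (- (- (beta + 2 * L) * INR n) + - kap * INR n) by (unfold kap; ring).
      rewrite exp_plus exp_Ropp; set (q := exp (- (beta + 2 * L) * INR n)) in *.
      assert (Pq : 0 < q) by apply exp_pos.
      apply (Rmult_le_reg_l q); auto.
      replace (q * (4 * R * (/ q * exp (- kap * INR n)))) with (4 * exp (- kap * INR n) * R)
        by (field; lra); lra. }
    pose proof (norm_PQ_le P (minus (w n) (w m))) as T; unfold Q in C; canon; lra. }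
  exists w0; split; [apply (manifold_closed w); auto; intro; apply Hw |].
  intros t Pt; fold kap; apply Rle_plus_epsilon; intros e Pe.
  (* Replacing [w n] by its limit costs [exp (L * t) * d] on the left-hand side and
     [2 * exp (- kap * t) * d] on the right-hand side. *)
  set (B := exp (L * t) + 2 * exp (- kap * t)).
  pose proof (exp_pos (L * t)) as P1; pose proof (exp_pos (- kap * t)) as P2.
  assert (PB : 0 < B) by (unfold B; lra).
  destruct (Hw0 (e / B)) as [N HN]; [apply Rdiv_lt_0_compat; auto |].
  destruct (INR_unbounded t) as [n0 Hn0]; set (n := max N n0).
  specialize (HN n (Nat.le_max_l _ _)).
  pose proof (le_INR n0 n (Nat.le_max_r _ _)) as Hn.
  pose proof (Sq n t ltac:(lra)) as S1.
  pose proof (Q_le _ OP (minus u0 (w n))) as S2; fold Q in S2.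
  pose proof (S_lip t (w n) w0 Pt) as S3.
  pose proof (norm_minus_triangle (S t (w n)) (S t u0) (S t w0)) as S4.
  pose proof (norm_minus_triangle w0 u0 (w n)) as S5.
  rewrite (norm_minus_sym w0 (w n)) in S5.
  set (d := norm (minus (w n) w0)) in *.
  assert (Hd : B * d <= e).
  { replace e with (B * (e / B)) by (field; lra); apply Rmult_le_compat_l; lra. }
  assert (S6 : norm (Q (minus u0 (w n))) <= norm (minus u0 w0) + d) by (canon; lra).
  apply (Rmult_le_compat_l (2 * exp (- kap * t))) in S6; [| lra].
  unfold B in Hd; lra.
Qed.

(** * The reduced equation *)

Context (A_minus : forall p q, P p = p -> P q = q -> A (minus p q) = minus (A p) (A q))
  (A_nonneg : forall p, P p = p -> 0 <= inner (A p) p).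

Lemma derivative_halfline_iff (p : R -> H) t l : 0 <= t ->
  derivative_on_halfline p t l <->
  forall e, 0 < e -> exists d, 0 < d /\ forall s, 0 <= s -> Rabs (s - t) < d ->
    norm (minus (minus (p s) (p t)) (scal (s - t) l)) <= e * Rabs (s - t).
Proof.
  intro Pt; unfold derivative_on_halfline.
  rewrite (filterlim_locally_ball_norm (K := R_AbsRing) (U := H)).
  assert (Eq : forall s, s <> t -> norm (minus (minus (p s) (p t)) (scal (s - t) l)) =
    Rabs (s - t) * norm (minus (scal (/ (s - t)) (minus (p s) (p t))) l)).
  { intros s Ns; rewrite -norm_scal_eq; f_equal; vec; lra. }
  split.
  - intros Hl e Pe; destruct (Hl (mkposreal e Pe)) as [d Hd]; exists d; split; [apply cond_pos |].
    intros s Ps Hs; destruct (Req_dec s t) as [-> | Ns].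
    + rewrite Rminus_diag Rabs_R0 Rmult_0_r.
      vreplace (minus (minus (p t) (p t)) (scal 0 l)) with (zero : H); rewrite norm_0; lra.
    + rewrite Eq // Rmult_comm; apply Rmult_le_compat_r; [apply Rabs_pos |].
      left; apply (Hd s); auto.
  - intros Hl e; pose proof (cond_pos e) as Pe.
    destruct (Hl (e / 2)) as [d [Pd Hd]]; [lra |].
    exists (mkposreal d Pd); intros s Hs Ns Ps; specialize (Hd s Ps Hs).
    rewrite Eq // in Hd; assert (0 < Rabs (s - t)) by (apply Rabs_pos_lt; lra).
    change (norm (minus (scal (/ (s - t)) (minus (p s) (p t))) l) < e).
    apply (Rmult_lt_reg_l (Rabs (s - t))); auto.
    eapply Rle_lt_trans; [exact Hd |]; nra.
Qed.

Lemma derivative_right_diff p t (l : H) : 0 <= t -> derivative_on_halfline p t l -> right_diff p t l.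
Proof.
  intros Pt Hl e Pe; destruct (proj1 (derivative_halfline_iff p t l Pt) Hl e Pe) as [d [Pd Hd]].
  apply (at_right_0_intro _ d); auto; intros r Hr.
  specialize (Hd (t + r) ltac:(lra)); replace (t + r - t) with r in Hd by ring.
  rewrite Rabs_pos_eq in Hd; [apply Hd |]; lra.
Qed.

Lemma derivative_vcont p : (forall t, 0 <= t -> exists l : H, derivative_on_halfline p t l) -> vcont p.
Proof.
  intros Hp t Pt e Pe; destruct (Hp t Pt) as [l Hl].
  destruct (proj1 (derivative_halfline_iff p t l Pt) Hl 1 Rlt_0_1) as [d [Pd Hd]].
  pose proof (norm_pos l) as Nl.
  exists (Rmin d (e / (norm l + 1))); split; [apply Rmin_pos; auto; apply Rdiv_lt_0_compat; lra |].
  intros s Ps Hs; pose proof (Rmin_l d (e / (norm l + 1))); pose proof (Rmin_r d (e / (norm l + 1))).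
  specialize (Hd s Ps ltac:(lra)).
  pose proof (norm_le_minus (minus (p s) (p t)) (scal (s - t) l)) as T; rewrite norm_scal_eq in T.
  assert (B : norm (minus (p s) (p t)) <= (norm l + 1) * Rabs (s - t)) by (canon; lra).
  eapply Rle_lt_trans; [exact B |].
  replace e with ((norm l + 1) * (e / (norm l + 1))) by (field; lra).
  apply Rmult_lt_compat_l; lra.
Qed.

(** The right derivative [l s] exists at every time and is continuous, so the mean value estimate on
    intervals ending or starting at [t] gives a two-sided derivative. *)
Lemma trajectory_P_derivative v t : traj v -> 0 <= t ->
  derivative_on_halfline (fun s => P (v s)) t (minus (P (F (v t))) (A (P (v t)))).
Proof.
  intros Tv Pt; apply derivative_halfline_iff; auto; intros e Pe.
  set (l := fun s => minus (P (F (v s))) (A (P (v s)))); fold (l t).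
  assert (PC : 0 < L + Lam) by lra.
  destruct (proj1 Tv t Pt (e / (L + Lam))) as [d [Pd Hd]]; [apply Rdiv_lt_0_compat; lra |].
  assert (Cl : forall s, 0 <= s -> Rabs (s - t) < d -> norm (minus (l s) (l t)) <= e).
  { intros s Ps Hs; unfold l.
    vreplace (minus (minus (P (F (v s))) (A (P (v s)))) (minus (P (F (v t))) (A (P (v t)))))
      with (minus (minus (P (F (v s))) (P (F (v t)))) (minus (A (P (v s))) (A (P (v t))))).
    rewrite -(P_minus _ OP) -A_minus; try apply (P_idem _ OP).
    rewrite -(P_minus _ OP (v s)).
    eapply Rle_trans; [apply norm_minus_le |].
    pose proof (P_le _ OP (minus (F (v s)) (F (v t)))) as B1; pose proof (F_lip (v s) (v t)) as B2.
    pose proof (A_le _ (P_idem _ OP (minus (v s) (v t)))) as B3.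
    pose proof (P_le _ OP (minus (v s) (v t))) as B4; specialize (Hd s Ps Hs).
    assert (B5 : Lam * norm (P (minus (v s) (v t))) <= Lam * norm (minus (v s) (v t)))
      by (apply Rmult_le_compat_l; lra).
    apply Rle_trans with ((L + Lam) * norm (minus (v s) (v t))); [canon; lra |].
    replace e with ((L + Lam) * (e / (L + Lam))) by (field; lra).
    apply Rmult_le_compat_l; lra. }
  assert (Cp : vcont (fun s => P (v s))) by (apply (vcont_lip P 1); [apply P_lip; auto | apply Tv]).
  assert (MV : forall a b, 0 <= a <= b -> (forall s, a <= s < b -> Rabs (s - t) < d) ->
    norm (minus (minus (P (v b)) (P (v a))) (scal (b - a) (l t))) <= e * (b - a)).
  { intros a b Hab Hd'; apply (right_diff_mean_value (fun s => P (v s)) (l t) l); auto.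
    intros s Hs; split; [apply euler_P, (proj2 Tv); lra | apply Cl; [lra | auto]]. }
  exists d; split; auto; intros s Ps Hs; destruct (Rle_lt_dec t s) as [Lt | Lt].
  - rewrite (Rabs_pos_eq (s - t)) in Hs *; [| lra]; apply MV; [lra |].
    intros s' Hs'; rewrite Rabs_pos_eq; lra.
  - rewrite Rabs_minus_sym (Rabs_pos_eq (t - s)) in Hs *; try lra.
    vreplace (minus (minus (P (v s)) (P (v t))) (scal (s - t) (l t)))
      with (opp (minus (minus (P (v t)) (P (v s))) (scal (t - s) (l t)))).
    rewrite norm_opp_eq; apply MV; [lra |].
    intros s' Hs'; rewrite Rabs_minus_sym Rabs_pos_eq; lra.
Qed.

Section Graph.

Context {h : H -> H} (h_manifold : forall p, P p = p -> manifold (plus p (h p)))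
  (h_Q : forall p, P p = p -> P (h p) = zero).

Lemma P_graph p : P p = p -> P (plus p (h p)) = p.
Proof. intro Pp; rewrite (P_plus _ OP) Pp h_Q //; vec. Qed.

Lemma manifold_graph u : manifold u <-> graph_over (range P) h u.
Proof.
  split.
  - intro Mu; exists (P u); split; [exists u; auto |].
    apply manifold_unique; auto; [apply h_manifold, (P_idem _ OP) |].
    rewrite P_graph; [| apply (P_idem _ OP)]; auto.
  - intros [p [Vp ->]]; apply h_manifold, (range_P _ OP); auto.
Qed.

Lemma reduced_forward p : (forall t, 0 <= t -> P (p t) = p t) ->
  (forall t, 0 <= t -> S t (plus (p 0) (h (p 0))) = plus (p t) (h (p t))) ->
  forall t, 0 <= t ->
    derivative_on_halfline p t (minus (P (F (plus (p t) (h (p t))))) (A (p t))).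
Proof.
  intros Pp Sp t Pt; set (v := fun t => S t (plus (p 0) (h (p 0)))).
  assert (Ev : forall s, 0 <= s -> P (v s) = p s).
  { intros s Ps; unfold v; rewrite Sp // P_graph; auto. }
  pose proof (trajectory_P_derivative v t (S_traj _) Pt) as Dv.
  rewrite (Ev t Pt) in Dv; unfold v at 2 in Dv; rewrite Sp // in Dv.
  rewrite derivative_halfline_iff // in Dv; rewrite derivative_halfline_iff //.
  intros e Pe; destruct (Dv e Pe) as [d [Pd Hd]]; exists d; split; auto.
  intros s Ps Hs; specialize (Hd s Ps Hs); rewrite !Ev // in Hd.
Qed.

(** Energy estimate for [d = p - q]: the term with [A] has a favorable sign, and by the cone the
    points on the graph differ by at most [2 * norm d], so the squared norm grows at a rate of at
    most [4 L]. *)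
Lemma reduced_unique p q : (forall t, 0 <= t -> P (p t) = p t) -> (forall t, 0 <= t -> P (q t) = q t) ->
  (forall t, 0 <= t -> derivative_on_halfline p t (minus (P (F (plus (p t) (h (p t))))) (A (p t)))) ->
  (forall t, 0 <= t -> derivative_on_halfline q t (minus (P (F (plus (q t) (h (q t))))) (A (q t)))) ->
  p 0 = q 0 -> forall t, 0 <= t -> p t = q t.
Proof.
  intros Pp Pq Dp Dq E0 t Pt; apply minus_eq, norm_zero_eq.
  assert (B : norm (minus (p t) (q t)) ^ 2 <= exp (4 * L * t) * norm (minus (p 0) (q 0)) ^ 2).
  { apply (dini_gronwall (fun s => norm (minus (p s) (q s)) ^ 2)); auto.
    - apply rcont_sq, vcont_norm, vcont_minus; apply derivative_vcont; intros s Ps; eexists; eauto.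
    - intros s Hs; assert (Ps : 0 <= s) by lra.
      eapply dini_le_weaken; [| apply right_diff_sq, right_diff_minus;
        apply derivative_right_diff; auto].
      set (d := minus (p s) (q s)).
      set (u := plus (p s) (h (p s))); set (u' := plus (q s) (h (q s))).
      assert (Pd : P d = d) by (unfold d; rewrite (P_minus _ OP) Pp // Pq //).
      vreplace (minus (minus (P (F u)) (A (p s))) (minus (P (F u')) (A (q s))))
        with (minus (minus (P (F u)) (P (F u'))) (minus (A (p s)) (A (q s)))).
      rewrite -A_minus; auto; rewrite -(P_minus _ OP); fold d.
      pose proof (A_nonneg d Pd) as An.
      pose proof (inner_le d (P (minus (F u) (F u')))) as I1.
      pose proof (P_le _ OP (minus (F u) (F u'))) as I2; pose proof (F_lip u u') as I3.
      assert (Ed : P (minus u u') = d).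
      { unfold u, u'; rewrite (P_minus _ OP) !P_graph; auto. }
      pose proof (manifold_cone 1 ltac:(lra) ltac:(nra) u u' (h_manifold _ (Pp s Ps))
        (h_manifold _ (Pq s Ps))) as C.
      pose proof (norm_PQ_le P (minus u u')) as T; unfold Q in C; rewrite Ed in C T.
      rewrite inner_minus_r (inner_sym _ d (A d)).
      pose proof (norm_pos d) as Nd.
      assert (I4 : norm (P (minus (F u) (F u'))) <= 2 * L * norm d) by (canon; nra).
      apply (Rmult_le_compat_l (norm d)) in I4; auto; canon; nra. }
  rewrite E0 minus_self norm_0 in B; pose proof (norm_pos (minus (p t) (q t))).
  nra.
Qed.

(** The [P] component of the true trajectory solves the reduced equation with the same initial
    value, hence equals [p]. *)
Lemma reduced_backward p : (forall t, 0 <= t -> P (p t) = p t) ->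
  (forall t, 0 <= t ->
    derivative_on_halfline p t (minus (P (F (plus (p t) (h (p t))))) (A (p t)))) ->
  forall t, 0 <= t -> S t (plus (p 0) (h (p 0))) = plus (p t) (h (p t)).
Proof.
  intros Pp Dp; set (q := fun t => P (S t (plus (p 0) (h (p 0))))).
  assert (q0 : q 0 = p 0) by (unfold q; rewrite S_0 P_graph //; apply Pp; lra).
  assert (Pq : forall t, 0 <= t -> P (q t) = q t) by (intros; apply (P_idem _ OP)).
  assert (Sq : forall t, 0 <= t -> S t (plus (p 0) (h (p 0))) = plus (q t) (h (q t))).
  { intros t Pt; apply manifold_unique.
    - apply S_manifold; auto; apply h_manifold, Pp; lra.
    - apply h_manifold, Pq; auto.
    - rewrite P_graph; auto. }
  assert (Dq := reduced_forward q Pq).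
  rewrite q0 in Dq; specialize (Dq Sq).
  intros t Pt; rewrite Sq // (reduced_unique p q Pp Pq Dp Dq) //.
Qed.

End Graph.

Lemma invariant_graph : exists h : H -> H,
  (forall p, P p = p -> P (h p) = zero /\ norm (h p) <= M / alpha) /\
  lipschitz_on (range P) h (4 * L / (alpha - beta)) /\
  invariant S (graph_over (range P) h) /\
  (forall K, global_attractor S K -> forall u, K u -> graph_over (range P) h u) /\
  exponential_tracking S (graph_over (range P) h) /\
  (forall p : R -> H, (forall t, 0 <= t -> P (p t) = p t) ->
     (forall t, 0 <= t -> S t (plus (p 0) (h (p 0))) = plus (p t) (h (p t))) <->
     (forall t, 0 <= t ->
        derivative_on_halfline p t (minus (P (F (plus (p t) (h (p t))))) (A (p t))))).
Proof.
  destruct (choice (fun p u => P p = p -> manifold u /\ P u = p)) as [g Hg].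
  { intro p; destruct (classic (P p = p)) as [Pp | N].
    - destruct (manifold_full p Pp) as [u Hu]; exists u; auto.
    - exists zero; intro; contradiction. }
  set (h := fun p => Q (g p)).
  assert (Eg : forall p, P p = p -> plus p (h p) = g p).
  { intros p Pp; destruct (Hg p Pp) as [_ Pg]; unfold h, Q; rewrite -{1}Pg; apply PQ_sum. }
  assert (hM : forall p, P p = p -> manifold (plus p (h p)))
    by (intros p Pp; rewrite Eg //; apply Hg; auto).
  assert (hQ : forall p, P p = p -> P (h p) = zero) by (intros; apply (PQ _ OP)).
  assert (GM := manifold_graph hM hQ).
  assert (Inv : invariant S (graph_over (range P) h)).
  { intros t Pt u; rewrite -GM (manifold_invariant t Pt u).
    split; intros [w [Mw ->]]; exists w; split; auto; apply GM; auto. }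
  exists h; split; [| split; [| split; [| split; [| split]]]]; auto.
  - intros p Pp; split; auto; apply Q_manifold, Hg; auto.
  - intros p q Vp Vq; apply (range_P _ OP) in Vp; apply (range_P _ OP) in Vq.
    (* The gap makes [k <= 1 / 2], so [(1 + k) ^ 2 * L <= 4 * L = (alpha - beta) * k], which is the
       cone condition. *)
    set (k := 4 * L / (alpha - beta)).
    assert (Pk : 0 <= k) by (left; apply Rdiv_lt_0_compat; lra).
    assert (Ek : (alpha - beta) * k = 4 * L) by (unfold k; field; lra).
    assert (Hk : k <= 1 / 2) by (apply (Rmult_le_reg_l (alpha - beta)); lra).
    assert (Hk2 : (1 + k) ^ 2 <= 4) by nra.
    assert (Hk3 : (1 + k) ^ 2 * L <= (alpha - beta) * k)
      by (rewrite Ek; apply Rmult_le_compat_r; lra).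
    pose proof (manifold_cone k Pk Hk3 _ _ (hM p Vp) (hM q Vq)) as C.
    rewrite (P_minus _ OP) !(P_graph hQ) // in C.
    unfold Q in C; rewrite (Q_minus _ OP) in C.
    assert (EQ : forall p, P p = p -> complement_of P (plus p (h p)) = h p).
    { intros x Px; unfold complement_of; rewrite (P_graph hQ) //; vec. }
    rewrite !EQ // in C.
  - intros K GK u Ku; apply GM; apply (attractor_manifold K); auto.
  - exists 2, (alpha - 2 * L); split; [lra |]; split; [lra |].
    intro u0; destruct (tracking u0) as [w0 [Mw Hw]]; exists w0; split; auto; apply GM; auto.
  - intros p Pp; split.
    + apply reduced_forward; auto.
    + apply reduced_backward; auto.
Qed.

End Dynamics.

(** * The renormalized operator *)

Section Renormalized.

Context {H : HilbertSpace} {D : H -> Prop} {A P : H -> H} {eps : R}.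
Context (SA : self_adjoint D A) (NN : nonnegative D A) (eps_pos : 0 < eps)
  (OP : orthoprojector P) (DP : forall u, D (P u)) (AP : forall u, D u -> P (A u) = A (P u)).

Lemma renormalized_minus x y : D x -> D y ->
  renormalized A P eps (minus x y) =
  minus (renormalized A P eps x) (renormalized A P eps y).
Proof.
  intros Dx Dy; unfold renormalized; rewrite (A_minus SA) // (Q_minus _ OP); vec.
Qed.

Lemma renormalized_P x : D x -> P (renormalized A P eps x) = renormalized A P eps (P x).
Proof.
  intro Dx; unfold renormalized.
  rewrite (P_plus _ OP) (P_scal _ OP) (PQ _ OP) AP // (Q_of_P _ _ (P_idem _ OP x)); auto.
Qed.

Lemma renormalized_low p : P p = p -> renormalized A P eps p = A p.
Proof. intro Pp; unfold renormalized; rewrite (Q_of_P _ p Pp); vec. Qed.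

Lemma renormalized_nonneg x : D x -> 0 <= inner (renormalized A P eps x) x.
Proof.
  intro Dx; unfold renormalized; rewrite inner_plus_l inner_scal_l.
  pose proof (NN x Dx) as N1; assert (0 < / eps) by (apply Rinv_0_lt_compat; auto).
  assert (N2 : inner (complement_of P x) x = norm (complement_of P x) ^ 2).
  { rewrite -inner_norm -{2}(PQ_sum P x) inner_plus_r.
    rewrite (inner_sym _ _ (P x)) (inner_range_kernel _ OP) ?(P_idem _ OP) ?(PQ _ OP) //; ring. }
  rewrite N2; pose proof (pow2_ge_0 (norm (complement_of P x))); nra.
Qed.

Lemma renormalized_high a q : P q = zero -> a * norm q ^ 2 <= inner (A q) q ->
  (a + / eps) * norm q ^ 2 <= inner (renormalized A P eps q) q.
Proof.
  intros Pq Ha; unfold renormalized; rewrite (Q_of_Q _ q Pq) inner_plus_l inner_scal_l inner_norm.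
  lra.
Qed.

End Renormalized.

Lemma mild_initial {H : HilbertSpace} (E : R -> H -> H) F (u0 : H) v :
  C0_semigroup E -> is_mild_solution E F u0 v -> v 0 = u0.
Proof.
  intros C0 [_ Mv]; destruct (Mv 0 (Rle_refl 0)) as [_ ->].
  rewrite (RInt_point (V := H)) (E_0 C0); apply (plus_zero_r u0).
Qed.

Lemma graph_lipschitz_submanifold {H : HilbertSpace} {P : H -> H} (OP : orthoprojector P) h c n :
  has_dimension (range P) n -> (forall p, P p = p -> P (h p) = zero) ->
  lipschitz_on (range P) h c -> lipschitz_submanifold n (graph_over (range P) h).
Proof.
  intros Dn hQ Lh x Gx; exists (range P), h, c, 1; split; auto; split; [| split; [auto |]].
  - intros p v Vp Vv; rewrite inner_sym.
    apply (inner_range_kernel _ OP); [apply (range_P _ OP); auto |].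
    apply hQ, (range_P _ OP); auto.
  - split; [lra | tauto].
Qed.

Theorem theorem3p2 (H : HilbertSpace)
  (H_infinite : ~ finite_dimensional (@whole H))
  (D : H -> Prop) (A : H -> H)
  (A_self_adjoint : self_adjoint D A)
  (A_nonnegative : nonnegative D A)
  (A_compact_resolvent : compact_resolvent D A)
  (F : H -> H) (M L : R) (M_pos : 0 < M) (L_pos : 0 < L)
  (F_bounded : forall u, norm (F u) <= M)
  (F_lipschitz : forall u w, norm (minus (F u) (F w)) <= L * norm (minus u w))
  (mu : R) (mu_pos : 0 < mu)
  (eps : R) (eps_pos : 0 < eps) (eps_le_1 : eps <= 1)
  (P : H -> H)
  (P_spectral :
     is_spectral_projection D A (fun x => 0 <= x <= cutoff mu eps) P)
  (S : R -> H -> H)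
  (S_semiflow : is_mild_semiflow D (renormalized A P eps) F S)
  (gap : 8 * L <= gamma D A P eps) :
  exists h : H -> H,
    let Meps := graph_over (range P) h in
    (forall p, range P p -> range (complement_of P) (h p)) /\
    finite_dimensional (range P) /\
    inertial_manifold S Meps /\
    (* bounds on the graph map *)
    ((forall p, range P p -> norm (h p) <= M / alpha D A P eps) /\
     M / alpha D A P eps <= M * eps ^ 2 / (mu + eps) /\
     M * eps ^ 2 / (mu + eps) <= M / mu * eps ^ 2) /\
    (lipschitz_on (range P) h (4 * L / gamma D A P eps) /\
     4 * L / gamma D A P eps <= 4 * L * eps) /\
    (* invariance and reduced dynamics *)
    invariant S Meps /\
    (forall p : R -> H, (forall t, 0 <= t -> range P (p t)) ->
       ((forall t, 0 <= t ->
           S t (plus (p 0) (h (p 0))) = plus (p t) (h (p t)))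
        <-> reduced_solution D A P F h p)) /\
    (* exponential tracking *)
    (exists C kappa : R, 1 <= C /\ 0 < kappa /\
       forall u0, exists w0, Meps w0 /\
         forall t, 0 <= t ->
           norm (minus (S t u0) (S t w0))
           <= C * exp (- kappa * t) * norm (minus u0 w0)) /\
    (* attractor *)
    (forall K, global_attractor S K -> forall u, K u -> Meps u).
Proof.
  assert (eps2 : 0 < eps ^ 2) by (apply pow_lt; auto).
  assert (Lam_pos : 0 < cutoff mu eps) by (apply Rdiv_lt_0_compat; auto).
  pose proof (spectral_orthoprojector A_self_adjoint A_compact_resolvent P_spectral) as OP.
  pose proof (D_P A_self_adjoint A_compact_resolvent P_spectral) as DP.
  pose proof (A_P A_self_adjoint A_compact_resolvent P_spectral) as AP.
  destruct (beta_bounds A_self_adjoint A_compact_resolvent Lam_pos P_spectral) as [[b0 bL] _].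
  destruct (lambda_plus_bounds A_self_adjoint A_nonnegative A_compact_resolvent P_spectral H_infinite)
    as [lL lform].
  assert (ie : 0 < / eps) by (apply Rinv_0_lt_compat; auto).
  destruct S_semiflow as [E [[C0 gen] mild]].
  set (G := renormalized A P eps) in *.
  pose proof (D_dense A_self_adjoint) as dense.
  assert (G0 : forall x, D x -> 0 <= inner (G x) x)
    by (intros; apply (renormalized_nonneg A_nonnegative eps_pos OP); auto).
  assert (GP : forall x, D x -> P (G x) = G (P x))
    by (intros; apply (renormalized_P OP AP); auto).
  assert (DM : forall x y, D x -> D y -> D (minus x y))
    by (intros; apply (D_minus A_self_adjoint); auto).
  assert (GM : forall x y, D x -> D y -> G (minus x y) = minus (G x) (G y))
    by (intros; apply (renormalized_minus A_self_adjoint OP); auto).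
  assert (DP' : forall x, D x -> D (P x)) by auto.
  (* The semigroup is that of the renormalized operator, while [A] itself serves on [range P], where
     the two operators agree; the shift [/ eps] enters only through [alpha]. *)
  destruct (invariant_graph OP (E := E) (E_linear C0) (E_contraction C0 gen dense G0)
    (E_P C0 gen dense G0 OP DP' GP DM GM)
    (alpha := alpha D A P eps) (beta := beta D A P) (Lam := cutoff mu eps)
    (E_decay C0 gen dense G0 OP DP' GP DM GM (alpha D A P eps)
      (fun q Dq Pq => renormalized_high _ q Pq (lform q Dq Pq))
      (kernel_dense A_self_adjoint A_compact_resolvent P_spectral))
    (A := A)) with (F := F) (L := L) (M := M) (S := S)
    as [h [hQ [hL [Inv [Att [Trk Red]]]]]]; auto.
  - intros p Pp; rewrite -(renormalized_low (eps := eps) p Pp).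
    apply (gen_D gen); rewrite -Pp; auto.
  - apply (form_range_P A_self_adjoint A_compact_resolvent Lam_pos P_spectral).
  - apply (norm_A_P A_self_adjoint A_compact_resolvent Lam_pos P_spectral).
  - intro u; apply (mild_trajectory C0 gen dense G0 L_pos F_lipschitz u _ (mild u)).
  - intro u; apply (mild_initial E F u _ C0 (mild u)).
  - intros p q Pp Pq; apply (A_minus A_self_adjoint); [rewrite -Pp | rewrite -Pq]; auto.
  - intros p Pp; apply A_nonnegative; rewrite -Pp; auto.
  - assert (Hal : (mu + eps) / eps ^ 2 <= alpha D A P eps).
    { unfold alpha, cutoff in *; replace ((mu + eps) / eps ^ 2) with (mu / eps ^ 2 + / eps)
        by (field; lra); lra. }
    (* The cutoff separates [beta] from [lambda_plus], so the gap is at least the shift. *)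
    assert (Hga : / eps <= gamma D A P eps) by (unfold gamma, alpha; lra).
    destruct (range_P_finite_dimensional A_self_adjoint A_compact_resolvent P_spectral) as [n Hn].
    exists h; intro Meps; split; [| split; [| split; [| split; [| split; [| split; [| split]]]]]]; auto.
    + intros p Vp; apply (range_Q _ OP), hQ, (range_P _ OP); auto.
    + exists n; auto.
    + split; [| auto]; exists n.
      apply (graph_lipschitz_submanifold OP h (4 * L / gamma D A P eps)); auto.
      intros p Pp; apply hQ; auto.
    + split; [| split].
      * intros p Vp; apply hQ, (range_P _ OP); auto.
      * replace (M * eps ^ 2 / (mu + eps)) with (M / ((mu + eps) / eps ^ 2)) by (field; lra).
        apply Rmult_le_compat_l; [lra |]; apply Rinv_le_contravar; auto.
        apply Rdiv_lt_0_compat; lra.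
      * replace (M * eps ^ 2 / (mu + eps)) with (M * eps ^ 2 * / (mu + eps)) by (field; lra).
        replace (M / mu * eps ^ 2) with (M * eps ^ 2 * / mu) by (field; lra).
        apply Rmult_le_compat_l; [nra |]; apply Rinv_le_contravar; lra.
    + split; auto.
      replace (4 * L * eps) with (4 * L / / eps) by (field; lra).
      apply Rmult_le_compat_l; [lra |]; apply Rinv_le_contravar; auto.
    + intros p Vp.
      assert (Pp : forall t, 0 <= t -> P (p t) = p t) by (intros; apply (range_P _ OP); auto).
      rewrite (Red p Pp); split.
      * intros Dp t Pt; split; [auto |]; split; [rewrite -Pp //; auto |].
        eexists; split; [apply Dp; auto | vec].
      * intros Rp t Pt; destruct (Rp t Pt) as [_ [_ [l [Dl El]]]].
        rewrite -El; vreplace (minus (plus l (A (p t))) (A (p t))) with l; auto.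
Qed.
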